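(* Let $X$ be a real Banach space with the Radon–Nikodým property and let $f: X \to \mathbb{R}\cup\{+\infty\}$ be proper, convex and lower semicontinuous with $\mathrm{int}(\mathrm{dom}\, f)\neq\varnothing$ and $\mathrm{int}(\mathrm{dom}\, f^* )\neq\varnothing$. Then the Fitzpatrick family $\mathcal{F}_{\partial f}$ consists of a single element if and only if there exist a constant $c\in\mathbb{R}$, a functional $\overline{x}^*\in X^*$, closed convex sets $K, C\subseteq X$ and a set $\mathcal{V}\subseteq X^*$ such that $C$ is a cone, $\mathcal{V}$ is weak$^*$-closed and convex, $0\in\mathcal{V}$, $\langle k_1-k_2, v^*\rangle = 0$ for all $k_1,k_2\in K$ and $v^*\in\mathcal{V}$, and for every $\widehat{x}\in K$ and every $x\in X$ \[ f(x) = \sigma_{\mathcal{V}}(x-\widehat{x}) + i_{\overline{K+C}}(x) + \langle x,\overline{x}^*\rangle + c. \]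
   Context: $f^*$ is the Fenchel conjugate $f^*(x^* ) = \sup_{x\in X}\{\langle x,x^*\rangle - f(x)\}$. For a maximal monotone $A:X\rightrightarrows X^*$, a representative function is a proper convex lsc $h: X\times X^*\to\mathbb{R}\cup\{+\infty\}$ with $h(x,x^* )\ge\langle x,x^*\rangle$ everywhere and equality on $\mathrm{Gr}(A)$; $\mathcal{F}_A$ is the set of all such functions. $\sigma_{\mathcal{V}}(x) = \sup_{v^*\in\mathcal{V}}\langle x,v^*\rangle$ is the support function, $i_S$ is the indicator function of $S$ ($0$ on $S$, $+\infty$ outside), and $\overline{K+C}$ is the closure of the Minkowski sum.
   Formalization: The set K is required to be nonempty; with K empty the displayed formula is vacuous and the equivalence fails, e.g. for f(x) = x²/2 on the real line. *)

(* Defs.v *)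
From Stdlib Require List.
From HB Require Import structures.
From mathcomp Require Import all_boot all_order all_algebra.
From mathcomp Require Import all_classical all_reals all_analysis.
Set Implicit Arguments. Unset Strict Implicit. Unset Printing Implicit Defensive.
Import Order.TTheory GRing.Theory Num.Theory.
Import numFieldNormedType.Exports.
Local Open Scope classical_set_scope.
Local Open Scope ring_scope.

Section Defs.
Context {R : realType} {X : normedModType R}.

Definition is_dual (p : X -> R) : Prop :=
  (forall (a : R) (x y : X), p (a *: x + y) = a * p x + p y) /\ continuous p.

Definition dual := {p : X -> R | is_dual p}.

Definition pair (x : X) (p : dual) : R := proj1_sig p x.

Definition ddist (p q : dual) : \bar R :=
  ereal_sup [set (`|pair x p - pair x q|)%:E | x in [set x : X | `|x| <= 1]].

Definition dual_int_nonempty (S : set dual) : Prop :=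
  exists p, exists2 e : R, 0 < e &
    forall q, (ddist q p < e%:E)%E -> S q.

Definition weakstar_closed (V : set dual) : Prop :=
  forall p, ~ V p -> exists (s : seq X), exists2 e : R, 0 < e &
    forall q, (forall x, List.In x s -> `|pair x q - pair x p| < e) -> ~ V q.

Definition convex_dual (V : set dual) : Prop :=
  forall p q r (t : R), V p -> V q -> 0 <= t <= 1 ->
    (forall x, pair x r = t * pair x p + (1 - t) * pair x q) -> V r.

Definition support_fun (V : set dual) (x : X) : \bar R :=
  ereal_sup [set (pair x v)%:E | v in V].

Definition is_cone (C : set X) : Prop :=
  forall (l : R) c, 0 <= l -> C c -> C (l *: c).

Definition ind_set (S : set X) (x : X) : \bar R :=
  if `[< S x >] then 0%E else +oo%E.

Definition dom (f : X -> \bar R) : set X := [set x | (f x < +oo)%E].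

Definition convex_fun (f : X -> \bar R) : Prop :=
  forall (x y : X) (t : R), 0 <= t <= 1 ->
    (f ((t *: x + (1 - t) *: y)%R) <= t%:E * f x + (1 - t)%:E * f y)%E.

Definition fconj (f : X -> \bar R) (p : dual) : \bar R :=
  ereal_sup [set ((pair x p)%:E - f x)%E | x in setT].

Definition dom_dual (g : dual -> \bar R) : set dual := [set p | (g p < +oo)%E].

Definition subdiff (f : X -> \bar R) (x : X) (p : dual) : Prop :=
  f x \is a fin_num /\ forall y, (f x + (pair (y - x) p)%:E <= f y)%E.

Definition convex_fun2 (h : X -> dual -> \bar R) : Prop :=
  forall (x1 x2 : X) (p1 p2 p : dual) (t : R), 0 <= t <= 1 ->
    (forall z, pair z p = t * pair z p1 + (1 - t) * pair z p2) ->
    (h ((t *: x1 + (1 - t) *: x2)%R) p <= t%:E * h x1 p1 + (1 - t)%:E * h x2 p2)%E.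

Definition lsc2 (h : X -> dual -> \bar R) : Prop :=
  forall x p (a : R), (a%:E < h x p)%E ->
    exists2 e : R, 0 < e & forall y q, `|y - x| < e -> (ddist q p < e%:E)%E ->
      (a%:E < h y q)%E.

Definition proper2 (h : X -> dual -> \bar R) : Prop :=
  (forall x p, h x p != -oo%E) /\ exists x p, h x p != +oo%E.

Definition representative (f : X -> \bar R) (h : X -> dual -> \bar R) : Prop :=
  [/\ proper2 h, convex_fun2 h, lsc2 h,
      (forall x p, ((pair x p)%:E <= h x p)%E) &
      (forall x p, subdiff f x p -> h x p = (pair x p)%:E)].

Definition fitzpatrick_singleton (f : X -> \bar R) : Prop :=
  exists h, representative f h /\ forall h', representative f h' -> h' = h.

End Defs.

Section RNP.
Context {R : realType} {X : normedModType R}.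

Definition simple_fn {T : Type} (s : seq (X * set T)) (t : T) : X :=
  \sum_(p <- s) (if `[< p.2 t >] then p.1 else 0).

(* g is Bochner integrable w.r.t. mu with indefinite integral G:
   there are simple functions s_n -> g mu-a.e., Cauchy in L^1(mu; X),
   and for every measurable A, int_A g dmu = lim_n int_A s_n dmu = G A. *)
Definition bochner_density {d} {T : measurableType d}
    (mu : {measure set T -> \bar R}) (g : T -> X) (G : set T -> X) : Prop :=
  exists s : nat -> seq (X * set T),
  [/\ forall n, List.Forall (fun p => measurable p.2 /\ (mu p.2 < +oo)%E) (s n),
      {ae mu, forall t, (fun n => simple_fn (s n) t) @ \oo --> g t},
      (forall e : R, 0 < e -> exists N, forall n m, (N <= n)%N -> (N <= m)%N ->
         (\int[mu]_t (`|simple_fn (s n) t - simple_fn (s m) t|)%:E <= e%:E)%E) &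
      forall A, measurable A ->
        (fun n => \sum_(p <- s n) fine (mu (A `&` p.2)) *: p.1) @ \oo --> G A].

Definition countably_additive_vm {d} {T : measurableType d} (G : set T -> X) : Prop :=
  forall A : nat -> set T, (forall n, measurable (A n)) -> trivIset setT A ->
    (fun n => \sum_(i < n) G (A i)) @ \oo --> G (\bigcup_n A n).

Definition bounded_variation_vm {d} {T : measurableType d} (G : set T -> X) : Prop :=
  exists M : R, forall (n : nat) (B : 'I_n -> set T),
    (forall i, measurable (B i)) -> trivIset setT B ->
    \sum_(i < n) `|G (B i)| <= M.

Definition RNP : Prop :=
  forall d (T : measurableType d) (mu : {finite_measure set T -> \bar R})
    (G : set T -> X),
    countably_additive_vm G -> bounded_variation_vm G ->
    (forall A, measurable A -> mu A = 0%E -> G A = 0) ->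
    exists g : T -> X, bochner_density mu g G.

End RNP.

(* Main.v *)
Require Import Defs.
From HB Require Import structures.
From mathcomp Require Import all_boot all_order all_algebra.
From mathcomp Require Import all_classical all_reals all_analysis.
From mathcomp Require Import measurable_realfun ring lra.
Import Order.TTheory GRing.Theory Num.Theory.
Import numFieldNormedType.Exports.
Local Open Scope classical_set_scope.
Local Open Scope ring_scope.
Set Implicit Arguments. Unset Strict Implicit. Unset Printing Implicit Defensive.

(* The functions [f + f^*] and the Fitzpatrick function are both representatives, so
   uniqueness means that they agree.

   By the Radon-Nikodym property, closed convex epigraphs with coercive tilts have
   small slices (otherwise an approximate martingale with steps bounded below would
   give a vector measure without density), and Baire category in the dual then yields
   functionals strongly exposing the epigraph, densely in the interior of [dom f^*].

   If the two representatives agree, then any [x] in [dom f] and [q] in [dom f^*] are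
   almost joined through a point [a] of the graph: a subgradient at [a] is almost
   tight at [x], and [a] almost maximises [q - f]. When [q] strongly exposes [k], this
   makes [f] affine on segments issuing from [k], so that [k] is a pivot: all
   subgradients at interior points are subgradients at [k]. The pivots form [K], the
   common subgradients at all pivots form [V] up to translation, and [C] is the
   recession cone of the closure of the domain. Were some [x] of the domain outside the
   closure of [K + C], a separating [p] would push functionals out of [dom f^*], and
   a Bronsted-Rockafellar argument at the exit point would produce a recession
   direction on which [p] is positive.

   Conversely, for [f] of the given form, a representative [h] is at most [f + f^*],
   by lower semicontinuity from points [(k + c, q)] where [f^*] is attained at [q]; the
   bound [h >= <.,.>] on segments issuing from points near the graph then gives the
   reverse inequality. *)

(** * Hahn-Banach separation and the dual space *)

(** Nothing need be attained: [X] is not assumed reflexive, and neither [K + C] nor [dom f] need be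
    closed. Identities are therefore proved with an error, which is removed by letting a small
    weight vanish ([ler_vanishing]) or by going to infinity along a ray and comparing slopes
    ([ler_scaled]). Exact attainment comes from strongly exposing functionals; they are reached by
    tilting a given functional slightly towards one that is coercive on the epigraph, which the
    interior of [dom f^*] provides.

    That the Fitzpatrick function dominates the duality product is the maximality of the
    subdifferential as a monotone operator, proved along segments ending in the interior of the
    domain.

    A subgradient at an interior point [x] is one at [k] because [f] is affine on a segment from [k]
    to a point slightly beyond [x]. Being subgradients at every pivot is also what makes the members
    of the translated [V] agree on [K - K].

    Representatives are lower semicontinuous for the norm of [X^*], so in the converse slopes must
    be approximated in norm: slopes and positions that go to infinity enter with weights that go to
    zero. *)

Section RealLimits.
Context {R : realType}.

Lemma archi_lt (x : R) : exists n : nat, x < n.+1%:R.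
Proof. by exists (Num.trunc x); exact: truncnS_gt. Qed.

Lemma ler_vanishing (a b c : R) :
  (forall e, 0 < e < 1 -> a <= b + c * e) -> a <= b.
Proof.
move=> h; rewrite leNgt; apply/negP => ba.
have c1 : 0 < `|c| + 1 by rewrite ltr_wpDl.
pose e := Num.min (1 / 2) ((a - b) / 2 / (`|c| + 1)).
have e0 : 0 < e by rewrite lt_min !divr_gt0// subr_gt0.
have e1 : e < 1 by rewrite gt_min; apply/orP; left; lra.
have := h e; rewrite e0 e1 => /(_ isT).
have ce : c * e <= (a - b) / 2.
  apply: (@le_trans _ _ ((`|c| + 1) * e)).
    by rewrite ler_wpM2r ?(ltW e0)//; have := ler_norm c; lra.
  by rewrite mulrC -ler_pdivlMr// ge_min lexx orbT.
lra.
Qed.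

Lemma ler_scaled (a b c : R) :
  (forall n, n.+1%:R * a <= n.+1%:R * b + c) -> a <= b.
Proof.
move=> h; rewrite leNgt; apply/negP => ba.
have ab : 0 < a - b by rewrite subr_gt0.
have [n] := archi_lt (c / (a - b)); rewrite ltr_pdivrMr//.
have := h n; rewrite mulrBr; lra.
Qed.

End RealLimits.

Section HahnBanach.
Context {R : realType}.

Definition sublinear (X : lmodType R) (q : X -> R) : Prop :=
  [/\ forall x y, q (x + y) <= q x + q y,
      forall t x, 0 < t -> q (t *: x) <= t * q x & q 0 <= 0].

Lemma sublinear_ge (X : lmodType R) (q : X -> R) (x : X) :
  sublinear q -> - q (- x) <= q x.
Proof.
case=> qD _ _; have := qD x (- x); rewrite subrr.
have := qD 0 0; rewrite addr0; lra.
Qed.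

(** The pointwise infimum works: since members of the chain are comparable, near-minimisers at [x]
    and at [y] can be replaced by the smaller of the two, which is subadditive. *)
Lemma sublinear_chain_inf (X : lmodType R) (A : set (X -> R)) :
  A !=set0 -> (forall q, A q -> sublinear q) ->
  (forall q1 q2, A q1 -> A q2 ->
     (forall x, q1 x <= q2 x) \/ (forall x, q2 x <= q1 x)) ->
  (forall x, exists m, forall q, A q -> m <= q x) ->
  exists q, sublinear q /\ forall q', A q' -> forall x, q x <= q' x.
Proof.
move=> [q0 Aq0] Asub Atot Alb.
pose V x := [set q x | q in A].
have hV x : has_inf (V x).
  split; first by exists (q0 x), q0.
  by have [m mP] := Alb x; exists m => _ [q Aq <-]; exact: mP.
have infV x q : A q -> inf (V x) <= q x.
  by move=> Aq; apply: ge_inf; [exact: (hV x).2|exists q].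
have adhV x e : 0 < e -> exists2 q, A q & q x < inf (V x) + e.
  by move=> /inf_adherent/(_ (hV x))[_ [q Aq <-]] ?; exists q.
exists (fun x => inf (V x)); split=> [|q' Aq' x]; last exact: infV.
split=> [x y|t x t0|].
- apply/ler_addgt0Pr => e e0; have e2 : 0 < e / 2 by rewrite divr_gt0.
  have [q1 Aq1 q1x] := adhV x _ e2; have [q2 Aq2 q2y] := adhV y _ e2.
  have [q12|q21] := Atot _ _ Aq1 Aq2.
  + have [qD _ _] := Asub _ Aq1.
    have := infV (x + y) _ Aq1; have := qD x y; have := q12 y; lra.
  + have [qD _ _] := Asub _ Aq2.
    have := infV (x + y) _ Aq2; have := qD x y; have := q21 x; lra.
- apply/ler_addgt0Pr => e e0; have [q Aq qx] := adhV x _ (divr_gt0 e0 t0).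
  have [_ qZ _] := Asub _ Aq.
  apply: (le_trans (infV _ _ Aq)); apply: (le_trans (qZ _ _ t0)).
  have -> : t * inf (V x) + e = t * (inf (V x) + e / t).
    by rewrite mulrDr [t * (e / t)]mulrC divfK ?gt_eqF.
  by rewrite ler_pM2l // ltW.
- by have [_ _ q00] := Asub _ Aq0; exact: le_trans (infV _ _ Aq0) _.
Qed.

(* The directional shrinking [y |-> inf_(t >= 0) q (y + t x) - t q x] of a
   sublinear [q] is sublinear and lies below [q]; for a minimal [q] it is [q]
   itself, which forces [q] to be odd. *)
Lemma sublinear_minimal_linear (X : lmodType R) (q : X -> R) :
  sublinear q ->
  (forall q', sublinear q' -> (forall x, q' x <= q x) -> q' = q) ->
  forall (a : R) x y, q (a *: x + y) = a * q x + q y.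
Proof.
move=> sq qmin; have [qD qZ q0] := sq.
have qZE t x : 0 < t -> q (t *: x) = t * q x.
  move=> t0; apply/eqP; rewrite eq_le qZ //=.
  have := qZ t^-1 (t *: x); rewrite invr_gt0 scalerA mulVf ?gt_eqF// scale1r.
  move=> /(_ t0); rewrite -(ler_pM2l t0) mulrA divff ?gt_eqF// mul1r //.
have qodd x : q (- x) = - q x.
  pose V y := [set q (y + t *: x) - t * q x | t in [set t : R | 0 <= t]].
  have V0 y : V y (q y) by exists 0 => //=; rewrite scale0r addr0 mul0r subr0.
  have lV y : lbound (V y) (- q (- y)).
    move=> _ [t /= t0 <-].
    have : t * q x <= q (y + t *: x) + q (- y).
      have := qD (y + t *: x) (- y); rewrite addrAC subrr add0r.
      move: t0; rewrite le_eqVlt => /predU1P[<-|t0]; last by rewrite qZE.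
      rewrite scale0r addr0 mul0r; have := sublinear_ge y sq; lra.
    lra.
  have hV y : has_inf (V y) by split; [exists (q y) | exists (- q (- y)); exact: lV].
  have infV y t : 0 <= t -> inf (V y) <= q (y + t *: x) - t * q x.
    by move=> t0; apply: ge_inf; [exact: (hV y).2|exists t].
  have adhV y e : 0 < e ->
      exists2 t, 0 <= t & q (y + t *: x) - t * q x < inf (V y) + e.
    by move=> /inf_adherent/(_ (hV y))[_ [t t0 <-]] ?; exists t.
  have qV : (fun y => inf (V y)) = q.
    apply: qmin => [|y]; last first.
      by have := infV y 0 (lexx _); rewrite scale0r addr0 mul0r subr0.
    split=> [y z|t y t0|].
    - apply/ler_addgt0Pr => e e0; have e2 : 0 < e / 2 by rewrite divr_gt0.
      have [t t0 ty] := adhV y _ e2; have [s s0 sz] := adhV z _ e2.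
      have := infV (y + z) (t + s) (addr_ge0 t0 s0).
      have := qD (y + t *: x) (z + s *: x).
      rewrite addrACA -scalerDl; lra.
    - apply/ler_addgt0Pr => e e0; have [s s0 sy] := adhV y _ (divr_gt0 e0 t0).
      have := infV (t *: y) (t * s) (mulr_ge0 (ltW t0) s0).
      rewrite -scalerA -scalerDr qZE // => h; apply: (le_trans h).
      have -> : t * inf (V y) + e = t * (inf (V y) + e / t).
        by rewrite mulrDr [t * (e / t)]mulrC divfK ?gt_eqF.
      by rewrite -mulrA -mulrBr ler_pM2l // ltW.
    - by have := infV 0 0 (lexx _); rewrite scale0r addr0 mul0r subr0; lra.
  have := infV (- x) 1 ler01.
  rewrite (congr1 (fun h => h (- x)) qV) scale1r addNr mul1r.
  have := sublinear_ge x sq; lra.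
move=> a x y.
have qN z w : q (z + w) = q z + q w.
  apply/eqP; rewrite eq_le qD /=.
  by rewrite -lerBrDr; have := qD (z + w) (- w); rewrite addrK qodd.
rewrite qN; congr (_ + _).
have [a0|a0|->] := ltgtP a 0.
- by rewrite -{1}[a]opprK scaleNr qodd qZE ?oppr_gt0 // mulNr opprK.
- exact: qZE.
- rewrite scale0r mul0r; have := qD 0 0; rewrite addr0; lra.
Qed.

(** Zorn's lemma with the order reversed, so that a maximal element is a pointwise minimal sublinear
    function below [p]; such a function is linear. *)
Theorem hahn_banach_sublinear (X : lmodType R) (p : X -> R) :
  sublinear p ->
  exists u : X -> R, (forall (a : R) x y, u (a *: x + y) = a * u x + u y) /\
    forall x, u x <= p x.
Proof.
move=> sp; pose T := {q : X -> R | sublinear q /\ forall x, q x <= p x}.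
pose r (q1 q2 : T) := `[< forall x, proj1_sig q2 x <= proj1_sig q1 x >].
have [|||A Atot|[q [sq qp]] qmax] := @Zorn T r.
- by move=> q; apply/asboolP.
- move=> q1 q2 q3 /asboolP h1 /asboolP h2; apply/asboolP => x.
  exact: le_trans (h2 x) (h1 x).
- move=> [q1 h1] [q2 h2] /asboolP /= h12 /asboolP /= h21; apply: eq_exist.
  by apply/funext => x; apply/eqP; rewrite eq_le h12 h21.
- have [[q0 Aq0]|A0] := pselect (exists q, A q); last first.
    exists (exist _ p (conj sp (fun x => lexx (p x)))) => s As.
    by exfalso; apply: A0; exists s.
  have [|||x|q [sq qA]] := @sublinear_chain_inf X [set proj1_sig q | q in A].
  + by exists (proj1_sig q0), q0.
  + by move=> _ [[q [sq ?]] _ <-].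
  + move=> _ _ [q1 A1 <-] [q2 A2 <-].
    by have [/asboolP|/asboolP] := Atot _ _ A1 A2; [right|left].
  + exists (- p (- x)) => _ [[q [sq qp]] _ <-] /=.
    by apply: le_trans (sublinear_ge x sq); rewrite lerN2.
  + have qp x : q x <= p x.
      apply: le_trans ((proj2_sig q0).2 x).
      by apply: qA; exists q0.
    exists (exist _ q (conj sq qp)) => s As; apply/asboolP => x /=.
    by apply: qA; exists s.
- exists q; split=> //; apply: sublinear_minimal_linear => // q' sq' q'q.
  have q'p x : q' x <= p x := le_trans (q'q x) (qp x).
  have /qmax /(congr1 (@proj1_sig _ _)) // :
    r (exist _ q (conj sq qp)) (exist _ q' (conj sq' q'p)) by apply/asboolP.
Qed.

End HahnBanach.

Section Dual.
Context {R : realType} {X : normedModType R}.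
Implicit Types (x y : X) (u v p q : @dual R X).

Lemma pairZD a x y u : pair (a *: x + y) u = a * pair x u + pair y u.
Proof. by case: u => u [lu cu]; exact: lu. Qed.

Lemma pairD x y u : pair (x + y) u = pair x u + pair y u.
Proof. by rewrite -[x]scale1r pairZD mul1r scale1r. Qed.

Lemma pair0 u : pair 0 u = 0.
Proof. by have := pairD 0 0 u; rewrite addr0; lra. Qed.

Lemma pairZ a x u : pair (a *: x) u = a * pair x u.
Proof. by rewrite -[a *: x]addr0 pairZD pair0 addr0. Qed.

Lemma pairN x u : pair (- x) u = - pair x u.
Proof. by rewrite -scaleN1r pairZ mulN1r. Qed.

Lemma pairB x y u : pair (x - y) u = pair x u - pair y u.
Proof. by rewrite pairD pairN. Qed.

Definition pairE := (pairD, pairZ, pairN, pair0).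

Lemma pair_bounded u : exists2 M, 0 < M & forall x, `|pair x u| <= M * `|x|.
Proof.
have cu : {for 0, continuous (fun x => pair x u)} by case: u => u [lu cu]; exact: cu.
have /nbhs_ballP[d /= d0 dP] : nbhs (0 : X) [set x | `|pair x u| < 1].
  move/cvgrPdist_lt: cu => /(_ _ ltr01); apply: filterS => x.
  by rewrite pair0 sub0r normrN.
exists (2 / d) => [|x]; first by rewrite divr_gt0.
have [->|x0] := eqVneq x 0; first by rewrite pair0 !normr0 mulr0.
have nx : 0 < `|x| by rewrite normr_gt0.
have := dP ((d / 2 / `|x|) *: x).
rewrite -ball_normE /= sub0r normrN normrZ ger0_norm; last by rewrite !divr_ge0// ltW.
rewrite divfK ?gt_eqF// ltr_pdivrMr// => /(_ _)/ltW.
rewrite pairZ normrM ger0_norm; last by rewrite !divr_ge0// ltW.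
move=> h; have {h} : d / 2 / `|x| * `|pair x u| <= 1 by apply: h; lra.
rewrite -(ler_pM2l nx) mulr1 => h.
rewrite -(ler_pM2l (_ : 0 < d / 2)); last by rewrite divr_gt0.
have -> : d / 2 * (2 / d * `|x|) = `|x| by field; rewrite gt_eqF.
by move: h; rewrite mulrA [`|x| * _]mulrC divfK ?gt_eqF.
Qed.

Lemma dual_of_bounded_linear (f : X -> R) (M : R) :
  (forall (a : R) x y, f (a *: x + y) = a * f x + f y) ->
  (forall x, f x <= M * `|x|) -> exists u, forall x, pair x u = f x.
Proof.
move=> lf bf.
have fB x y : f (x - y) = f x - f y.
  by rewrite addrC -scaleN1r lf mulN1r addrC.
have bf' x : `|f x| <= M * `|x|.
  have := fB 0 x; have := lf 1 0 0; rewrite scale1r addr0 mul1r sub0r => f0 fN.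
  rewrite ler_norml bf andbT; have := bf (- x); rewrite normrN; lra.
suff cf : is_dual f by exists (exist _ f cf).
split=> // x; apply/cvgrPdist_lt => e e0.
have M0 : 0 < `|M| + 1 by rewrite ltr_wpDl.
apply/nbhs_ballP; exists (e / (`|M| + 1)) => /=; first by rewrite divr_gt0.
move=> y; rewrite -ball_normE /= ltr_pdivlMr// mulrC => h; rewrite -fB.
apply: le_lt_trans (bf' _) _; apply: le_lt_trans h.
rewrite ler_wpM2r// (le_trans (ler_norm _))//; lra.
Qed.

Lemma dcomb_ex a p b q : exists u, forall x, pair x u = a * pair x p + b * pair x q.
Proof.
have [M M0 Mp] := pair_bounded p; have [N N0 Nq] := pair_bounded q.
apply: (@dual_of_bounded_linear _ (`|a| * M + `|b| * N)) => [t x y|x].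
  by rewrite !pairZD; ring.
rewrite mulrDl lerD// -mulrA (le_trans (ler_norm _))// normrM ler_wpM2l//.
Qed.

(** Linear combinations in the dual, obtained by choice and used through [pair_dcomb]: [dual] is a
    bare subset type, and functionals are compared by their values. *)
Definition dcomb a p b q : @dual R X := projT1 (cid (dcomb_ex a p b q)).

Lemma pair_dcomb a p b q x : pair x (dcomb a p b q) = a * pair x p + b * pair x q.
Proof. by rewrite /dcomb; case: cid. Qed.

(** The dual norm estimate [|p - q| <= e], kept in real numbers. *)
Definition dle p q (e : R) := forall x, `|pair x p - pair x q| <= e * `|x|.

Lemma dle_ddist p q e : dle p q e -> 0 <= e -> (ddist p q <= e%:E)%E.
Proof.
move=> pq e0; apply: ge_ereal_sup => _ [x /= x1 <-].
by rewrite lee_fin (le_trans (pq x))// -[leRHS]mulr1 ler_wpM2l.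
Qed.

Lemma ddist_dle p q e : (ddist p q <= e%:E)%E -> dle p q e.
Proof.
move=> pq x; have [->|x0] := eqVneq x 0.
  by rewrite !pair0 subrr !normr0 mulr0.
have nx : 0 < `|x| by rewrite normr_gt0.
have : ((`|pair (`|x|^-1 *: x) p - pair (`|x|^-1 *: x) q|)%:E <= e%:E)%E.
  apply: le_trans pq; apply: ereal_sup_ubound; exists (`|x|^-1 *: x) => //=.
  by rewrite normrZ ger0_norm ?invr_ge0// mulVf ?gt_eqF.
rewrite lee_fin !pairZ -mulrBr normrM ger0_norm ?invr_ge0//.
by rewrite ler_pdivrMl// mulrC.
Qed.

(* A convex set of pairs [(d, s)] lying above [0] over the origin and containing
   a horizontal disc admits a non-vertical supporting hyperplane at [(0, 0)]. *)
Lemma hahn_banach_epi (A : X -> R -> Prop) (r M : R) :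
  (forall t x1 s1 x2 s2, 0 < t < 1 -> A x1 s1 -> A x2 s2 ->
     A (t *: x1 + (1 - t) *: x2) (t * s1 + (1 - t) * s2)) ->
  (forall s, A 0 s -> 0 <= s) ->
  0 < r -> (forall d, `|d| <= r -> A d M) ->
  exists u, forall d s, A d s -> pair d u <= s.
Proof.
move=> cA A0 r0 Ar.
have M0 : 0 <= M by apply: A0; apply: Ar; rewrite normr0 ltW.
(* [V d] is the slice over [d] of the cone generated by [A]; its infimum is sublinear in [d], and
   any linear function below it is below [A]. *)
pose V d := [set s | exists2 t : R, 0 < t & A (t *: d) (t * s)].
have addV d1 d2 s1 s2 : V d1 s1 -> V d2 s2 -> V (d1 + d2) (s1 + s2).
  move=> [t1 t10 A1] [t2 t20 A2]; have t0 : 0 < t1 + t2 by rewrite addr_gt0.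
  exists (t1 * t2 / (t1 + t2)); first by rewrite divr_gt0// mulr_gt0.
  have := cA (t2 / (t1 + t2)) _ _ _ _ _ A1 A2.
  have -> : 1 - t2 / (t1 + t2) = t1 / (t1 + t2) by field; rewrite gt_eqF.
  rewrite !scalerA !mulrA [t2 / _ * t1]mulrAC [t1 / _ * t2]mulrAC [t2 * t1]mulrC.
  rewrite -scalerDr -mulrDr; apply.
  by rewrite divr_gt0//= ltr_pdivrMr// mul1r ltrDr.
have V0 s : V 0 s -> 0 <= s.
  by move=> [t t0]; rewrite scaler0 => /A0; rewrite pmulr_rge0.
have VM d : d != 0 -> V d (M * `|d| / r).
  move=> d0; have nd : 0 < `|d| by rewrite normr_gt0.
  exists (r / `|d|); first by rewrite divr_gt0.
  have -> : r / `|d| * (M * `|d| / r) = M by field; rewrite !gt_eqF.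
  apply: Ar; rewrite normrZ ger0_norm; last by rewrite divr_ge0// ltW.
  by rewrite divfK ?gt_eqF.
have V0M e : 0 < e -> exists2 s, s <= e & V 0 s.
  move=> e0; have M1 : 0 < M + 1 by rewrite ltr_wpDl.
  have A0M : A 0 M by apply: Ar; rewrite normr0 ltW.
  exists (M * e / (M + 1)).
    by rewrite -mulrA mulrCA ger_pMr// ler_pdivrMr// mul1r; lra.
  exists ((M + 1) / e); first by rewrite divr_gt0.
  rewrite scaler0 (_ : _ * _ = M)//; field; rewrite !gt_eqF//; lra.
pose q d := inf (V d).
have hV d : has_inf (V d).
  have [->|d0] := eqVneq d 0.
    have [s _ Vs] := V0M 1 ltr01.
    by split; [exists s|exists 0 => s'; exact: V0].
  split; first by exists (M * `|d| / r); exact: VM.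
  exists (- (M * `|- d| / r)) => s Vs.
  have := addV _ _ _ _ Vs (VM (- d) _).
  by rewrite oppr_eq0 subrr => /(_ d0)/V0; lra.
have infV d s : V d s -> q d <= s.
  by move=> Vs; apply: ge_inf; [exact: (hV d).2|].
have q0 : q 0 <= 0.
  apply/ler_addgt0Pr => e e0; rewrite add0r.
  by have [s se Vs] := V0M e e0; exact: le_trans (infV _ _ Vs) se.
have sq : sublinear q.
  split=> [x y|t x t0|//].
  - apply/ler_addgt0Pr => e e0; have e2 : 0 < e / 2 by rewrite divr_gt0.
    have [s1 V1 s1q] := inf_adherent e2 (hV x).
    have [s2 V2 s2q] := inf_adherent e2 (hV y).
    apply: (le_trans (infV _ _ (addV _ _ _ _ V1 V2))); rewrite /q; lra.
  - apply/ler_addgt0Pr => e e0.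
    have [s [t1 t10 A1] sq] := inf_adherent (divr_gt0 e0 t0) (hV x).
    apply: (@le_trans _ _ (t * s)).
      apply: infV; exists (t1 / t); first by rewrite divr_gt0.
      by rewrite scalerA mulrA divfK ?gt_eqF.
    apply: (@le_trans _ _ (t * (q x + e / t))); first by rewrite ler_pM2l// ltW.
    by rewrite mulrDr [t * (e / t)]mulrC divfK ?gt_eqF.
have [f [lf fq]] := hahn_banach_sublinear sq.
have [|u uf] := @dual_of_bounded_linear f (M / r) lf.
  move=> x; apply: (le_trans (fq x)).
  have [->|x0] := eqVneq x 0; first by rewrite normr0 mulr0.
  by apply: (le_trans (infV _ _ (VM _ x0))); rewrite mulrAC.
exists u => d s As; rewrite uf; apply: (le_trans (fq d)); apply: infV.
by exists 1 => //; rewrite scale1r mul1r.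
Qed.

(** A subgradient of the norm at [x]; testing it in the direction [- x] gives the equality. *)
Lemma norming_dual x :
  exists b, (forall d, pair d b <= `|d|) /\ pair x b = `|x|.
Proof.
have [||||b bP] := @hahn_banach_epi (fun d s => `|x + d| <= `|x| + s) 1 1.
- move=> t x1 s1 x2 s2 /andP[t0 t1] h1 h2.
  have -> : x + (t *: x1 + (1 - t) *: x2) = t *: (x + x1) + (1 - t) *: (x + x2).
    by rewrite !scalerDr addrACA -scalerDl addrC [t + _]addrC subrK scale1r addrC.
  apply: le_trans (ler_normD _ _) _; rewrite !normrZ !ger0_norm ?(ltW t0)//; last lra.
  by nra.
- by move=> s; rewrite addr0; lra.
- exact: ltr01.
- by move=> d d1; apply: le_trans (ler_normD _ _) _; lra.
have b1 d : pair d b <= `|d| by apply: bP; rewrite ler_normD.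
exists b; split=> //; apply/eqP; rewrite eq_le b1 /=.
have := bP (- x) (- `|x|); rewrite !subrr normr0 pairN lexx => /(_ isT); lra.
Qed.

(* Since the dual separates points, linear identities between vectors can be
   checked by [ring] after applying a generic functional. *)
Lemma pair_ext x y : (forall u, pair x u = pair y u) -> x = y.
Proof.
move=> xy; have [u [_ ux]] := norming_dual (x - y).
by apply/eqP; rewrite -subr_eq0 -normr_eq0 -ux pairB xy subrr.
Qed.

(** The set handed to [hahn_banach_epi] comes from the convex function
    [d |-> dist (x1 + d, S) - rho], which is nonnegative at the origin and at most [- rho] at each
    [x - x1] with [x] in [S]. *)
Lemma separation (S : X -> Prop) x0 x1 (rho : R) :
  (forall t x y, 0 < t < 1 -> S x -> S y -> S (t *: x + (1 - t) *: y)) ->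
  S x0 -> (forall x, S x -> rho <= `|x1 - x|) ->
  exists u, forall x, S x -> pair (x - x1) u <= - rho.
Proof.
move=> cS S0 Srho.
pose A d s := exists2 x, S x & `|x1 + d - x| <= s + rho.
have [||||u uP] := @hahn_banach_epi A 1 (`|x1 - x0| + 1 - rho).
- move=> t d1 s1 d2 s2 /andP[t0 t1] [y1 Sy1 h1] [y2 Sy2 h2].
  exists (t *: y1 + (1 - t) *: y2); first by apply: cS => //; rewrite t0.
  have -> : x1 + (t *: d1 + (1 - t) *: d2) - (t *: y1 + (1 - t) *: y2) =
      t *: (x1 + d1 - y1) + (1 - t) *: (x1 + d2 - y2).
    by apply: pair_ext => v; rewrite !pairE; ring.
  apply: le_trans (ler_normD _ _) _; rewrite !normrZ !ger0_norm ?(ltW t0)//; last lra.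
  by nra.
- by move=> s [x Sx]; rewrite addr0; have := Srho _ Sx; lra.
- exact: ltr01.
- move=> d d1; exists x0 => //; rewrite addrAC.
  by apply: le_trans (ler_normD _ _) _; lra.
exists u => x Sx; apply: uP; exists x => //.
by rewrite [x1 + _]addrC subrK subrr normr0 addNr.
Qed.

Lemma closed_dist (S : set X) x1 : closed S -> ~ S x1 ->
  exists2 rho : R, 0 < rho & forall x, S x -> rho <= `|x1 - x|.
Proof.
move=> cS nS; have : open (~` S) by exact: closed_openC.
rewrite openE => /(_ _ nS)/nbhs_ballP[r /= r0 rP].
exists r => // x Sx; rewrite leNgt; apply/negP => xr.
by apply: (rP x) => //; rewrite -ball_normE.
Qed.

(* The centres of nested balls converge pointwise; the limit is read off as the
   supremum of the lower ends [<x, u_n> - r_n |x|]. *)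
Lemma dual_nested_balls (u : nat -> @dual R X) (r : nat -> R) :
  (forall n, 0 < r n) -> (forall n, r n <= n.+1%:R^-1) ->
  (forall n m, (n <= m)%N -> dle (u m) (u n) (r n)) ->
  exists w, forall n, dle w (u n) (r n).
Proof.
move=> r0 rn um.
pose V x := [set pair x (u n) - r n * `|x| | n in [set: nat]].
have Vub n m x : pair x (u n) - r n * `|x| <= pair x (u m) + r m * `|x|.
  have nx : 0 <= `|x| by [].
  have [nm|/ltnW mn] := leqP n m.
    have := um _ _ nm x; rewrite ler_norml => /andP[].
    have := mulr_ge0 (ltW (r0 m)) nx; lra.
  have := um _ _ mn x; rewrite ler_norml => /andP[].
  have := mulr_ge0 (ltW (r0 n)) nx; lra.
have hV x : has_sup (V x).
  split; first by exists (pair x (u 0%N) - r 0%N * `|x|), 0%N.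
  by exists (pair x (u 0%N) + r 0%N * `|x|) => _ [n _ <-]; exact: Vub.
pose f x := sup (V x).
have fu n x : `|f x - pair x (u n)| <= r n * `|x|.
  have : f x <= pair x (u n) + r n * `|x|.
    by apply: ge_sup; [exact: (hV x).1|move=> _ [m _ <-]; exact: Vub].
  have : pair x (u n) - r n * `|x| <= f x.
    by apply: sup_upper_bound => //; exists n.
  by rewrite ler_norml; lra.
have small (c d : R) : 0 <= c -> (forall n, d <= c * r n) -> d <= 0.
  move=> c0 dc; rewrite leNgt; apply/negP => d0.
  have cd : 0 <= c / d by rewrite divr_ge0// ltW.
  have [n nP] := archi_lt (c / d).
  have := dc n; rewrite leNgt => /negP; apply.
  apply: le_lt_trans (ler_wpM2l c0 (rn n)) _.
  by rewrite ltr_pdivrMr ?ltr0n// mulrC -ltr_pdivrMr.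
have lf (a : R) x y : f (a *: x + y) = a * f x + f y.
  apply/eqP; rewrite -subr_eq0 -normr_le0.
  apply: (small (`|a *: x + y| + `|a| * `|x| + `|y|)) => [|n].
    by rewrite !addr_ge0// mulr_ge0.
  have -> : f (a *: x + y) - (a * f x + f y) =
    (f (a *: x + y) - pair (a *: x + y) (u n)) - a * (f x - pair x (u n))
     - (f y - pair y (u n)) by rewrite pairZD; ring.
  apply: le_trans (ler_normB _ _) _; rewrite !mulrDl lerD//; last first.
    by rewrite mulrC.
  apply: le_trans (ler_normB _ _) _; rewrite lerD//; first by rewrite mulrC.
  by rewrite normrM -mulrA ler_wpM2l// mulrC.
have [M M0 MP] := pair_bounded (u 0%N).
have [|w wf] := @dual_of_bounded_linear f (M + r 0%N) lf.
  move=> x; rewrite mulrDl; have := fu 0%N x; have := MP x.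
  by rewrite !ler_norml => /andP[_ ?] /andP[_ ?]; lra.
by exists w => n x; rewrite wf.
Qed.

(** Baire's theorem for the dual norm, phrased with balls since [dual] carries no topology here:
    each [O n] contains a ball inside every ball. *)
Lemma dual_baire (O : nat -> set (@dual R X)) :
  (forall n u r, 0 < r -> exists u' r', 0 < r' /\
     forall w, dle w u' r' -> dle w u r /\ O n w) ->
  forall u r, 0 < r -> exists w, dle w u r /\ forall n, O n w.
Proof.
move=> Odense u r r0.
pose P (z z' : nat * (@dual R X * R)) := 0 < z.2.2 -> [/\ z'.1 = z.1.+1, 0 < z'.2.2,
  z'.2.2 <= z'.1.+1%:R^-1 &
  forall w, dle w z'.2.1 z'.2.2 -> dle w z.2.1 z.2.2 /\ O z.1 w].
have [next nextP] : {next & forall z, P z (next z)}.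
  apply: choice => -[n [v s]]; have [s0|s0] := pselect (0 < s); last first.
    by exists (n, (v, s)) => /s0.
  have [v' [s' [s'0 vP]]] := Odense n v s s0.
  (* The ball of index [n + 1] needs radius at most [1 / (n + 2)] for [dual_nested_balls]. *)
  exists (n.+1, (v', Num.min s' n.+2%:R^-1)) => _; split=> //=.
  - by rewrite lt_min s'0/= invr_gt0 ltr0n.
  - by rewrite ge_min lexx orbT.
  move=> w wv'; apply: vP => x; apply: le_trans (wv' x) _.
  by rewrite ler_wpM2r// ge_min lexx.
pose z n := iter n next (0%N, (u, Num.min r 1)).
have z0 n : (z n).1 = n /\ 0 < (z n).2.2.
  elim: n => [|n [zn rn]]; first by rewrite /= lt_min r0 ltr01.
  by have [-> ? _ _] := nextP _ rn; rewrite zn.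
have zS n w : dle w (z n.+1).2.1 (z n.+1).2.2 ->
    dle w (z n).2.1 (z n).2.2 /\ O n w.
  by have [_ _ _ h] := nextP _ (z0 n).2; move=> /h; rewrite (z0 n).1.
have zle n m w : (n <= m)%N -> dle w (z m).2.1 (z m).2.2 -> dle w (z n).2.1 (z n).2.2.
  by move=> /subnK <-; elim: (m - n)%N => // k ih; rewrite addSn => /zS[/ih].
have [|||w wP] := @dual_nested_balls (fun n => (z n).2.1) (fun n => (z n).2.2).
- by move=> n; exact: (z0 n).2.
- case=> [|n]; first by rewrite /= invr1 ge_min lexx orbT.
  by have [_ _ + _] := nextP _ (z0 n).2; rewrite (z0 n.+1).1.
- move=> n m nm; apply: (zle n m) => // x.
  by rewrite subrr normr0 mulr_ge0// ltW//; exact: (z0 m).2.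
exists w; split=> [x|n]; last by have [] := zS n _ (wP n.+1).
apply: le_trans (wP 0%N x) _; rewrite ler_wpM2r//=.
by rewrite ge_min lexx.
Qed.

End Dual.

(** * Bushes *)

Section UnitInterval.
Context {R : realType}.
Implicit Types A B : set (measurableTypeR R).

Definition unit_measure : set (measurableTypeR R) -> \bar R :=
  mrestr (@lebesgue_measure R) (measurable_itv `[0 : R, 1[).

HB.instance Definition _ := Measure.copy unit_measure
  (mrestr (@lebesgue_measure R) (measurable_itv `[0 : R, 1[)).

Lemma unit_measureT : unit_measure setT = 1%E.
Proof.
rewrite /unit_measure /mrestr setTI lebesgue_measure_itv /= lte_fin ltr01.
by rewrite -EFinD subr0.
Qed.

Lemma unit_measure_le1 A : measurable A -> (unit_measure A <= 1)%E.
Proof. by move=> mA; rewrite -unit_measureT le_measure ?inE. Qed.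

Definition um (A : set (measurableTypeR R)) : R := fine (unit_measure A).

Lemma umE A : measurable A -> unit_measure A = (um A)%:E.
Proof.
move=> mA; rewrite /um fineK// ge0_fin_numE//.
by rewrite (le_lt_trans (unit_measure_le1 mA))// ltry.
Qed.

Lemma um_ge0 A : 0 <= um A.
Proof. by rewrite fine_ge0. Qed.

Lemma um0 : um set0 = 0.
Proof. by rewrite /um measure0. Qed.

Lemma um_le A B : measurable A -> measurable B -> A `<=` B -> um A <= um B.
Proof.
by move=> mA mB AB; rewrite -lee_fin -!umE// le_measure ?inE.
Qed.

Lemma umU A B : measurable A -> measurable B -> A `&` B = set0 ->
  um (A `|` B) = um A + um B.
Proof.
move=> mA mB AB; apply/EFin_inj; rewrite EFinD -!umE//; last exact: measurableU.
by rewrite measureU.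
Qed.

Lemma um_setU_le A B : measurable A -> measurable B ->
  um (A `|` B) <= um A + um B.
Proof.
move=> mA mB; rewrite -lee_fin EFinD -!umE//; last exact: measurableU.
exact: measureU2.
Qed.

Lemma um_itv (a b : R) : 0 <= a -> a <= b -> b <= 1 -> um `[a, b[%classic = b - a.
Proof.
move=> a0 ab b1; rewrite /um /unit_measure /mrestr.
have -> : `[a, b[%classic `&` `[0, 1[%classic = `[a, b[%classic :> set R.
  apply/setIidPl => x /=; rewrite !in_itv/= => /andP[ax xb].
  by rewrite (le_trans a0 ax) (lt_le_trans xb b1).
rewrite lebesgue_measure_itv /= lte_fin.
have [ab'|] := ltrP a b; first by rewrite -EFinD.
by move=> ba; rewrite /=; lra.
Qed.

(** The integrals of a bush are shown to converge on the sigma-algebra generated by its cells, so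
    the Radon-Nikodym property is applied to Lebesgue measure restricted to that
    sub-sigma-algebra. *)
Lemma unit_measure_sub_sigma (P : set (set (measurableTypeR R))) :
  (forall A, P A -> measurable A) ->
  exists mu : {finite_measure set (g_sigma_algebraType P) -> \bar R},
    forall A, mu A = unit_measure A.
Proof.
move=> mP.
have PB (A : set (g_sigma_algebraType P)) : measurable A -> measurable (A : set (measurableTypeR R)).
  apply: smallest_sub; last exact: mP.
  split; [exact: measurable0|move=> B mB; exact: measurableD|].
  by move=> F mF; exact: bigcup_measurable.
pose mu0 : set (g_sigma_algebraType P) -> \bar R := unit_measure.
have mu00 : mu0 set0 = 0%E by rewrite /mu0 measure0.
have mu0_ge0 A : (0 <= mu0 A)%E by [].
have mu0s : semi_sigma_additive mu0.
  move=> F mF tF mUF; apply: (@measure_semi_sigma_additive _ _ _ unit_measure) => //.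
    by move=> n; exact: PB.
  exact: PB.
pose mu1 : {measure set (g_sigma_algebraType P) -> \bar R} :=
  HB.pack mu0 (isMeasure.Build _ _ _ mu0 mu00 mu0_ge0 mu0s).
have mu1f : fin_num_fun mu1.
  by move=> A mA; rewrite /mu1/= /mu0 umE//; exact: PB.
pose mu2 : {finite_measure set (g_sigma_algebraType P) -> \bar R} :=
  HB.pack mu0 mu1 (Measure_isFinite.Build _ _ _ mu1 mu1f).
by exists mu2.
Qed.

End UnitInterval.

(** * Step functions on tilings of an interval *)

Section Tiling.
Context {R : realType} {X : normedModType R}.
Implicit Types A B : set (measurableTypeR R).

(* [(lo, hi, point, height)]: on [[lo, hi[] a step function takes the value [point];
   [height] is the second coordinate when the points lie in an epigraph. *)
Definition cell := (R * R * X * R)%type.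
Implicit Types (c : cell) (L : seq cell).

Definition lo c : R := c.1.1.1.
Definition hi c : R := c.1.1.2.
Definition pt c : X := c.1.2.
Definition ht c : R := c.2.
Definition wd c : R := hi c - lo c.
Definition body c : set (measurableTypeR R) := `[lo c, hi c[%classic.

(** With concatenation as a constructor, additivity over cells and refinement of each cell go by
    induction. Cells of zero width are allowed. *)
Inductive tiling : R -> R -> seq cell -> Prop :=
| tiling1 c : lo c <= hi c -> tiling (lo c) (hi c) [:: c]
| tiling_cat x y z L1 L2 :
    tiling x y L1 -> tiling y z L2 -> tiling x z (L1 ++ L2).

Lemma tiling_sub x y L : tiling x y L ->
  x <= y /\ forall c, c \in L -> [/\ x <= lo c, lo c <= hi c & hi c <= y].
Proof.
elim=> {x y L} [c ch|x y z L1 L2 _ [xy h1] _ [yz h2]].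
  by split=> // c'; rewrite inE => /eqP ->.
split=> [|c]; first exact: le_trans xy yz.
rewrite mem_cat => /orP[/h1[? ? h]|/h2[h ? ?]]; split=> //.
  exact: le_trans h yz.
exact: le_trans xy h.
Qed.

Lemma measurable_body c : measurable (body c).
Proof. exact: measurable_itv. Qed.
Hint Resolve measurable_body : core.

Lemma measurableI_body A c : measurable A -> measurable (A `&` body c).
Proof. by move=> mA; exact: measurableI. Qed.

Lemma um_itv_split A (x y z : R) : measurable A -> x <= y -> y <= z ->
  um (A `&` `[x, z[%classic) = um (A `&` `[x, y[%classic) + um (A `&` `[y, z[%classic).
Proof.
move=> mA xy yz; rewrite -umU; last first.
- rewrite -subset0 => t /= [[_ +] [_]]; rewrite !in_itv/= => /andP[_ ty] /andP[yt _].
  by rewrite ltNge yt in ty.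
- by apply: measurableI => //; exact: measurable_itv.
- by apply: measurableI => //; exact: measurable_itv.
congr um; rewrite -setIUr; congr setI.
apply/seteqP; split=> t /=; rewrite !in_itv/=.
  move=> /andP[xt tz]; have [ty|yt] := ltP t y.
    by left; rewrite xt.
  by right; rewrite tz.
move=> [/andP[-> ty]|/andP[yt ->]].
  by rewrite (lt_le_trans ty yz).
by rewrite (le_trans xy yt).
Qed.

Lemma um_tiling x y L A : tiling x y L -> measurable A ->
  um (A `&` `[x, y[%classic) = \sum_(c <- L) um (A `&` body c).
Proof.
move=> pL mA; elim: pL => {x y L} [c _|x y z L1 L2 p1 ih1 p2 ih2].
  by rewrite big_seq1.
by rewrite big_cat/= -ih1 -ih2 -(um_itv_split mA (tiling_sub p1).1 (tiling_sub p2).1).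
Qed.

Lemma um_tiling01 L A : tiling 0 1 L -> measurable A ->
  \sum_(c <- L) um (A `&` body c) = um A.
Proof.
move=> pL mA; rewrite -(um_tiling pL mA) /um /unit_measure /mrestr.
by rewrite -setIA setIid.
Qed.

Lemma um_body L c : tiling 0 1 L -> c \in L -> um (body c) = wd c.
Proof.
by move=> pL cL; have [? ? ?] := (tiling_sub pL).2 _ cL; rewrite um_itv.
Qed.

Lemma wd_ge0 x y L c : tiling x y L -> c \in L -> 0 <= wd c.
Proof.
by move=> pL cL; have [_ + _] := (tiling_sub pL).2 _ cL; rewrite subr_ge0.
Qed.

Lemma sum_wd x y L : tiling x y L -> \sum_(c <- L) wd c = y - x.
Proof.
elim=> {x y L} [c _|x y z L1 L2 _ ih1 _ ih2]; first by rewrite big_seq1.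
by rewrite big_cat/= ih1 ih2; ring.
Qed.

Lemma tiling_flatten x y L (F : cell -> seq cell) : tiling x y L ->
  (forall c, c \in L -> tiling (lo c) (hi c) (F c)) ->
  tiling x y (flatten [seq F c | c <- L]).
Proof.
elim=> {x y L} [c _ FL|x y z L1 L2 _ ih1 _ ih2 FL] /=.
  by rewrite cats0; apply: FL; rewrite inE.
rewrite map_cat flatten_cat; apply: (@tiling_cat _ y).
  by apply: ih1 => c cL; apply: FL; rewrite mem_cat cL.
by apply: ih2 => c cL; apply: FL; rewrite mem_cat cL orbT.
Qed.

Lemma big_flatten_map (V : nmodType) L (F : cell -> seq cell) (g : cell -> V) :
  \sum_(c <- flatten [seq F c | c <- L]) g c = \sum_(c <- L) \sum_(d <- F c) g d.
Proof. by rewrite big_flatten/= big_map. Qed.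

(** The integral over [A] of the step function coded by [L]. *)
Definition stepsum L A : X := \sum_(c <- L) um (A `&` body c) *: pt c.

Lemma disjoint_body x y L c A : tiling x y L -> c \in L ->
  A `&` `[x, y[%classic = set0 -> A `&` body c = set0.
Proof.
move=> pL cL; rewrite -!subset0 => Axy t [At ct]; apply: (Axy t); split=> //.
have [xc _ cy] := (tiling_sub pL).2 _ cL.
move: ct; rewrite /body/= !in_itv/= => /andP[ct tc].
by rewrite (le_trans xc ct) (lt_le_trans tc cy).
Qed.

Lemma stepsum_disjoint x y L A : tiling x y L ->
  A `&` `[x, y[%classic = set0 -> stepsum L A = 0.
Proof.
move=> pL Axy; rewrite /stepsum big_seq big1// => c cL.
by rewrite (disjoint_body pL cL Axy) um0 scale0r.
Qed.

Lemma stepsum_body x y L c : tiling x y L -> 0 <= x -> y <= 1 -> c \in L ->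
  stepsum L (body c) = wd c *: pt c.
Proof.
elim=> {x y L} [d dd|x y z L1 L2 p1 ih1 p2 ih2] x0 z1.
  rewrite inE => /eqP ->; rewrite /stepsum big_seq1 setIid.
  by rewrite um_itv.
have [xy h1] := tiling_sub p1; have [yz h2] := tiling_sub p2.
rewrite mem_cat /stepsum big_cat/= -!/(stepsum _ _) => /orP[cL|cL].
- rewrite ih1//; last exact: le_trans yz z1.
  rewrite (stepsum_disjoint p2) ?addr0// -subset0 => t; rewrite /body/= => -[].
  have [_ _ cy] := h1 _ cL.
  rewrite !in_itv/= => /andP[_ tc] /andP[yt _].
  by have := lt_le_trans tc cy; rewrite ltNge yt.
- rewrite ih2//; last exact: le_trans x0 xy.
  rewrite (stepsum_disjoint p1) ?add0r// -subset0 => t; rewrite /body/= => -[].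
  have [yc _ _] := h2 _ cL.
  rewrite !in_itv/= => /andP[ct _] /andP[_ ty].
  by have := lt_le_trans ty yc; rewrite ltNge ct.
Qed.

End Tiling.
#[export] Hint Resolve measurable_body : core.

Section NormedLimits.
Context {R : realType} {V : normedModType R}.

Lemma cvg_dist_le (u : nat -> V) (l a : V) (b : R) (N : nat) :
  u @ \oo --> l -> (forall n, (N <= n)%N -> `|u n - a| <= b) -> `|l - a| <= b.
Proof.
move=> ul ub; apply/ler_addgt0Pr => e e0.
have [n _ nP] := (cvgrPdist_le _ _).1 ul e e0.
have := nP (maxn n N) (leq_maxl _ _); have := ub (maxn n N) (leq_maxr _ _).
move=> h1 h2; rewrite -(subrK (u (maxn n N)) l) -addrA.
by apply: le_trans (ler_normD _ _) _; rewrite [leRHS]addrC lerD.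
Qed.

Lemma cvg_norm_le (u : nat -> V) (l : V) (b : R) (N : nat) :
  u @ \oo --> l -> (forall n, (N <= n)%N -> `|u n| <= b) -> `|l| <= b.
Proof.
move=> ul ub; rewrite -[l]subr0; apply: (cvg_dist_le (N := N) ul) => n Nn.
by rewrite subr0; exact: ub Nn.
Qed.

Lemma cvg_sum_seq (I : eqType) (s : seq I) (u : I -> nat -> V) (l : I -> V) :
  (forall i, i \in s -> u i n @[n --> \oo] --> l i) ->
  \sum_(i <- s) u i n @[n --> \oo] --> \sum_(i <- s) l i.
Proof.
elim: s => [|i s ih] ul.
  by rewrite big_nil; under eq_fun do rewrite big_nil; exact: cvg_cst.
rewrite big_cons; under eq_fun do rewrite big_cons.
apply: cvgD; first by apply: ul; rewrite inE eqxx.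
by apply: ih => j js; apply: ul; rewrite inE js orbT.
Qed.

End NormedLimits.

(** * Integrals of vector-valued simple functions *)

Section SimpleFunctions.
Context {R : realType} {X : normedModType R} {d} {T : measurableType d}
  (mu : {finite_measure set T -> \bar R}).
Implicit Types (q : seq (X * set T)) (A : set T).

Definition simple_int q A : X := \sum_(p <- q) fine (mu (A `&` p.2)) *: p.1.

Definition simple_opp q : seq (X * set T) := [seq (- p.1, p.2) | p <- q].

Lemma simple_fn_cat q1 q2 t : simple_fn (q1 ++ q2) t = simple_fn q1 t + simple_fn q2 t.
Proof. by rewrite /simple_fn big_cat. Qed.

Lemma simple_fn_opp q t : simple_fn (simple_opp q) t = - simple_fn q t.
Proof.
rewrite /simple_fn big_map /= -sumrN; apply: eq_bigr => p _.
by case: ifP => // _; rewrite oppr0.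
Qed.

Lemma simple_int_cat q1 q2 A : simple_int (q1 ++ q2) A = simple_int q1 A + simple_int q2 A.
Proof. by rewrite /simple_int big_cat. Qed.

Lemma simple_int_opp q A : simple_int (simple_opp q) A = - simple_int q A.
Proof.
rewrite /simple_int big_map /= -sumrN; apply: eq_bigr => p _.
by rewrite scalerN.
Qed.

Definition simple_meas q := forall p, List.In p q -> measurable p.2.

Lemma simple_meas_cat q1 q2 :
  simple_meas q1 -> simple_meas q2 -> simple_meas (q1 ++ q2).
Proof. by move=> h1 h2 p hp; case: (List.in_app_or _ _ _ hp) => [/h1|/h2]. Qed.

Lemma simple_meas_opp q : simple_meas q -> simple_meas (simple_opp q).
Proof. by move=> h p /(List.in_map_iff _ _ _).1[p' [<- /h]]. Qed.

Lemma simple_fn_cons p q x0 t : x0 + simple_fn (p :: q) t =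
  (if `[< p.2 t >] then (x0 + p.1) + simple_fn q t else x0 + simple_fn q t).
Proof.
rewrite /simple_fn big_cons; case: ifP => _; first by rewrite addrA.
by rewrite add0r.
Qed.

Lemma measurable_simple_norm q x0 : simple_meas q ->
  measurable_fun setT (fun t => EFin `|x0 + simple_fn q t|).
Proof.
elim: q x0 => [|p q ih] x0 mq.
  rewrite (_ : (fun t => _) = cst (`|x0|)%:E) //; last first.
    by apply/funext => t; rewrite /simple_fn big_nil addr0.
have mp : measurable p.2 by apply: mq; left.
have mq' : simple_meas q by move=> p' p'q; apply: mq; right.
rewrite -(setUv p.2); apply/measurable_funU => //; first exact: measurableC.
split.
  apply: (@eq_measurable_fun _ _ _ _ _ (fun t => (`|(x0 + p.1) + simple_fn q t|)%:E)).
    by move=> t; rewrite inE => pt; rewrite simple_fn_cons asboolT.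
  by apply: measurable_funS (ih _ mq').
apply: (@eq_measurable_fun _ _ _ _ _ (fun t => (`|x0 + simple_fn q t|)%:E)).
  by move=> t; rewrite inE => pt; rewrite simple_fn_cons asboolF.
by apply: measurable_funS (ih _ mq').
Qed.

(** The constant [x0] carries the induction: after [A] is split along the first set of [q], the
    first value is absorbed into the constant on one part and disappears on the other. *)
Lemma norm_simple_int_le q x0 A : simple_meas q -> measurable A ->
  ((`|fine (mu A) *: x0 + simple_int q A|)%:E <=
    \int[mu]_(t in A) (`|x0 + simple_fn q t|)%:E)%E.
Proof.
elim: q x0 A => [|p q ih] x0 A mq mA.
  rewrite /simple_int big_nil addr0.
  rewrite (@eq_integral _ _ _ mu A (cst (`|x0|)%:E)); last first.
    by move=> t _; rewrite /simple_fn big_nil addr0.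
  rewrite integral_cst// normrZ ger0_norm ?fine_ge0// mulrC EFinM fineK//.
  exact: fin_num_measure.
have mp : measurable p.2 by apply: mq; left.
have mq' : simple_meas q by move=> p' p'q; apply: mq; right.
have mAp : measurable (A `&` p.2) by exact: measurableI.
have mAn : measurable (A `\` p.2) by exact: measurableD.
have AE : A = (A `&` p.2) `|` (A `\` p.2) by rewrite setUIDK.
have Adisj : [disjoint (A `&` p.2) & (A `\` p.2)].
  by apply/disj_setPS => t [[_ ?] [_ ?]].
have fU (B : set T) : measurable B ->
    fine (mu (A `&` B)) = fine (mu (A `&` p.2 `&` B)) + fine (mu ((A `\` p.2) `&` B)).
  move=> mB; have m1 := measurableI _ _ mAp mB; have m2 := measurableI _ _ mAn mB.
  have dj : (A `&` p.2 `&` B) `&` ((A `\` p.2) `&` B) = set0.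
    by rewrite -subset0 => t [[[_ ?] _] [[_ ?] _]].
  rewrite -(fineD (fin_num_measure mu _ m1) (fin_num_measure mu _ m2)).
  by rewrite -(measureU mu m1 m2 dj) -setIUl -AE.
have -> : fine (mu A) *: x0 + simple_int (p :: q) A =
   (fine (mu (A `&` p.2)) *: (x0 + p.1) + simple_int q (A `&` p.2)) +
   (fine (mu (A `\` p.2)) *: x0 + simple_int q (A `\` p.2)).
  rewrite (_ : simple_int (p :: q) A = fine (mu (A `&` p.2)) *: p.1 + simple_int q A);
    last by rewrite /simple_int big_cons.
  have -> : simple_int q A = simple_int q (A `&` p.2) + simple_int q (A `\` p.2).
    rewrite /simple_int -big_split/=.
    elim: q mq' {ih mq} => [|b q ih] mq; first by rewrite !big_nil.
    rewrite !big_cons ih; last by move=> b' b'q; apply: mq; right.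
    by congr (_ + _); rewrite fU ?scalerDl//; apply: mq; left.
  have := fU setT measurableT; rewrite !setIT => ->.
  by apply: pair_ext => u; rewrite !pairE; ring.
rewrite [in leRHS]AE ge0_integral_setU//; last first.
  by apply: measurable_funS (measurable_simple_norm x0 mq) => //; exact: measurableT.
rewrite (@eq_integral _ _ _ mu (A `&` p.2) (fun t => (`|(x0 + p.1) + simple_fn q t|)%:E)); last first.
  by move=> t; rewrite inE => -[_ pt]; rewrite simple_fn_cons asboolT.
rewrite (@eq_integral _ _ _ mu (A `\` p.2) (fun t => (`|x0 + simple_fn q t|)%:E)); last first.
  by move=> t; rewrite inE => -[_ pt]; rewrite simple_fn_cons asboolF.
apply: le_trans (leeD (ih _ _ mq' mAp) (ih _ _ mq' mAn)).
by rewrite -EFinD lee_fin ler_normD.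
Qed.

End SimpleFunctions.

(* A bush is an approximate martingale of step functions [L n] on [[0, 1[], each cell
   [c] being refined into [F n c] with conditional mean within [ed n c] of [pt c].
   It converges to a vector measure, whose density would have to approximate the
   step functions, so the steps cannot all have size [eps0] ([no_bush]). *)
Section Bush.
Context {R : realType} {X : completeNormedModType R}.
Context (L : nat -> seq (@cell R X)) (F : nat -> @cell R X -> seq (@cell R X)).
Context (ed : nat -> @cell R X -> R) (Rb M : R).
Context (L0 : tiling 0 1 (L 0%N)).
Context (LS : forall n, L n.+1 = flatten [seq F n c | c <- L n]).
Context (FP : forall n c, c \in L n -> tiling (lo c) (hi c) (F n c)).
Context (Lb : forall n c, c \in L n -> `|pt c| <= Rb).
Context (ed0 : forall n c, c \in L n -> 0 <= ed n c).
Context (Ferr : forall n c, c \in L n ->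
  `|wd c *: pt c - \sum_(d <- F n c) wd d *: pt d| <= wd c * ed n c).
Context (edM : forall n, \sum_(k < n) \sum_(c <- L k) wd c * ed k c <= M).
Implicit Types A B : set (measurableTypeR R).

Lemma bush_tiling n : tiling 0 1 (L n).
Proof.
elim: n => [//|n ih]; rewrite LS; apply: tiling_flatten => // c; exact: FP.
Qed.
Let Lp := bush_tiling.

(** Inside [[0, 1[], the set [B] is a union of cells of every level from [m] on. *)
Definition adapted m B := forall n, (m <= n)%N -> forall c, c \in L n ->
  body c `<=` B \/ B `&` body c = set0.

Lemma adapted_le m n B : (m <= n)%N -> adapted m B -> adapted n B.
Proof. by move=> mn aB k nk; apply: aB; exact: leq_trans nk. Qed.

Lemma adaptedC m B : adapted m B -> adapted m (~` B).
Proof.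
move=> aB n mn c cL; have [cB|Bc] := aB n mn c cL.
  by right; rewrite -subset0 => t [nBt /cB].
by left=> t ct Bt; have : (B `&` body c) t by []; rewrite Bc.
Qed.

Lemma adaptedU m1 m2 B1 B2 : adapted m1 B1 -> adapted m2 B2 ->
  adapted (maxn m1 m2) (B1 `|` B2).
Proof.
move=> a1 a2 n; rewrite geq_max => /andP[mn1 mn2] c cL.
have [c1|c1] := a1 n mn1 c cL; first by left=> t /c1; left.
have [c2|c2] := a2 n mn2 c cL; first by left=> t /c2; right.
by right; rewrite setIUl c1 c2 setU0.
Qed.

Lemma tiling_nested (x y : R) (K : seq (@cell R X)) c d : tiling x y K ->
  c \in K -> d \in K -> body d `<=` body c \/ body c `&` body d = set0.
Proof.
elim=> {x y K} [e _|x y z K1 K2 p1 ih1 p2 ih2].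
  by rewrite !inE => /eqP -> /eqP ->; left.
have disj e1 e2 : e1 \in K1 -> e2 \in K2 -> body e1 `&` body e2 = set0.
  move=> /((tiling_sub p1).2)[_ _ h1] /((tiling_sub p2).2)[h2 _ _].
  rewrite -subset0 => t; rewrite /body/= !in_itv/= => -[/andP[_ te1] /andP[e2t _]].
  by have := lt_le_trans te1 (le_trans h1 (le_trans h2 e2t)); rewrite ltxx.
rewrite !mem_cat => /orP[c1|c2] /orP[d1|d2]; [exact: ih1| | |exact: ih2].
  by right; exact: disj.
by right; rewrite setIC; exact: disj.
Qed.

Lemma child_body n c d : c \in L n -> d \in F n c -> body d `<=` body c.
Proof.
move=> cL dF; have [cd _ dc] := (tiling_sub (FP cL)).2 _ dF.
move=> t; rewrite /body/= !in_itv/= => /andP[dt td].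
by rewrite (le_trans cd dt) (lt_le_trans td dc).
Qed.

Lemma adapted_body n c : c \in L n -> adapted n (body c).
Proof.
move=> cL m /subnK <-; elim: (m - n)%N => [|k ih] d.
  by move=> dL; exact: tiling_nested (Lp n) _ _.
rewrite addSn LS => /flattenP[_ /mapP[e eL ->] dF].
have de := child_body eL dF.
have [ec|ce] := ih _ eL; first by left; exact: subset_trans de ec.
by right; rewrite -subset0 -ce; exact: setIS.
Qed.

(** The approximate martingale property: over a union of cells, refinement changes the integral only
    by the conditional-mean errors of the cells in it. *)
Lemma stepsum_next n k A : measurable A -> adapted k A -> (k <= n)%N ->
  `|stepsum (L n.+1) A - stepsum (L n) A| <=
    \sum_(c <- L n) um (A `&` body c) * ed n c.
Proof.
move=> mA aA kn; rewrite /stepsum LS big_flatten_map -sumrB.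
apply: le_trans (ler_norm_sum _ _ _) _.
rewrite big_seq [leRHS]big_seq; apply: ler_sum => c cL.
have wdF d : d \in F n c -> um (body d) = wd d.
  move=> dF; apply: (um_body (Lp n.+1)); rewrite LS.
  by apply/flattenP; exists (F n c) => //; apply/mapP; exists c.
have [cA|Ac] := aA n kn c cL.
  have -> : A `&` body c = body c by apply/setIidPr.
  rewrite (um_body (Lp n) cL) distrC (_ : \sum_(d <- F n c) _ = \sum_(d <- F n c) wd d *: pt d).
    exact: Ferr.
  rewrite big_seq [RHS]big_seq; apply: eq_bigr => d dF.
  have -> : A `&` body d = body d.
    by apply/setIidPr; apply: subset_trans cA; exact: child_body dF.
  by rewrite wdF.
rewrite Ac um0 scale0r subr0 mul0r big_seq big1 ?normr0// => d dF.
suff -> : A `&` body d = set0 by rewrite um0 scale0r.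
by rewrite -subset0 -Ac; apply: setIS; exact: child_body dF.
Qed.

Definition err n := \sum_(c <- L n) wd c * ed n c.

Lemma err_ge0 n : 0 <= err n.
Proof.
rewrite /err big_seq sumr_ge0// => c cL; rewrite mulr_ge0 ?ed0//.
exact: wd_ge0 (Lp n) cL.
Qed.

Lemma err_tail e : 0 < e ->
  exists N, forall m n, (N <= m)%N -> \sum_(m <= k < n) err k <= e.
Proof.
move=> e0; pose V := [set \sum_(k < n) err k | n in [set: nat]].
have hV : has_sup V.
  by split; [exists (\sum_(k < 0) err k), 0%N|exists M => _ [n _ <-]; exact: edM].
have [_ [N _ <-] Nsup] := sup_adherent e0 hV.
exists N => m n Nm; have [nm|mn] := leqP n m; first by rewrite big_geq// ltW.
have : \sum_(k < n) err k <= sup V by apply: sup_upper_bound => //; exists n.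
rewrite -!(big_mkord xpredT err) in Nsup *.
rewrite (big_cat_nat (n := m)) ?(ltnW mn)//= (big_cat_nat (n := N) (p := m))//=.
have : 0 <= \sum_(N <= k < m) err k by rewrite sumr_ge0// => k _; exact: err_ge0.
lra.
Qed.

Lemma stepsum_tele n K A : measurable A -> adapted n A -> (n <= K)%N ->
  `|stepsum (L K) A - stepsum (L n) A| <=
    \sum_(n <= j < K) \sum_(c <- L j) um (A `&` body c) * ed j c.
Proof.
move=> mA aA /subnK <-; elim: (K - n)%N => [|k ih].
  by rewrite add0n subrr normr0 big_geq.
rewrite addSn big_nat_recr/= ?leq_addl//.
have := stepsum_next mA aA (leq_addl k n).
set a := stepsum _ _; set b := stepsum (L (k + n)) _.
move=> h; rewrite -(subrK b a) -addrA; apply: le_trans (ler_normD _ _) _.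
by rewrite [leRHS]addrC lerD.
Qed.

Lemma sum_um_body_le n A : measurable A ->
  \sum_(c <- L n) um (A `&` body c) * ed n c <= err n.
Proof.
move=> mA; rewrite /err big_seq [leRHS]big_seq; apply: ler_sum => c cL.
rewrite ler_wpM2r ?ed0// -(um_body (Lp n) cL) um_le//; exact: measurableI_body.
Qed.

Definition symd A B := (A `\` B) `|` (B `\` A).

Lemma um_symd A B : measurable A -> measurable B -> `|um A - um B| <= um (symd A B).
Proof.
move=> mA mB; have mAB := measurableD mA mB; have mBA := measurableD mB mA.
have mD : measurable (symd A B) by exact: measurableU.
suff h C D : measurable C -> measurable D -> um C <= um D + um (symd C D).
  have := h _ _ mA mB; have := h _ _ mB mA.
  by rewrite /symd setUC ler_norml; lra.
move=> mC mE; have mCE := measurableD mC mE; have mEC := measurableD mE mC.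
have : um C = um (C `&` D) + um (C `\` D).
  rewrite -umU//; [by rewrite setUIDK|exact: measurableI|].
  by rewrite setDE setIACA setICr setI0.
have : um (C `&` D) <= um D by apply: um_le => //; exact: measurableI.
have : um (C `\` D) <= um (symd C D).
  by apply: um_le => //; [exact: measurableU|exact: subsetUl].
lra.
Qed.

Lemma stepsum_close n A B : measurable A -> measurable B ->
  `|stepsum (L n) A - stepsum (L n) B| <= Rb * um (symd A B).
Proof.
move=> mA mB.
have mD : measurable (symd A B) by apply: measurableU; exact: measurableD.
rewrite /stepsum -sumrB; apply: le_trans (ler_norm_sum _ _ _) _.
rewrite -(um_tiling01 (Lp n) mD) mulr_sumr big_seq [leRHS]big_seq.
apply: ler_sum => c cL; rewrite -scalerBl normrZ mulrC ler_pM//; first exact: Lb cL.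
apply: le_trans (um_symd (measurableI_body c mA) (measurableI_body c mB)) _.
apply: um_le; [|exact: measurableI|].
  by apply: measurableU; apply: measurableD; exact: measurableI_body.
move=> t [[[At ct] nB]|[[Bt ct] nA]]; split=> //.
  by left; split=> // Bt; apply: nB.
by right; split=> // At; apply: nA.
Qed.

Lemma stepsum_le n A : measurable A -> `|stepsum (L n) A| <= Rb * um A.
Proof.
move=> mA; have := @stepsum_close n A set0 mA measurable0.
have -> : stepsum (L n) set0 = 0.
  by rewrite /stepsum big1// => c _; rewrite set0I um0 scale0r.
by rewrite subr0 /symd setD0 set0D setU0.
Qed.

Definition adapted_sets : set (set (measurableTypeR R)) :=
  [set B | measurable B /\ exists m, adapted m B].

Lemma um_bigcup_tail (D : nat -> set (measurableTypeR R)) e :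
  (forall n, measurable (D n)) -> 0 < e ->
  exists N, forall n, (N <= n)%N ->
    um (\bigcup_k D k `\` \big[setU/set0]_(k < n) D k) <= e.
Proof.
move=> mD e0; have mU : measurable (\bigcup_k D k) by exact: bigcup_measurable.
have mS n : measurable (\big[setU/set0]_(k < n) D k) by exact: bigsetU_measurable.
pose S n := \big[setU/set0]_(k < n.+1) D k.
have SE : \bigcup_n S n = \bigcup_k D k by exact: bigcup_bigsetU_bigcup.
have mUS : measurable (\bigcup_n S n) by rewrite SE.
have homS : {homo S : n m / (n <= m)%N >-> (n <= m)%O}.
  by move=> n m nm; apply/subsetPset; exact: subset_bigsetU.
have h0 : unit_measure (S n) @[n --> \oo] --> (um (\bigcup_k D k))%:E.
  rewrite -umE// -SE.
  exact: (@nondecreasing_cvg_mu _ _ _ (@unit_measure R) S (fun n => mS n.+1) mUS homS).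
have h : um (S n) @[n --> \oo] --> um (\bigcup_k D k) by exact: fine_cvg h0.
have [N _ NP] := (cvgrPdist_le _ _).1 h e e0.
exists N.+1 => -[//|n] Nn; have := NP n Nn => /= hn.
apply: le_trans hn; have sub : \big[setU/set0]_(k < n.+1) D k `<=` \bigcup_k D k.
  by rewrite -bigcup_mkord => t [k _ ?]; exists k.
have : um (\bigcup_k D k) = um (\bigcup_k D k `\` \big[setU/set0]_(k < n.+1) D k) +
   um (\big[setU/set0]_(k < n.+1) D k).
  rewrite -umU//; first by rewrite setUC setDUK.
    by apply: measurableD.
  by rewrite setDKI.
move=> ->; rewrite addrK; exact: ler_norm.
Qed.

Definition approximable A := measurable A /\ forall e, 0 < e ->
  exists m B, [/\ measurable B, adapted m B & um (symd A B) <= e].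

Lemma approximableU A1 A2 : approximable A1 -> approximable A2 -> approximable (A1 `|` A2).
Proof.
move=> [m1 h1] [m2 h2]; split=> [|e e0]; first exact: measurableU.
have e2 : 0 < e / 2 by rewrite divr_gt0.
have [k1 [B1 [mB1 a1 u1]]] := h1 _ e2; have [k2 [B2 [mB2 a2 u2]]] := h2 _ e2.
exists (maxn k1 k2), (B1 `|` B2); split; [exact: measurableU|exact: adaptedU|].
have s1 : measurable (symd A1 B1) by apply: measurableU; exact: measurableD.
have s2 : measurable (symd A2 B2) by apply: measurableU; exact: measurableD.
apply: (@le_trans _ _ (um (symd A1 B1 `|` symd A2 B2))).
  apply: um_le; [|exact: measurableU|].
    by apply: measurableU; apply: measurableD; exact: measurableU.
  move=> t [[[At|At] nB]|[[Bt|Bt] nA]].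
  - by left; left; split=> // ?; apply: nB; left.
  - by right; left; split=> // ?; apply: nB; right.
  - by left; right; split=> // ?; apply: nA; left.
  - by right; right; split=> // ?; apply: nA; right.
have := um_setU_le s1 s2; lra.
Qed.

(** Approximability in measure by adapted sets is stable under complements and finite unions, and
    continuity of the measure reduces countable unions to finite ones. *)
Lemma sigma_approximable A : <<s adapted_sets >> A -> approximable A.
Proof.
apply: smallest_sub; last first.
  move=> B [mB [m aB]]; split=> // e e0; exists m, B; split=> //.
  by rewrite /symd setDv setU0 um0 ltW.
split.
- split=> // e e0; exists 0%N, set0; split=> //; last by rewrite /symd setDv setU0 um0 ltW.
  by move=> n _ c _; right; rewrite set0I.
- move=> B [mB hB]; rewrite setTD; split=> [|e e0]; first exact: measurableC.
  have [m [D [mD aD u]]] := hB e e0; exists m, (~` D); split.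
  + exact: measurableC.
  + exact: adaptedC.
  + by rewrite /symd !setDE !setCK setUC [_ `&` B]setIC [_ `&` D]setIC in u *.
- move=> D aD; have mD n : measurable (D n) := (aD n).1.
  split=> [|e e0]; first exact: bigcup_measurable.
  have e2 : 0 < e / 2 by rewrite divr_gt0.
  have [N NP] := um_bigcup_tail mD e2; have {NP} := NP N (leqnn _).
  set U := \big[setU/set0]_(k < N) D k => tail.
  have [mU /(_ _ e2)[m [B [mB aB uB]]]] : approximable U.
    rewrite /U; elim/big_ind: _ => [|A1 A2|//]; last exact: approximableU.
    split=> // e' e'0; exists 0%N, set0; split=> //; last by rewrite /symd setDv setU0 um0 ltW.
    by move=> n _ c _; right; rewrite set0I.
  have mV : measurable (\bigcup_k D k) by exact: bigcup_measurable.
  have UV : U `<=` \bigcup_k D k.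
    by rewrite /U -bigcup_mkord => t [k _ ?]; exists k.
  have s1 : measurable (symd U B) by apply: measurableU; exact: measurableD.
  have s2 : measurable (\bigcup_k D k `\` U) by exact: measurableD.
  exists m, B; split=> //.
  apply: (@le_trans _ _ (um (symd U B `|` (\bigcup_k D k `\` U)))).
    apply: um_le; [by apply: measurableU; exact: measurableD|exact: measurableU|].
    move=> t [[Vt nB]|[Bt nV]].
      by have [Ut|nU] := pselect (U t); [left; left|right].
    by left; right; split=> // /UV.
  have := um_setU_le s1 s2; lra.
Qed.

Definition bush_measure A : X := lim (stepsum (L n) A @[n --> \oo]).

(** On adapted sets the integrals are Cauchy because the errors are summable; the common bound [Rb]
    on the values transfers this to sets approximated in measure. *)
Lemma stepsum_cvg A : <<s adapted_sets >> A ->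
  stepsum (L n) A @[n --> \oo] --> bush_measure A.
Proof.
move=> /sigma_approximable[mA hA]; apply/cauchy_cvgP/cauchy_exP => e e0.
have Rb0 : 0 <= Rb.
  have [c cL] : exists c, c \in L 0%N.
    case: (L 0%N) (sum_wd L0) => [|c l _]; last by exists c; rewrite inE eqxx.
    by rewrite big_nil subr0 => /eqP; rewrite eq_sym oner_eq0.
  exact: le_trans (normr_ge0 _) (Lb cL).
have R1 : 0 < Rb + 1 by lra.
have e4 : 0 < e / 4 by rewrite divr_gt0.
have [m [B [mB aB uB]]] := hA (e / 4 / (Rb + 1)) (divr_gt0 e4 R1).
have {uB} RB : Rb * um (symd A B) <= e / 4.
  apply: (@le_trans _ _ ((Rb + 1) * um (symd A B))).
    by rewrite ler_wpM2r ?um_ge0//; lra.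
  by rewrite mulrC -ler_pdivlMr//; apply: uB.
have [N NP] := @err_tail (e / 4) e4.
exists (stepsum (L (maxn m N)) A); exists (maxn m N) => // n /= mn.
rewrite -ball_normE /= distrC.
have h1 := le_trans (stepsum_close n mA mB) RB.
have h2 := le_trans (stepsum_close (maxn m N) mA mB) RB.
have aB' : adapted (maxn m N) B by apply: adapted_le aB; exact: leq_maxl.
have h3 : `|stepsum (L n) B - stepsum (L (maxn m N)) B| <= e / 4.
  apply: le_trans (stepsum_tele mB aB' mn) _.
  apply: le_trans (NP (maxn m N) n (leq_maxr _ _)).
  by apply: ler_sum => j _; exact: sum_um_body_le.
have -> : stepsum (L n) A - stepsum (L (maxn m N)) A =
   (stepsum (L n) A - stepsum (L n) B) + (stepsum (L n) B - stepsum (L (maxn m N)) B) -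
   (stepsum (L (maxn m N)) A - stepsum (L (maxn m N)) B).
  by apply: pair_ext => u; rewrite !pairE; ring.
have := ler_normB (stepsum (L n) A - stepsum (L n) B +
  (stepsum (L n) B - stepsum (L (maxn m N)) B))
   (stepsum (L (maxn m N)) A - stepsum (L (maxn m N)) B).
have := ler_normD (stepsum (L n) A - stepsum (L n) B)
  (stepsum (L n) B - stepsum (L (maxn m N)) B).
lra.
Qed.

Let TM : set (set (measurableTypeR R)) := <<s adapted_sets >>.

Lemma sigma_adapted_measurable A : TM A -> measurable A.
Proof. by move=> /sigma_approximable[]. Qed.

Lemma sigma_adapted_body n c : c \in L n -> TM (body c).
Proof.
move=> cL; apply: sub_gen_smallest; split; first exact: measurable_body.
by exists n; exact: adapted_body.
Qed.

Lemma bush_le A : TM A -> `|bush_measure A| <= Rb * um A.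
Proof.
move=> tA; apply: (cvg_norm_le (N := 0%N) (stepsum_cvg tA)) => n _.
by apply: stepsum_le; exact: sigma_adapted_measurable tA.
Qed.

Lemma Rb_ge0 : 0 <= Rb.
Proof.
have [c cL] : exists c, c \in L 0%N.
  case: (L 0%N) (sum_wd L0) => [|c l _]; last by exists c; rewrite inE eqxx.
  by rewrite big_nil subr0 => /eqP; rewrite eq_sym oner_eq0.
exact: le_trans (normr_ge0 _) (Lb cL).
Qed.

Lemma bush_add A B : TM A -> TM B -> A `&` B = set0 ->
  bush_measure (A `|` B) = bush_measure A + bush_measure B.
Proof.
move=> tA tB AB; have mA := sigma_adapted_measurable tA.
have mB := sigma_adapted_measurable tB.
have tAB : TM (A `|` B).
  exact: (@measurableU _ (g_sigma_algebraType adapted_sets) A B tA tB).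
apply: (cvg_unique (@norm_hausdorff R X) (stepsum_cvg tAB)).
have -> : (fun n => stepsum (L n) (A `|` B)) =
    (fun n => stepsum (L n) A + stepsum (L n) B).
  apply/funext => n; rewrite /stepsum -big_split; apply: eq_bigr => c _ /=.
  rewrite setIUl umU ?scalerDl//; [exact: measurableI|exact: measurableI|].
  by rewrite setIACA AB set0I.
exact: cvgD (stepsum_cvg tA) (stepsum_cvg tB).
Qed.

Lemma bush_countably_additive :
  @countably_additive_vm R X _ (g_sigma_algebraType adapted_sets) bush_measure.
Proof.
move=> D tD dD; have mD n : measurable (D n : set (measurableTypeR R)).
  exact: (sigma_adapted_measurable (tD n)).
have tU n : TM (\big[setU/set0]_(k < n) D k).
  exact: (@bigsetU_measurable _ (g_sigma_algebraType adapted_sets)).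
have mU n : measurable (\big[setU/set0]_(k < n) D k : set (measurableTypeR R)).
  exact: (sigma_adapted_measurable (tU n)).
have tV : TM (\bigcup_k D k).
  exact: (@bigcup_measurable _ (g_sigma_algebraType adapted_sets)).
have sumD n : \sum_(i < n) bush_measure (D i) = bush_measure (\big[setU/set0]_(k < n) D k).
  elim: n => [|n ih].
    rewrite !big_ord0; apply/esym/eqP; rewrite -normr_le0.
    by have := bush_le (tU 0%N); rewrite big_ord0 um0 mulr0.
  rewrite !big_ord_recr/= ih bush_add//; first exact: tU; first exact: tD.
  rewrite -subset0 => t; rewrite -bigcup_mkord => -[[k /= kn Dk] Dn].
  have := dD k n I I; move/(_ (ex_intro _ t (conj Dk Dn))) => knE.
  by rewrite knE ltnn in kn.
apply/cvgrPdist_le => e e0; have R1 : 0 < Rb + 1 by have := Rb_ge0; lra.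
have [N NP] := um_bigcup_tail mD (divr_gt0 e0 R1).
exists N => // n /= Nn; rewrite sumD.
have sub : \big[setU/set0]_(k < n) D k `<=` \bigcup_k D k.
  by rewrite -bigcup_mkord => t [k _ ?]; exists k.
have tD' : TM (\bigcup_k D k `\` \big[setU/set0]_(k < n) D k).
  exact: (@measurableD _ (g_sigma_algebraType adapted_sets) _ _ tV (tU n)).
rewrite -{1}(setDUK sub) (bush_add (tU n) tD' (setDIK _ _)).
rewrite addrAC subrr add0r; apply: le_trans (bush_le tD') _.
apply: (@le_trans _ _ ((Rb + 1) * um (\bigcup_k D k `\` \big[setU/set0]_(k < n) D k))).
  by rewrite ler_wpM2r ?um_ge0//; lra.
by rewrite mulrC -ler_pdivlMr//; exact: NP.
Qed.

Lemma bush_bounded_variation :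
  @bounded_variation_vm R X _ (g_sigma_algebraType adapted_sets) bush_measure.
Proof.
exists Rb => n B tB dB.
have mB i : measurable (B i : set (measurableTypeR R)).
  exact: (sigma_adapted_measurable (tB i)).
apply: (@le_trans _ _ (\sum_(i < n) Rb * um (B i))).
  by apply: ler_sum => i _; exact: (bush_le (tB i)).
rewrite -mulr_sumr -[leRHS]mulr1 ler_wpM2l ?Rb_ge0//.
have mU : measurable (\big[setU/set0]_(i < n) (B i : set (measurableTypeR R))).
  exact: bigsetU_measurable.
have : (unit_measure (\big[setU/set0]_(i < n) (B i : set (measurableTypeR R))) <= 1)%E.
  exact: unit_measure_le1.
rewrite (measure_bigsetU_ord (@unit_measure R) xpredT mB dB).
rewrite (_ : (\sum_(i < n) _)%E = (\sum_(i < n) um (B i))%:E) ?lee_fin//.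
by rewrite -sumEFin; apply: eq_bigr => i _; rewrite -umE.
Qed.

(** The errors made at a later level [j] inside the cells of level [n] add up to [err j], since
    these cells tile [[0, 1[]; the tail of a convergent series remains. *)
Lemma bush_tail e : 0 < e -> exists N, forall n, (N <= n)%N ->
  \sum_(c <- L n) `|bush_measure (body c) - wd c *: pt c| <= e.
Proof.
move=> e0; have [N NP] := err_tail e0; exists N => n Nn.
have cv : \sum_(c <- L n) `|stepsum (L K) (body c) - wd c *: pt c| @[K --> \oo] -->
    \sum_(c <- L n) `|bush_measure (body c) - wd c *: pt c|.
  apply: (@cvg_sum_seq R R^o _ (L n) (fun c K => `|stepsum (L K) (body c) - wd c *: pt c|)).
  move=> c cL; apply: cvg_norm; apply: cvgB; last exact: cvg_cst.
  exact: (stepsum_cvg (sigma_adapted_body cL)).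
apply: le_trans (ler_norm _) _.
apply: (@cvg_norm_le R R^o _ _ e n cv) => K nK; rewrite ger0_norm ?sumr_ge0//.
apply: le_trans (NP n K Nn).
apply: (@le_trans _ _ (\sum_(c <- L n) \sum_(n <= j < K)
    \sum_(d <- L j) um (body c `&` body d) * ed j d)).
  rewrite big_seq [leRHS]big_seq; apply: ler_sum => c cL.
  rewrite -(stepsum_body (Lp n) (lexx _) (lexx _) cL).
  exact: stepsum_tele (measurable_body c) (adapted_body cL) nK.
rewrite exchange_big/=; apply: ler_sum => j _; rewrite exchange_big/= /err.
rewrite big_seq [leRHS]big_seq; apply: ler_sum => d dL.
rewrite -mulr_suml ler_wpM2r ?ed0//.
rewrite (eq_bigr (fun c => um (body d `&` body c))); last by move=> c _; rewrite setIC.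
by rewrite (um_tiling01 (Lp n))// (um_body (Lp j) dL).
Qed.

Let T := g_sigma_algebraType adapted_sets.

Lemma integral_tiling (mu : {finite_measure set T -> \bar R}) (phi : T -> \bar R)
    (x y : R) (K : seq (@cell R X)) : measurable_fun setT phi -> (forall t, (0 <= phi t)%E) ->
  tiling x y K -> (forall c, c \in K -> TM (body c)) ->
  TM `[x, y[%classic /\
  (\sum_(c <- K) \int[mu]_(t in (body c : set T)) phi t =
     \int[mu]_(t in (`[x, y[%classic : set T)) phi t)%E.
Proof.
move=> mphi phi0; elim=> {x y K} [c _|x y z K1 K2 p1 ih1 p2 ih2] tK.
  by rewrite big_seq1; split=> //; apply: tK; rewrite inE.
have [|t1 e1] := ih1; first by move=> c cK; apply: tK; rewrite mem_cat cK.
have [|t2 e2] := ih2; first by move=> c cK; apply: tK; rewrite mem_cat cK orbT.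
have [xy _] := tiling_sub p1; have [yz _] := tiling_sub p2.
have xzE : (`[x, z[%classic : set T) = `[x, y[%classic `|` `[y, z[%classic.
  apply/seteqP; split=> t /=; rewrite !in_itv/=.
    by move=> /andP[xt tz]; have [ty|yt] := ltP t y; [left; rewrite xt|right; rewrite tz].
  by move=> [/andP[-> ty]|/andP[yt ->]]; rewrite ?(lt_le_trans ty yz) ?(le_trans xy yt).
split; first by rewrite xzE; exact: (@measurableU _ T).
rewrite big_cat/= e1 e2 xzE ge0_integral_setU//.
  exact: measurable_funS mphi.
apply/disj_setPS => t /=; rewrite !in_itv/= => -[/andP[_ ty] /andP[yt _]].
by rewrite ltNge yt in ty.
Qed.

Definition usum (q : seq (X * set (measurableTypeR R))) A : X :=
  \sum_(p <- q) um (A `&` p.2) *: p.1.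

(** Each set of the simple function is replaced by an adapted one. The error is uniform in [n],
    because it is the measure of a symmetric difference cut up by a tiling. *)
Lemma usum_adapted (q : seq (X * set (measurableTypeR R))) e :
  (forall p, List.In p q -> TM p.2) -> 0 < e ->
  exists q' m, (forall p, List.In p q' -> adapted m p.2) /\
    forall n, \sum_(c <- L n) `|usum q (body c) - usum q' (body c)| <= e.
Proof.
elim: q e => [|[x A] q ih] e tq e0.
  exists [::], 0%N; split=> // n; rewrite big1 ?ltW// => c _.
  by rewrite subrr normr0.
have e2 : 0 < e / 2 by rewrite divr_gt0.
have [|q' [m [aq' q'e]]] := ih _ _ e2; first by move=> p pq; apply: tq; right.
have [mA hA] := sigma_approximable (tq (x, A) (or_introl erefl)).
have x1 : 0 < `|x| + 1 by rewrite ltr_wpDl.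
have [k [B [mB aB uB]]] := hA _ (divr_gt0 e2 x1).
exists ((x, B) :: q'), (maxn m k); split=> [p [<-|/aq'] /=|n].
- by apply: adapted_le aB; exact: leq_maxr.
- by apply: adapted_le; exact: leq_maxl.
have mD : measurable (symd A B) by apply: measurableU; exact: measurableD.
have hx : \sum_(c <- L n) um (symd A B `&` body c) * `|x| <= e / 2.
  rewrite -mulr_suml (um_tiling01 (Lp n) mD).
  apply: (@le_trans _ _ (um (symd A B) * (`|x| + 1))).
    by rewrite ler_wpM2l ?um_ge0// lerDl.
  by rewrite -ler_pdivlMr.
apply: (@le_trans _ _ (\sum_(c <- L n) (um (symd A B `&` body c) * `|x| +
    `|usum q (body c) - usum q' (body c)|))); last first.
  by rewrite big_split/=; have := q'e n; lra.
apply: ler_sum => c _; rewrite /usum !big_cons -!/(usum _ _) /=.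
set a := um (body c `&` A); set b := um (body c `&` B).
have -> : a *: x + usum q (body c) - (b *: x + usum q' (body c)) =
    (a - b) *: x + (usum q (body c) - usum q' (body c)).
  by apply: pair_ext => u; rewrite !pairE; ring.
apply: le_trans (ler_normD _ _) _; rewrite lerD2r normrZ ler_wpM2r//.
rewrite /a /b !(setIC (body c)).
apply: le_trans (um_symd (measurableI_body c mA) (measurableI_body c mB)) _.
apply: um_le; [|exact: measurableI|].
  by apply: measurableU; apply: measurableD; exact: measurableI_body.
move=> t [[[At ct] nB]|[[Bt ct] nA]]; split=> //.
  by left; split=> // Bt; apply: nB.
by right; split=> // At; apply: nA.
Qed.

(** A simple function with adapted sets is constant on a cell, so the cell and its children see the
    same value [v]. *)
Lemma usum_child (q : seq (X * set (measurableTypeR R))) m n c :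
  (forall p, List.In p q -> adapted m p.2) -> (m <= n)%N -> c \in L n ->
  exists v, usum q (body c) = wd c *: v /\
    forall d, d \in F n c -> usum q (body d) = wd d *: v.
Proof.
move=> aq mn cL.
have wdF d : d \in F n c -> um (body d) = wd d.
  move=> dF; apply: (um_body (Lp n.+1)); rewrite LS.
  by apply/flattenP; exists (F n c) => //; apply/mapP; exists c.
elim: q aq => [|[x B] q ih] aq.
  exists 0; split=> [|d _]; by rewrite /usum big_nil scaler0.
have [|v [vc vd]] := ih; first by move=> p pq; apply: aq; right.
have [cB|Bc] := aq (x, B) (or_introl erefl) n mn c cL.
  exists (x + v); split=> [|d dF].
    rewrite /usum big_cons -/(usum _ _) vc /= (_ : _ `&` _ = body c) ?(um_body (Lp n) cL) ?scalerDr//.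
    exact/setIidPl.
  rewrite /usum big_cons -/(usum _ _) vd//= (_ : _ `&` _ = body d) ?wdF ?scalerDr//.
  by apply/setIidPl; apply: subset_trans cB; exact: child_body dF.
exists v; split=> [|d dF].
  by rewrite /usum big_cons -/(usum _ _) vc /= setIC Bc um0 scale0r add0r.
rewrite /usum big_cons -/(usum _ _) vd//= (_ : _ `&` _ = set0) ?um0 ?scale0r ?add0r//.
by rewrite setIC -subset0 -Bc; apply: setIS; exact: child_body dF.
Qed.

(** A density gives a simple function, then an adapted one, close in mean to the vector measure and
    hence to the step functions of two consecutive levels. It is constant on the cells of the
    coarser level, whereas every step has size at least [eps0]. *)
Lemma no_bush eps0 : @RNP R X -> 0 < eps0 ->
  (forall n c d, c \in L n -> d \in F n c -> eps0 <= `|pt d - pt c|) -> False.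
Proof.
move=> rnp e0 steps.
have [mu muE] : exists mu : {finite_measure set T -> \bar R}, forall A, mu A = unit_measure A.
  by apply: unit_measure_sub_sigma => A [].
have [g [s [s_meas _ s_cauchy s_lim]]] : exists g, bochner_density mu g bush_measure.
  apply: rnp; [exact: bush_countably_additive|exact: bush_bounded_variation|].
  move=> A tA; rewrite muE => A0; apply/eqP; rewrite -normr_le0.
  by apply: le_trans (bush_le tA) _; rewrite /um A0 mulr0.
have sm n : simple_meas (s n).
  by move=> p ps; have := s_meas n; rewrite List.Forall_forall => /(_ p ps)[].
have siE n A : simple_int mu (s n) A = usum (s n) A.
  by rewrite /simple_int /usum; apply: eq_bigr => p _; rewrite muE.
(* Each of the two levels will be within [3 * e] of the adapted function in mean, so the conclusion
   reads [eps0 <= 6 * e]. *)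
pose e := eps0 / 12; have e1 : 0 < e by rewrite divr_gt0.
have [N NP] := s_cauchy e e1.
have close n : \sum_(c <- L n) `|bush_measure (body c) - usum (s N) (body c)| <= e.
  have cv : \sum_(c <- L n) `|usum (s k) (body c) - usum (s N) (body c)| @[k --> \oo] -->
      \sum_(c <- L n) `|bush_measure (body c) - usum (s N) (body c)|.
    apply: (@cvg_sum_seq R R^o _ (L n) (fun c k => `|usum (s k) (body c) - usum (s N) (body c)|)).
    move=> c cL; apply: cvg_norm; apply: cvgB; last exact: cvg_cst.
    under eq_fun do rewrite -siE.
    exact: s_lim (sigma_adapted_body cL).
  apply: le_trans (ler_norm _) _.
  apply: (@cvg_norm_le R R^o _ _ e N cv) => k Nk; rewrite ger0_norm ?sumr_ge0//.
  pose q := s k ++ simple_opp (s N).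
  have mq : simple_meas q.
    by apply: simple_meas_cat => //; apply: simple_meas_opp.
  have mphi := measurable_simple_norm 0 mq.
  have phi0 t : (0 <= (`|0 + simple_fn q t|)%:E)%E by rewrite lee_fin.
  have [tI intE] := integral_tiling mu mphi phi0 (Lp n)
    (fun c cL => sigma_adapted_body cL).
  rewrite -lee_fin -sumEFin.
  apply: (@le_trans _ _ (\sum_(c <- L n) \int[mu]_(t in (body c : set T))
      (`|0 + simple_fn q t|)%:E)%E).
    rewrite big_seq [leRHS]big_seq; apply: lee_sum => c cL.
    have := norm_simple_int_le mu 0 mq (sigma_adapted_body cL).
    by rewrite scaler0 add0r simple_int_cat simple_int_opp !siE.
  rewrite intE; apply: le_trans (NP k N Nk (leqnn _)).
  under [in leRHS]eq_integral do rewrite -[X in `|X|]add0r -simple_fn_opp -simple_fn_cat.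
  exact: ge0_subset_integral.
have [|q' [m [aq' q'e]]] := @usum_adapted (s N) e _ e1.
  by move=> p ps; exact: sm ps.
have [N2 N2P] := bush_tail e1.
pose n := maxn m N2.
have mn : (m <= n)%N by exact: leq_maxl.
have near k : \sum_(c <- L k) `|bush_measure (body c) - usum q' (body c)| <= 2 * e.
  have := close k; have := q'e k => h1 h2.
  apply: (@le_trans _ _ (\sum_(c <- L k) (`|bush_measure (body c) - usum (s N) (body c)| +
     `|usum (s N) (body c) - usum q' (body c)|))); last by rewrite big_split/=; lra.
  apply: ler_sum => c _; apply: le_trans (ler_normD _ _).
  by rewrite addrA subrK.
have tot : \sum_(c <- L n) \sum_(d <- F n c) wd d * eps0 = eps0.
  rewrite -(big_flatten_map (L n) (F n) (fun d => wd d * eps0)) -LS -mulr_suml.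
  by rewrite (sum_wd (Lp n.+1)) subr0 mul1r.
have bound : \sum_(c <- L n) \sum_(d <- F n c) wd d * eps0 <=
   \sum_(d <- L n.+1) `|bush_measure (body d) - wd d *: pt d| +
   \sum_(d <- L n.+1) `|bush_measure (body d) - usum q' (body d)| +
   (\sum_(c <- L n) `|bush_measure (body c) - usum q' (body c)| +
    \sum_(c <- L n) `|bush_measure (body c) - wd c *: pt c|).
  rewrite LS !big_flatten_map -!big_split/= big_seq [leRHS]big_seq.
  apply: ler_sum => c cL; have [v [vc vd]] := usum_child aq' mn cL.
  rewrite -big_split/=.
  have wc0 : 0 <= wd c := wd_ge0 (Lp n) cL.
  apply: (@le_trans _ _ (\sum_(d <- F n c) (`|bush_measure (body d) - wd d *: pt d| +
     `|bush_measure (body d) - usum q' (body d)|) + \sum_(d <- F n c) wd d * `|v - pt c|)).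
    rewrite -big_split/= big_seq [leRHS]big_seq; apply: ler_sum => d dF.
    have wd0 : 0 <= wd d := wd_ge0 (FP cL) dF.
    apply: (@le_trans _ _ (wd d * `|pt d - pt c|)).
      by rewrite ler_wpM2l//; exact: steps dF.
    have nZ (x : X) : wd d * `|x| = `|wd d *: x| by rewrite normrZ ger0_norm.
    rewrite vd// !nZ.
    have -> : wd d *: (pt d - pt c) = (bush_measure (body d) - wd d *: v) -
       (bush_measure (body d) - wd d *: pt d) + wd d *: (v - pt c).
      by apply: pair_ext => u; rewrite !pairE; ring.
    apply: le_trans (ler_normD _ _) _; rewrite lerD2r [leRHS]addrC.
    exact: ler_normB.
  rewrite lerD2l -mulr_suml (sum_wd (FP cL)).
  have nZ (x : X) : wd c * `|x| = `|wd c *: x| by rewrite normrZ ger0_norm.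
  rewrite -/(wd c) nZ vc.
  have -> : wd c *: (v - pt c) = (bush_measure (body c) - wd c *: pt c) -
       (bush_measure (body c) - wd c *: v).
    by apply: pair_ext => u; rewrite !pairE; ring.
  by rewrite [leRHS]addrC; exact: ler_normB.
have h1 := N2P n.+1 (leq_trans (leq_maxr _ _) (leqnSn _)).
have h2 := N2P n (leq_maxr _ _).
have h3 := near n; have h4 := near n.+1.
move: bound; rewrite tot.
have : e = eps0 / 12 by [].
lra.
Qed.

End Bush.

(** * Small slices and strongly exposed points *)

Section Epigraphs.
Context {R : realType} {X : normedModType R}.
Implicit Types (ep : X -> R -> Prop) (u : @dual R X).

Definition epi_convex ep := forall t x1 s1 x2 s2, 0 < t < 1 ->
  ep x1 s1 -> ep x2 s2 -> ep (t *: x1 + (1 - t) *: x2) (t * s1 + (1 - t) * s2).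

(* Epigraphs are relations [ep x s], standing for [f x <= s]; the closure is taken in
   [X * R] with the domination of [s] built in. *)
Definition epi_closed ep := forall x s,
  (forall e, 0 < e -> exists y s', [/\ `|x - y| < e, s' <= s + e & ep y s']) -> ep x s.

(* The conjugate is at most [N] on the ball of radius [r] around [u]. *)
Definition coercive ep u r N := forall x s, ep x s -> pair x u + r * `|x| - N <= s.

(** The projection to [X] of the slice of depth [eps] that [u] cuts off from the epigraph. *)
Definition almost_min ep u eps x := exists2 s, ep x s &
  forall x' s', ep x' s' -> s - pair x u <= s' - pair x' u + eps.

Definition dual0 : @dual R X := dcomb 0 (projT1 (cid (norming_dual 0))) 0
  (projT1 (cid (norming_dual 0))).

Lemma pair_dual0 x : pair x dual0 = 0.
Proof. by rewrite pair_dcomb; ring. Qed.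

Inductive hull ep (dl Rb e0 : R) (c : X) : X -> R -> Prop :=
| hull_base z s d : ep z s -> e0 <= `|z - c| -> `|z| <= Rb ->
    hull ep dl Rb e0 c (z + d) (s + dl * `|d|)
| hull_conv t x1 s1 x2 s2 : 0 < t < 1 -> hull ep dl Rb e0 c x1 s1 ->
    hull ep dl Rb e0 c x2 s2 ->
    hull ep dl Rb e0 c (t *: x1 + (1 - t) *: x2) (t * s1 + (1 - t) * s2).

(** Convex weights become lengths of subintervals. The displacements [d] turn into the mean error
    [e], and their penalties [dl * |d|] are recorded as a loss of height that pays for it. *)
Lemma hull_tiling ep dl Rb e0 c x s (a b : R) : hull ep dl Rb e0 c x s -> a <= b ->
  exists (K : seq (@cell R X)) e, [/\ tiling a b K, 0 <= e,
    forall d, d \in K -> [/\ ep (pt d) (ht d), e0 <= `|pt d - c| & `|pt d| <= Rb],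
    `|(b - a) *: x - \sum_(d <- K) wd d *: pt d| <= (b - a) * e &
    \sum_(d <- K) wd d * ht d + dl * ((b - a) * e) <= (b - a) * s].
Proof.
move=> h; elim: h a b => {x s} [z s d ez zc zR|t x1 s1 x2 s2 /andP[t0 t1] _ ih1 _ ih2] a b ab.
  exists [:: (a, b, z, s)], `|d|; split=> //.
  - exact: (@tiling1 _ _ (a, b, z, s)).
  - by move=> c'; rewrite inE => /eqP ->.
  - rewrite big_seq1 /wd /hi /lo /pt /= scalerDr addrAC subrr add0r normrZ.
    by rewrite ger0_norm ?subr_ge0.
  - by rewrite big_seq1 /wd /hi /lo /ht /=; lra.
pose m := a + t * (b - a).
have am : a <= m by rewrite /m lerDl mulr_ge0 ?subr_ge0 // ltW.
have mb : m <= b.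
  have : 0 <= (1 - t) * (b - a) by rewrite mulr_ge0 ?subr_ge0 // ltW.
  by rewrite /m; lra.
have [K1 [e1 [p1 e10 h1 n1 q1]]] := ih1 a m am.
have [K2 [e2 [p2 e20 h2 n2 q2]]] := ih2 m b mb.
have mE : m - a = t * (b - a) by rewrite /m; ring.
have bE : b - m = (1 - t) * (b - a) by rewrite /m; ring.
rewrite mE in n1 q1; rewrite bE in n2 q2.
exists (K1 ++ K2), (t * e1 + (1 - t) * e2); split.
- exact: tiling_cat p1 p2.
- by rewrite addr_ge0// mulr_ge0 //; lra.
- by move=> d; rewrite mem_cat => /orP[/h1|/h2].
- rewrite big_cat/=; set S1 := \sum_(d <- K1) _ in n1 *; set S2 := \sum_(d <- K2) _ in n2 *.
  have -> : (b - a) *: (t *: x1 + (1 - t) *: x2) - (S1 + S2) =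
     ((t * (b - a)) *: x1 - S1) + (((1 - t) * (b - a)) *: x2 - S2).
    by apply: pair_ext => u; rewrite !pairE; ring.
  by apply: le_trans (ler_normD _ _) _; lra.
- by rewrite big_cat/=; lra.
Qed.

End Epigraphs.

Section SmallSlice.
Context {R : realType} {X : completeNormedModType R}.
Implicit Types (ep : X -> R -> Prop) (u : @dual R X).

(* If no tilt of size [dl] produces a slice of diameter [e0], then the convex
   hull of the points far from any [c], enlarged by the penalty [dl |.|], still
   lies below [ep]; iterating this decomposition builds a bush. *)
Lemma hull_below ep (dl Rb e0 : R) c x s eta : 0 < dl ->
  (forall u, (forall x, `|pair x u| <= dl * `|x|) -> forall eps, 0 < eps <= 1 ->
     exists z, [/\ almost_min ep u eps z, e0 <= `|z - c| & `|z| <= Rb]) ->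
  ep x s -> 0 < eta <= 1 -> exists2 s', s' <= s + eta & hull ep dl Rb e0 c x s'.
Proof.
move=> dl0 far xs /andP[eta0 eta1]; apply: contrapT => no.
have [|zc [[sc zsc _] zcc zcR]] := far (@dual0 R X) _ 1 (introT andP (conj ltr01 (lexx 1))).
  by move=> x'; rewrite pair_dual0 normr0 mulr_ge0// ltW.
pose A d t := exists2 t', t' <= s + eta + t & hull ep dl Rb e0 c (x + d) t'.
have baseA z sz : ep z sz -> e0 <= `|z - c| -> `|z| <= Rb ->
    forall d, A d (sz + dl * `|x + d - z| - s - eta).
  move=> zsz zc' zR d; exists (sz + dl * `|x + d - z|); first by lra.
  by rewrite -{1}(subrK z (x + d)) [_ + z]addrC; exact: hull_base.
have [||||u uA] := @hahn_banach_epi R X A 1 (sc + dl * (`|x - zc| + 1) - s - eta).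
- move=> t x1 s1 x2 s2 t01 [t1 h1 H1] [t2 h2 H2].
  exists (t * t1 + (1 - t) * t2).
    by move: t01 => /andP[? ?]; nra.
  have -> : x + (t *: x1 + (1 - t) *: x2) = t *: (x + x1) + (1 - t) *: (x + x2).
    by apply: pair_ext => u; rewrite !pairE; ring.
  exact: hull_conv.
- move=> t [t' t't]; rewrite addr0 => ht; rewrite leNgt; apply/negP => t0.
  by apply: no; exists t' => //; lra.
- exact: ltr01.
- move=> d d1; have [t' ht' H'] := baseA _ _ zsc zcc zcR d; exists t' => //.
  have : `|x + d - zc| <= `|x - zc| + 1.
    by rewrite addrAC; apply: le_trans (ler_normD _ _) _; rewrite lerD2l.
  by move=> /(ler_wpM2l (ltW dl0)); lra.
have ule d : pair d u <= dl * `|d|.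
  apply: (@ler_scaled R _ _ (sc + dl * `|x - zc| - s - eta)) => n.
  have := uA _ _ (baseA _ _ zsc zcc zcR (n.+1%:R *: d)).
  rewrite pairZ => h; apply: (le_trans h).
  have : `|x + n.+1%:R *: d - zc| <= `|x - zc| + n.+1%:R * `|d|.
    by rewrite addrAC; apply: le_trans (ler_normD _ _) _; rewrite normrZ ger0_norm.
  by move=> /(ler_wpM2l (ltW dl0)); lra.
have ule' d : `|pair d u| <= dl * `|d|.
  by rewrite ler_norml ule andbT; have := ule (- d); rewrite pairN normrN; lra.
(* The tilt [u] places all far points at least [eta] above [(x, s)], whereas its slice of depth
   [eta / 2] contains a far point. *)
have eta2 : 0 < eta / 2 <= 1 by apply/andP; split; lra.
have [z [[sz zsz zmin] zc' zR]] := far u ule' _ eta2.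
have := uA _ _ (baseA _ _ zsz zc' zR (z - x)).
have := zmin _ _ xs.
rewrite [x + _]addrC subrK subrr normr0 pairB; lra.
Qed.

(** Otherwise [hull_below] replaces any point of the epigraph by far points of almost the same mean
    height, level after level. The heights are bounded below, which makes the conditional-mean
    errors summable, and the resulting bush contradicts [no_bush]. *)
Lemma small_slice ep (r N dl e0 : R) : @RNP R X ->
  (exists x s, ep x s) -> (forall x s, ep x s -> r * `|x| - N <= s) ->
  0 < dl -> dl <= r / 2 -> 0 < e0 ->
  exists u, (forall x, `|pair x u| <= dl * `|x|) /\
    exists eps c, 0 < eps /\ forall x, almost_min ep u eps x -> `|x - c| <= e0.
Proof.
move=> rnp [z0 [s0 zs0]] cep dl0 dlr e00; apply: contrapT => no.
have r0 : 0 < r by lra.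
(* By coercivity, [Rb] bounds every slice of depth at most [1] cut off by a tilt of size at most
   [dl], as seen by comparison with [(z0, s0)]. *)
pose Rb := (N + s0 + dl * `|z0| + 1) / (r - dl).
have rd : 0 < r - dl by lra.
have nz0 : 0 <= dl * `|z0| by rewrite mulr_ge0// ltW.
have z0R : `|z0| <= Rb.
  by rewrite ler_pdivlMr//; have := cep _ _ zs0; lra.
have far c u : (forall x, `|pair x u| <= dl * `|x|) -> forall eps, 0 < eps <= 1 ->
    exists z, [/\ almost_min ep u eps z, e0 <= `|z - c| & `|z| <= Rb].
  move=> udl eps /andP[eps0 eps1]; apply: contrapT => noz; apply: no.
  exists u; split=> //; exists eps, c; split=> // x xmin.
  rewrite leNgt; apply/negP => xc; apply: noz; exists x; split=> //; first exact: ltW.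
  have [s xs smin] := xmin.
  rewrite ler_pdivlMr//; have := cep _ _ xs; have := smin _ _ zs0.
  have := udl z0; have := udl x; rewrite !ler_norml => /andP[_ ?] /andP[? _]; lra.
pose P (nc : nat * @cell R X) (Ke : seq (@cell R X) * R) :=
  lo nc.2 <= hi nc.2 -> ep (pt nc.2) (ht nc.2) ->
  [/\ tiling (lo nc.2) (hi nc.2) Ke.1, 0 <= Ke.2,
    forall d, d \in Ke.1 -> [/\ ep (pt d) (ht d), e0 <= `|pt d - pt nc.2| & `|pt d| <= Rb],
    `|wd nc.2 *: pt nc.2 - \sum_(d <- Ke.1) wd d *: pt d| <= wd nc.2 * Ke.2 &
    \sum_(d <- Ke.1) wd d * ht d + dl * (wd nc.2 * Ke.2) <=
      wd nc.2 * (ht nc.2 + 2^-1 ^+ nc.1)].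
have [f fP] : {f & forall nc, P nc (f nc)}.
  apply: choice => -[n c].
  have [[lohi epc]|nc] := pselect (lo c <= hi c /\ ep (pt c) (ht c)); last first.
    by exists ([::], 0) => h1 h2; exfalso; apply: nc.
  have eta01 : 0 < (2^-1 : R) ^+ n <= 1.
    by rewrite exprn_gt0 ?invr_gt0//= exprn_ile1 ?invr_ge0// invf_le1 ?ler1n.
  have [s' s'le H] := hull_below dl0 (far (pt c)) epc eta01.
  have [K [e [tK e0' hK nK qK]]] := hull_tiling H lohi.
  exists (K, e) => _ _; split=> //; apply: (le_trans qK).
  by rewrite ler_wpM2l// subr_ge0.
pose F n c := (f (n, c)).1; pose ed n c := (f (n, c)).2.
pose L := fix L n := if n is n'.+1 then flatten [seq F n' c | c <- L n']
   else [:: (0, 1, z0, s0) : @cell R X].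
have LS n : L n.+1 = flatten [seq F n c | c <- L n] by [].
have valid n c : c \in L n -> [/\ lo c <= hi c, ep (pt c) (ht c) & `|pt c| <= Rb].
  elim: n c => [|n ih] c; first by rewrite inE => /eqP -> ; split=> //; exact: ler01.
  rewrite LS => /flattenP[_ /mapP[c' c'L ->] cF].
  have [lohi epc _] := ih _ c'L; have [tF _ hF _ _] := fP (n, c') lohi epc.
  have [h1 _ h2] := hF _ cF; split=> //.
  by have [_ + _] := (tiling_sub tF).2 _ cF.
have FP n c : c \in L n -> tiling (lo c) (hi c) (F n c).
  by move=> /valid[h1 h2 _]; have [] := fP (n, c) h1 h2.
have L0 : tiling 0 1 (L 0%N) by exact: (@tiling1 _ _ (0, 1, z0, s0) ler01).
have Lp := bush_tiling L0 LS FP.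
(* The mean height is a potential: from level [n] to the next it drops by [dl] times the error, up
   to [2^-n], and it never falls below [- N]; hence the bound [(pot 0 + N + 2) / dl] on the total
   error. *)
pose pot n := \sum_(c <- L n) wd c * ht c.
have potN n : - N <= pot n.
  rewrite /pot -[- N]mul1r -[X in X * _]subr0 -(sum_wd (Lp n)) mulr_suml.
  rewrite big_seq [leRHS]big_seq; apply: ler_sum => c cL.
  have [lohi epc _] := valid _ _ cL.
  rewrite ler_wpM2l ?subr_ge0//; have := cep _ _ epc.
  have : 0 <= r * `|pt c| by rewrite mulr_ge0// ltW.
  lra.
have potS n : pot n.+1 + dl * (\sum_(c <- L n) wd c * ed n c) <= pot n + 2^-1 ^+ n.
  rewrite /pot LS big_flatten_map mulr_sumr -big_split/=.
  have -> : (2^-1 : R) ^+ n = \sum_(c <- L n) wd c * 2^-1 ^+ n.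
    by rewrite -mulr_suml (sum_wd (Lp n)) subr0 mul1r.
  rewrite -big_split/= big_seq [leRHS]big_seq; apply: ler_sum => c cL.
  have [h1 h2 _] := valid _ _ cL; have [_ _ _ _ h] := fP (n, c) h1 h2.
  by rewrite -mulrDr.
have edM n : \sum_(k < n) \sum_(c <- L k) wd c * ed k c <= (pot 0%N + N + 2) / dl.
  rewrite ler_pdivlMr// mulrC.
  suff : pot n + dl * \sum_(k < n) \sum_(c <- L k) wd c * ed k c <=
      pot 0%N + 2 - 2 * 2^-1 ^+ n.
    have p2 : 0 <= (2^-1 : R) ^+ n by rewrite exprn_ge0// invr_ge0.
    by have := potN n; lra.
  elim: n => [|n ih]; first by rewrite big_ord0 expr0; lra.
  rewrite big_ord_recr/= exprS mulrDr; have := potS n; move: ih.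
  set S := \sum_(k < n) _; lra.
apply: (no_bush (Rb := Rb) L0 LS FP _ _ _ edM rnp e00).
- by move=> n c /valid[].
- by move=> n c /valid[h1 h2 _]; have [] := fP (n, c) h1 h2.
- by move=> n c /valid[h1 h2 _]; have [] := fP (n, c) h1 h2.
- by move=> n c d /valid[h1 h2 _]; have [_ _ h _ _] := fP (n, c) h1 h2 => /h[].
Qed.

End SmallSlice.

Section StronglyExposed.
Context {R : realType} {X : completeNormedModType R}.
Implicit Types (ep : X -> R -> Prop) (u v w : @dual R X).

Lemma coercive_dle ep u w r N d : coercive ep u r N -> dle w u d ->
  coercive ep w (r - d) N.
Proof.
move=> cu wu x s xs; have := cu _ _ xs; have := wu x.
by rewrite ler_norml => /andP[_]; lra.
Qed.

Lemma dle_trans u v w d1 d2 : dle u v d1 -> dle v w d2 -> dle u w (d1 + d2).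
Proof.
move=> uv vw x; rewrite mulrDl.
by have := ler_distD (pair x v) (pair x u) (pair x w); have := uv x; have := vw x; lra.
Qed.

Lemma dle_le u v d1 d2 : d1 <= d2 -> dle u v d1 -> dle u v d2.
Proof. by move=> d12 uv x; apply: le_trans (uv x) _; rewrite ler_wpM2r. Qed.

Lemma tilted_inf ep u r N : (exists x s, ep x s) -> coercive ep u r N -> 0 < r ->
  exists m, (forall x s, ep x s -> m <= s - pair x u) /\
    forall e, 0 < e -> exists x s, ep x s /\ s - pair x u < m + e.
Proof.
move=> [z0 [s0 zs0]] cu r0.
pose V := [set y | exists x s, ep x s /\ y = s - pair x u].
have hV : has_inf V.
  split; first by exists (s0 - pair z0 u), z0, s0.
  exists (- N) => _ [x [s [xs ->]]]; have := cu _ _ xs.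
  have : 0 <= r * `|x| by rewrite mulr_ge0// ltW.
  lra.
exists (inf V); split=> [x s xs|e e0].
  by apply: ge_inf; [exact: hV.2|exists x, s].
by have [_ [x [s [xs ->]]] ?] := inf_adherent e0 hV; exists x, s.
Qed.

(** Coercivity confines the slices to a ball of radius [Rx], on which a change of tilt by [d] moves
    values by at most [eps / 4]; comparing two points costs [eps / 2]. Outside the ball, values are
    no lower than at [z0]. *)
Lemma slice_stable ep u r N eps : (exists x s, ep x s) -> coercive ep u r N ->
  0 < r -> 0 < eps -> exists2 d, 0 < d & forall w, dle w u d ->
    forall x, almost_min ep w (eps / 2) x -> almost_min ep u eps x.
Proof.
move=> [z0 [s0 zs0]] cu r0 eps0.
have r2 : 0 < r / 2 by rewrite divr_gt0.
pose Rx := (`|N| + `|s0 - pair z0 u| + r * `|z0| + eps) / (r / 2) + `|z0|.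
have nz : 0 <= r * `|z0| by rewrite mulr_ge0// ltW.
have nN := ler_norm N; have nS := ler_norm (s0 - pair z0 u).
have N0 := normr_ge0 N; have S0 := normr_ge0 (s0 - pair z0 u).
have z0R : `|z0| <= Rx by rewrite /Rx lerDr divr_ge0 ?(ltW r2)//; lra.
have Rx0 : 0 <= Rx := le_trans (normr_ge0 _) z0R.
have boundR x : (r / 2) * `|x| <= `|N| + `|s0 - pair z0 u| + r * `|z0| + eps -> `|x| <= Rx.
  move=> h; apply: (@le_trans _ _ ((`|N| + `|s0 - pair z0 u| + r * `|z0| + eps) / (r / 2))).
    by rewrite ler_pdivlMr// mulrC.
  by rewrite /Rx lerDl.
have R1 : 0 < 4 * (Rx + 1) by lra.
pose d := Num.min (r / 2) (eps / (4 * (Rx + 1))).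
have d0 : 0 < d by rewrite lt_min r2/= divr_gt0.
have dr : d <= r / 2 by rewrite ge_min lexx.
have dRx : d * (4 * (Rx + 1)) <= eps by rewrite -ler_pdivlMr// ge_min lexx orbT.
exists d => // w wu x [s xs xmin].
have cw : coercive ep w (r / 2) N.
  by move=> y t yt; have := coercive_dle cu wu yt; have := ler_wpM2r (normr_ge0 y) dr; lra.
have wu_small y : `|y| <= Rx -> `|pair y w - pair y u| <= eps / 4.
  move=> yR; apply: le_trans (wu y) _; apply: (@le_trans _ _ (d * Rx)).
    by rewrite ler_wpM2l// ltW.
  by rewrite ler_pdivlMr//; have := ltW d0; lra.
have zwu := wu_small _ z0R.
have xR : `|x| <= Rx.
  apply: boundR; have := cw _ _ xs; have := xmin _ _ zs0.
  by move: zwu; rewrite ler_norml => /andP[? ?]; lra.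
have main x' s' : ep x' s' -> `|x'| <= Rx -> s - pair x u <= s' - pair x' u + eps.
  move=> xs' x'R; have := xmin _ _ xs'; have := wu_small _ xR; have := wu_small _ x'R.
  by rewrite !ler_norml => /andP[? ?] /andP[? ?]; lra.
exists s => // x' s' xs'; have [x'R|Rx'] := leP `|x'| Rx; first exact: main.
have := main _ _ zs0 z0R.
suff : s0 - pair z0 u <= s' - pair x' u by lra.
rewrite leNgt; apply/negP => lt; have := cu _ _ xs' => h.
have : `|x'| <= Rx by apply: boundR; have := normr_ge0 x'; nra.
by rewrite leNgt Rx'.
Qed.

(** Functionals with a slice of radius [1 / (n + 1)] contain a ball in every ball near [u0], by
    [small_slice] for the tilted epigraph and [slice_stable]. By Baire some [w] has such slices for
    all [n]; they form a Cauchy filter, and its limit is the exposed point. *)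
Theorem strongly_exposed ep u0 r N dl : @RNP R X ->
  (exists x s, ep x s) -> epi_closed ep -> coercive ep u0 r N -> 0 < r -> 0 < dl ->
  exists u, dle u u0 dl /\ exists a s, [/\ ep a s,
    forall x s', ep x s' -> s + pair (x - a) u <= s' &
    forall e, 0 < e -> exists2 eps, 0 < eps & forall x s', ep x s' ->
      s' <= s + pair (x - a) u + eps -> `|x - a| <= e].
Proof.
move=> rnp ne clo cu0 r0 dl0.
pose small n u := exists eps c, 0 < eps /\
  forall x, almost_min ep u eps x -> `|x - c| <= n.+1%:R^-1.
(* Far from [u0] coercivity may fail, so membership is made vacuous there. *)
pose O n : set (@dual R X) := [set u | dle u u0 (r / 2) -> small n u].
have m0 : 0 < Num.min dl (r / 2) by rewrite lt_min dl0 divr_gt0.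
have [|w [wu0 wO]] := @dual_baire R X O _ u0 _ m0.
- move=> n u rho rho0; have rho2 : 0 < rho / 2 by rewrite divr_gt0.
  have [[w0 [w0u w0u0]]|none] := pselect (exists w0, dle w0 u (rho / 2) /\ dle w0 u0 (r / 2));
    last first.
    exists u, (rho / 2); split=> // w wu; split; first by apply: dle_le wu; lra.
    by move=> wu0; exfalso; apply: none; exists w.
  have cw0 : coercive ep w0 (r / 2) N.
    by move=> x s xs; have := coercive_dle cu0 w0u0 xs; lra.
  pose d := Num.min (rho / 4) (r / 4).
  have d0 : 0 < d by rewrite lt_min !divr_gt0.
  have drho : d <= rho / 4 by rewrite ge_min lexx.
  have dr : d <= r / 4 by rewrite ge_min lexx orbT.
  pose ep' x s := ep x (s + pair x w0).
  have [||||v [vd [eps [c [eps0 vP]]]]] :=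
    @small_slice R X ep' (r / 2) N d n.+1%:R^-1 rnp _ _ d0 _ _.
  + by have [x [s xs]] := ne; exists x, (s - pair x w0); rewrite /ep' subrK.
  + by move=> x s /cw0; lra.
  + by lra.
  + by rewrite invr_gt0 ltr0n.
  pose u1 := dcomb 1 w0 1 v.
  have u1E x : pair x u1 = pair x w0 + pair x v by rewrite pair_dcomb !mul1r.
  have u1w0 : dle u1 w0 d.
    by move=> x; rewrite u1E addrAC subrr add0r.
  have cu1 : coercive ep u1 (r / 4) N.
    move=> x s xs; have := coercive_dle cw0 u1w0 xs.
    by have := ler_wpM2r (normr_ge0 x) dr; lra.
  have r4 : 0 < r / 4 by rewrite divr_gt0.
  have [d' d'0 d'P] := slice_stable ne cu1 r4 eps0.
  exists u1, (Num.min d' (rho / 4)); split; first by rewrite lt_min d'0 divr_gt0.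
  move=> w wu1; split.
    apply: (@dle_le _ _ (rho / 4 + (rho / 4 + rho / 2))); first by lra.
    apply: (@dle_trans _ u1); first by apply: dle_le wu1; rewrite ge_min lexx orbT.
    by apply: (@dle_trans _ w0) => //; exact: dle_le u1w0.
  move=> _; exists (eps / 2), c; split; first by rewrite divr_gt0.
  move=> x xmin; apply: vP.
  have [|s xs smin] := d'P w _ x xmin.
    by apply: dle_le wu1; rewrite ge_min lexx.
  exists (s - pair x w0); first by rewrite /ep' subrK.
  move=> x' s' xs'; have := smin _ _ xs'; rewrite !u1E; lra.
have wr : dle w u0 (r / 2) by apply: dle_le wu0; rewrite ge_min lexx orbT.
have cw : coercive ep w (r / 2) N.
  by move=> x s xs; have := coercive_dle cu0 wr xs; lra.
have r2 : 0 < r / 2 by rewrite divr_gt0.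
exists w; split; first by apply: dle_le wu0; rewrite ge_min lexx.
have [m [mlb minf]] := tilted_inf ne cw r2.
have amin x s e : ep x s -> s - pair x w <= m + e -> almost_min ep w e x.
  by move=> xs h; exists s => // x' s' /mlb; lra.
pose Fl := filter_from [set e : R | 0 < e] (fun e => [set x | almost_min ep w e x]).
have FF : ProperFilter Fl.
  apply: filter_from_proper.
    apply: filter_from_filter; first by exists 1 => /=; exact: ltr01.
    move=> e1 e2 /= e10 e20; exists (Num.min e1 e2) => /=; first by rewrite lt_min e10.
    move=> x [s xs xmin]; split; exists s => // x' s' /xmin h; apply: (le_trans h);
      by rewrite lerD2l ge_min lexx ?orbT.
  move=> e /= e0; have [x [s [xs h]]] := minf e e0.
  by exists x; apply: amin xs _; exact: ltW.
have : cvg Fl.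
  apply: cauchy_cvg; apply: cauchy_exP => e e0.
  have [n] := archi_lt e^-1 => ne1.
  have [eps [c [eps0 cP]]] := wO n wr.
  exists c, eps => // x /cP xc; rewrite -ball_normE /= distrC.
  apply: le_lt_trans xc _.
  by rewrite -[ltRHS]invrK ltf_pV2// posrE ?invr_gt0 ?ltr0n.
move=> /cvg_ex[a aP].
have near_a e : 0 < e -> exists2 eps, 0 < eps &
    forall x, almost_min ep w eps x -> `|a - x| < e.
  move=> e0; have [eps /= eps0 h] := aP _ (nbhsx_ballx a e e0).
  by exists eps => // x /h; rewrite -ball_normE.
exists a, (m + pair a w); split.
- apply: clo => e e0; have [M M0 MP] := pair_bounded w.
  have e2 : 0 < e / 2 by rewrite divr_gt0.
  have eM : 0 < Num.min e (e / 2 / M) by rewrite lt_min e0/= divr_gt0.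
  have [eps eps0 h] := near_a _ eM.
  have ee : 0 < Num.min eps (e / 2) by rewrite lt_min eps0.
  have [x [s [xs hx]]] := minf _ ee.
  have ax := h x (amin _ _ _ xs _).
  have {}ax : `|a - x| < Num.min e (e / 2 / M).
    by apply: ax; apply: ltW; apply: lt_le_trans hx _; rewrite lerD2l ge_min lexx.
  exists x, s; split=> //; first by apply: lt_le_trans ax _; rewrite ge_min lexx.
  have : M * `|a - x| <= e / 2.
    rewrite mulrC -ler_pdivlMr//; apply: ltW; apply: lt_le_trans ax _.
    by rewrite ge_min lexx orbT.
  have := MP (a - x); rewrite pairB ler_norml => /andP[h1 h2] h3.
  have : Num.min eps (e / 2) <= e / 2 by rewrite ge_min lexx orbT.
  lra.
- by move=> x s' /mlb; rewrite pairB; lra.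
- move=> e e0; have [eps eps0 h] := near_a _ e0; exists eps => // x s' xs' hs.
  apply: ltW; rewrite distrC; apply: h; apply: amin xs' _.
  by move: hs; rewrite pairB; lra.
Qed.

End StronglyExposed.

(** * Convex functions, subgradients and conjugates *)

Section ConvexFunction.
Context {R : realType} {X : completeNormedModType R} (f : X -> \bar R).
Context (fN : forall x, f x != -oo%E) (fconv : convex_fun f)
  (flsc : lower_semicontinuous f).
Implicit Types (x y z d : X) (u v w : @dual R X).

(** Meaningful on [dom f] only; [fine] sends [+oo] to [0]. *)
Definition fval x : R := fine (f x).

Definition epi x s := (f x <= s%:E)%E.

Lemma dom_val x : dom f x -> f x = (fval x)%:E.
Proof.
by rewrite /dom/= => fx; rewrite /fval fineK// fin_numE fN lt_eqF.
Qed.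

Lemma dom_of_le x s : epi x s -> dom f x /\ fval x <= s.
Proof.
move=> fx; have dx : dom f x by rewrite /dom/= (le_lt_trans fx)// ltry.
by split=> //; move: fx; rewrite /epi dom_val.
Qed.

Lemma epi_val x s : dom f x -> fval x <= s -> epi x s.
Proof. by move=> dx fs; rewrite /epi dom_val. Qed.

Lemma dom_convex t x y : 0 < t < 1 -> dom f x -> dom f y ->
  dom f (t *: x + (1 - t) *: y) /\
  fval (t *: x + (1 - t) *: y) <= t * fval x + (1 - t) * fval y.
Proof.
move=> /andP[t0 t1] dx dy; apply: dom_of_le.
have t01 : 0 <= t <= 1 by rewrite !ltW.
by have := fconv x y t01; rewrite (dom_val dx) (dom_val dy).
Qed.

Lemma epi_convexP : epi_convex epi.
Proof.
move=> t x1 s1 x2 s2 t01 /dom_of_le[d1 h1] /dom_of_le[d2 h2].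
have [d h] := dom_convex t01 d1 d2; apply: epi_val => //; apply: (le_trans h).
by move: t01 => /andP[? ?]; nra.
Qed.

Lemma epi_closedP : epi_closed epi.
Proof.
move=> x s h; rewrite /epi leNgt; apply/negP => sf.
have [a [sa af]] : exists a, s < a /\ (a%:E < f x)%E.
  move: sf; have := fN x; case: (f x) => [b| |] //= _.
    by rewrite lte_fin => sb; exists ((s + b) / 2); rewrite lte_fin; split; lra.
  by move=> _; exists (s + 1); split; [lra|exact: ltry].
have [V /nbhs_ballP[e /= e0 eV] VP] := flsc af.
have m0 : 0 < Num.min e (a - s) by rewrite lt_min e0 subr_gt0.
have [y [s' [xy s's fy]]] := h _ m0.
have := VP y; have : V y by apply: eV; rewrite -ball_normE /=; apply: lt_le_trans xy _; rewrite ge_min lexx.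
move=> Vy /(_ Vy); rewrite ltNge => /negP; apply; apply: (le_trans fy).
rewrite lee_fin; apply: (le_trans s's).
have : Num.min e (a - s) <= a - s by rewrite ge_min lexx orbT.
lra.
Qed.

Lemma val_lsc x s :
  (forall e, 0 < e -> exists y, [/\ `|x - y| < e, dom f y & fval y <= s + e]) ->
  dom f x /\ fval x <= s.
Proof.
move=> h; apply: dom_of_le; apply: epi_closedP => e e0.
have [y [xy dy hy]] := h e e0; exists y, (s + e); split=> //; exact: epi_val.
Qed.

Definition subg x u := dom f x /\ forall y, dom f y -> fval x + pair (y - x) u <= fval y.

Lemma subgP x u : subdiff f x u <-> subg x u.
Proof.
split=> [[fx h]|[dx h]].
  have dx : dom f x by rewrite /dom/= ltey_eq fx.
  split=> // y dy; have := h y; rewrite (dom_val dx) (dom_val dy).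
  by rewrite -EFinD lee_fin.
split=> [|y]; first by rewrite (dom_val dx).
have [dy|ndy] := pselect (dom f y).
  by rewrite (dom_val dx) (dom_val dy) -EFinD lee_fin; exact: h.
have -> : f y = +oo%E by apply/eqP; rewrite -leye_eq leNgt; apply/negP.
exact: leey.
Qed.

(** The inequality [f^* u <= N], in real numbers. *)
Definition cj u N := forall x, dom f x -> pair x u - fval x <= N.

Lemma subg_cj x u : subg x u -> cj u (pair x u - fval x).
Proof. by move=> [_ h] y dy; have := h y dy; rewrite pairB; lra. Qed.

Lemma fconj_leP u N : (fconj f u <= N%:E)%E <-> cj u N.
Proof.
split=> [h x dx|h].
  have : ((pair x u)%:E - f x <= N%:E)%E.
    by apply: le_trans h; apply: ereal_sup_ubound; exists x.
  by rewrite (dom_val dx) -EFinB lee_fin.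
apply: ge_ereal_sup => _ [x _ <-].
have [dx|ndx] := pselect (dom f x).
  by rewrite (dom_val dx) -EFinB lee_fin; exact: h.
have -> : f x = +oo%E by apply/eqP; rewrite -leye_eq leNgt; apply/negP.
by rewrite /= leNye.
Qed.

(* Boundedness above near [x] is automatic on the interior of the domain, by Baire
   ([bint_exists]). *)
Definition bint x := exists r M, 0 < r /\ forall d, `|d| <= r -> dom f (x + d) /\ fval (x + d) <= M.

Lemma bint_dom x : bint x -> dom f x.
Proof. by move=> [r [M [r0 /(_ 0)]]]; rewrite addr0 normr0 => /(_ (ltW r0))[]. Qed.

(** The open sets [{f > n}] cannot all be dense: by Baire, some point in the interior of the domain
    would have infinite value. On a ball that misses one of them, [f] is bounded. *)
Lemma bint_exists : interior (dom f) !=set0 -> exists x, bint x.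
Proof.
move=> [x0 ix0].
pose O (n : nat) := [set x | (n%:R%:E < f x)%E].
have oO n : open (O n) by apply: (lower_semicontinuousP f).1 flsc _.
have [dO|] := pselect (forall n, dense (O n)); last first.
  move=> /existsNP[n]; rewrite /dense => /existsNP[U /not_implyP[[x1 Ux1] /not_implyP[oU UO]]].
  move: oU; rewrite openE => /(_ _ Ux1)/nbhs_ballP[r /= r0 rU].
  exists x1, (r / 2), n%:R; split=> [|d dr]; first by rewrite divr_gt0.
  apply: dom_of_le; rewrite /epi leNgt; apply/negP => fd; apply: UO; exists (x1 + d); split=> //.
  by apply: rU; rewrite -ball_normE /= opprD addrA subrr add0r normrN; lra.
have := Baire (fun n => conj (oO n) (dO n)).
move=> /(_ (interior (dom f))) [||x [ix Ox]]; [by exists x0|exact: open_interior|].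
have dx : dom f x by exact: interior_subset ix.
have [n] := archi_lt (fval x); have := Ox n.+1 I; rewrite /O/= dom_val// lte_fin.
by move=> /lt_trans h /h; rewrite ltxx.
Qed.

Lemma bint_segment x y t : bint x -> dom f y -> 0 < t < 1 ->
  bint (t *: x + (1 - t) *: y).
Proof.
move=> [r [M [r0 h]]] dy t01; have /andP[t0 t1] := t01.
exists (t * r), (t * M + (1 - t) * fval y); split; first by rewrite mulr_gt0.
move=> d dr.
have -> : t *: x + (1 - t) *: y + d = t *: (x + t^-1 *: d) + (1 - t) *: y.
  by rewrite scalerDr scalerA divff ?gt_eqF// scale1r addrAC.
have [|dx hx] := h (t^-1 *: d).
  by rewrite normrZ ger0_norm ?invr_ge0 ?(ltW t0)// ler_pdivrMl.
have [dd hd] := dom_convex t01 dx dy; split=> //; apply: (le_trans hd).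
by rewrite lerD2r ler_wpM2l// ltW.
Qed.

Lemma bint_usc x e : bint x -> 0 < e ->
  exists2 r, 0 < r & forall d, `|d| <= r -> bint (x + d) /\ fval (x + d) <= fval x + e.
Proof.
move=> bx e0; have dx := bint_dom bx; have [r [M [r0 h]]] := bx.
have K0 : 0 < `|M - fval x| + 1 by rewrite ltr_wpDl.
(* [x + d] has weight [t] on [x + d / t], where [f <= M], and [1 - t] on [x]; the increase is at
   most [t * (M - f x)]. *)
pose t := Num.min (1 / 2) (e / (`|M - fval x| + 1)).
have t0 : 0 < t by rewrite lt_min !divr_gt0.
have t1 : t <= 1 / 2 by rewrite ge_min lexx.
have tK : t * (`|M - fval x| + 1) <= e by rewrite -ler_pdivlMr// ge_min lexx orbT.
have t01 : 0 < t < 1 by apply/andP; split; lra.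
exists (t * r / 2); first by rewrite divr_gt0// mulr_gt0.
move=> d dr.
have dr' : `|t^-1 *: d| <= r / 2.
  by rewrite normrZ ger0_norm ?invr_ge0 ?(ltW t0)// ler_pdivrMl// mulrA.
have xdE : x + d = t *: (x + t^-1 *: d) + (1 - t) *: x.
  rewrite scalerDr scalerA divff ?gt_eqF// scale1r addrAC -scalerDl.
  by rewrite [t + _]addrC subrK scale1r.
split.
  rewrite xdE; apply: bint_segment => //.
  exists (r / 2), M; split; first by rewrite divr_gt0.
  move=> d' d'r; rewrite -addrA; apply: h; apply: le_trans (ler_normD _ _) _; lra.
have [|dxd hxd] := h (t^-1 *: d); first by lra.
have [_] := dom_convex t01 dxd dx; rewrite -xdE => h1; apply: (le_trans h1).
have := ler_norm (M - fval x); nra.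
Qed.

Lemma subg_exists x : bint x -> exists u, subg x u.
Proof.
move=> bx; have dx := bint_dom bx; have [r [M [r0 h]]] := bx.
have [||||u uP] := @hahn_banach_epi R X (fun d s => epi (x + d) (fval x + s)) r (M - fval x).
- move=> t x1 s1 x2 s2 t01 h1 h2; have := epi_convexP t01 h1 h2.
  have -> : t *: (x + x1) + (1 - t) *: (x + x2) = x + (t *: x1 + (1 - t) *: x2).
    by apply: pair_ext => u; rewrite !pairE; ring.
  by have -> : t * (fval x + s1) + (1 - t) * (fval x + s2) = fval x + (t * s1 + (1 - t) * s2) by ring.
- by move=> s; rewrite addr0 => /dom_of_le[_]; lra.
- exact: r0.
- by move=> d /h[dd hd]; apply: epi_val => //; lra.
exists u; split=> // y dy; have := uP (y - x) (fval y - fval x).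
rewrite !subrKC => /(_ (epi_val dy (lexx _))); lra.
Qed.

(** The dual counterpart of [bint_exists]: by Baire, [f^*] is bounded on a ball around some [u].
    Adding to [u] a small multiple of a norming functional of [x] produces the term [r * |x|]. *)
Lemma coercive_exists : dual_int_nonempty (dom_dual (fconj f)) ->
  exists u r N, 0 < r /\ coercive epi u r N.
Proof.
move=> [p [e e0 pe]].
pose O (n : nat) : set (@dual R X) := [set u | ~ cj u n%:R].
have nd : ~ forall n u rho, 0 < rho -> exists u' rho', 0 < rho' /\
    forall w, dle w u' rho' -> dle w u rho /\ O n w.
  move=> /dual_baire/(_ p _ (divr_gt0 e0 (ltr0n _ 2)))[w [wp wO]].
  have : dom_dual (fconj f) w.
    apply: pe; apply: (@le_lt_trans _ _ (e / 2)%:E); last by rewrite lte_fin; lra.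
    by apply: dle_ddist => //; rewrite divr_ge0// ltW.
  rewrite /dom_dual/=; case E: (fconj f w) => [N| |] // _.
  - have [n nN] := archi_lt N; apply: (wO n.+1); apply/fconj_leP.
    by rewrite E lee_fin ltW.
  - by apply: (wO 0%N); apply/fconj_leP; rewrite E leNye.
move: nd => /existsNP[n /existsNP[u /existsNP[rho /not_implyP[rho0 nd]]]].
have rho2 : 0 < rho / 2 by rewrite divr_gt0.
have ball_cj u' : dle u' u (rho / 2) -> cj u' n%:R.
  move=> u'u x dx; rewrite leNgt; apply/negP => gap; apply: nd.
  have x1 : 0 < `|x| + 1 by rewrite ltr_wpDl.
  pose g := pair x u' - fval x - n%:R.
  have g0 : 0 < g by rewrite /g; lra.
  exists u', (Num.min (rho / 2) (g / 2 / (`|x| + 1))); split.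
    by rewrite lt_min rho2/= !divr_gt0.
  move=> w wu'; split.
    apply: (@dle_le _ _ _ _ (rho / 2 + rho / 2)); first by lra.
    by apply: dle_trans u'u; apply: dle_le wu'; rewrite ge_min lexx.
  move=> /(_ x dx); have := wu' x; rewrite ler_norml => /andP[h _].
  have : Num.min (rho / 2) (g / 2 / (`|x| + 1)) * `|x| <= g / 2.
    apply: (@le_trans _ _ (g / 2 / (`|x| + 1) * (`|x| + 1))).
      by rewrite ler_pM// ?ge_min ?lexx ?orbT ?lerDl// le_min ltW//= !divr_ge0// ltW.
    by rewrite divfK// gt_eqF.
  by rewrite /g in g0 *; lra.
exists u, (rho / 2), n%:R; split=> // x s /dom_of_le[dx hs].
have [b [b1 bx]] := norming_dual x.
have := ball_cj (dcomb 1 u (rho / 2) b) _ x dx.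
rewrite pair_dcomb mul1r bx => h; apply: le_trans hs.
suff : pair x u + rho / 2 * `|x| - fval x <= n%:R by lra.
apply: h => y; rewrite pair_dcomb mul1r addrAC subrr add0r normrM ger0_norm ?(ltW rho2)//.
rewrite ler_wpM2l ?(ltW rho2)// ler_norml b1 andbT.
by have := b1 (- y); rewrite pairN normrN; lra.
Qed.

End ConvexFunction.

(** * The representative [f + f^*] *)

Section Representatives.
Context {R : realType} {X : completeNormedModType R} (f : X -> \bar R).
Context (fN : forall x, f x != -oo%E) (fp : exists x, f x != +oo%E)
  (fconv : convex_fun f) (flsc : lower_semicontinuous f).
Implicit Types (x y z d : X) (u v w p q : @dual R X).

Lemma dom_nonempty : exists x, dom f x.
Proof. by have [x fx] := fp; exists x; rewrite /dom/= ltey. Qed.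

Lemma not_dom x : ~ dom f x -> f x = +oo%E.
Proof. by move=> ndx; apply/eqP; rewrite -leye_eq leNgt; apply/negP. Qed.

Lemma fconj_gt u x : dom f x -> ((pair x u - fval f x)%:E <= fconj f u)%E.
Proof.
move=> dx; apply: ereal_sup_ubound; exists x => //.
by rewrite (dom_val fN dx) -EFinB.
Qed.

Lemma fconj_neqN u : fconj f u != -oo%E.
Proof.
have [x dx] := dom_nonempty; have := fconj_gt u dx.
by case: (fconj f u).
Qed.

Lemma fconj_fin u : (fconj f u < +oo)%E -> exists2 N, fconj f u = N%:E & cj f u N.
Proof.
have := fconj_neqN u; case E: (fconj f u) => [N| |] // _ _; exists N => //.
by apply/(fconj_leP fN); rewrite E.
Qed.

Lemma cj_mix t u v w N M : 0 <= t <= 1 -> cj f u N -> cj f v M ->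
  (forall x, pair x w = t * pair x u + (1 - t) * pair x v) ->
  cj f w (t * N + (1 - t) * M).
Proof.
move=> /andP[t0 t1] cu cv wE x dx; rewrite wE.
by have := cu x dx; have := cv x dx; nra.
Qed.

Definition conj_sum x u := (f x + fconj f u)%E.

Lemma conj_sum_leP x u s : (conj_sum x u <= s%:E)%E <->
  dom f x /\ cj f u (s - fval f x).
Proof.
rewrite /conj_sum; split=> [h|[dx cu]].
  have dx : dom f x.
    apply: contrapT => /not_dom fx; move: h; rewrite fx addye ?fconj_neqN//.
  split=> //; apply/(fconj_leP fN); move: h; rewrite (dom_val fN dx).
  by rewrite EFinB leeBrDl.
move/(fconj_leP fN): cu; rewrite (dom_val fN dx) EFinB leeBrDl//.
Qed.

Lemma conj_sum_neqN x u : conj_sum x u != -oo%E.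
Proof. by rewrite /conj_sum adde_eq_ninfty negb_or fN fconj_neqN. Qed.

Lemma conj_sum_ge x u : ((pair x u)%:E <= conj_sum x u)%E.
Proof.
have := conj_sum_neqN x u; case E: (conj_sum x u) => [s| |] // _; last exact: leey.
have /conj_sum_leP[dx cu] : (conj_sum x u <= s%:E)%E by rewrite E.
by rewrite lee_fin; have := cu x dx; lra.
Qed.

Lemma conj_sum_subg x u : subg f x u -> conj_sum x u = (pair x u)%:E.
Proof.
move=> [dx h]; apply/eqP; rewrite eq_le conj_sum_ge andbT; apply/conj_sum_leP.
by split=> // y dy; have := h y dy; rewrite pairB; lra.
Qed.

Lemma conj_sum_lsc : lsc2 conj_sum.
Proof.
move=> x p a; rewrite /conj_sum => afp.
have [b1 [b2 [b1f b2f ab]]] : exists b1 b2, [/\ (b1%:E < f x)%E,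
    (b2%:E < fconj f p)%E & a <= b1 + b2].
  move: afp; have := fN x; have := fconj_neqN p.
  case: (f x) => [s| |] //; case: (fconj f p) => [N| |] // _ _.
  - rewrite -EFinD lte_fin => h; exists ((s + a - N) / 2), ((N + a - s) / 2).
    by rewrite !lte_fin; split; lra.
  - by move=> _; exists (s - 1), (a - s + 1); rewrite lte_fin ltry; split=> //; lra.
  - by move=> _; exists (a - N + 1), (N - 1); rewrite lte_fin ltry; split=> //; lra.
  - by move=> _; exists a, 0; rewrite !ltry; split=> //; lra.
have [V /nbhs_ballP[e1 /= e10 e1V] VP] := flsc b1f.
have [z [dz hz]] : exists z, dom f z /\ b2 < pair z p - fval f z.
  apply: contrapT => no; move: b2f; rewrite ltNge => /negP; apply.
  apply/(fconj_leP fN) => z dz; rewrite leNgt; apply/negP => hz; apply: no; by exists z.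
have z1 : 0 < `|z| + 1 by rewrite ltr_wpDl.
pose g := pair z p - fval f z - b2; have g0 : 0 < g by rewrite /g; lra.
exists (Num.min e1 (g / (`|z| + 1))); first by rewrite lt_min e10/= divr_gt0.
move=> y q yx /ltW/ddist_dle/(_ z) qp.
have fy : (b1%:E < f y)%E.
  apply/VP/e1V; rewrite -ball_normE /= distrC; apply: lt_le_trans yx _.
  by rewrite ge_min lexx.
have fq : (b2%:E < fconj f q)%E.
  apply: lt_le_trans (fconj_gt q dz); rewrite lte_fin.
  have : Num.min e1 (g / (`|z| + 1)) * `|z| < g.
    apply: (@le_lt_trans _ _ (g / (`|z| + 1) * `|z|)).
      by rewrite ler_wpM2r// ge_min lexx orbT.
    by rewrite mulrAC ltr_pdivrMr// ltr_pM2l//; lra.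
  by move: qp; rewrite ler_norml /g => /andP[? _]; lra.
apply: le_lt_trans (lteD fy fq); by rewrite -EFinD lee_fin.
Qed.

Lemma conj_sum_convex : convex_fun2 conj_sum.
Proof.
move=> x1 x2 p1 p2 p t t01 pE; have /andP[t0 t1] := t01.
have ext q1 q2 : (forall z, pair z q1 = pair z q2) -> fconj f q1 = fconj f q2.
  move=> h; congr ereal_sup; apply/seteqP; split=> _ [z _ <-]; exists z => //.
    by rewrite h.
  by rewrite h.
have [tE|tn0] := eqVneq t 0.
  rewrite tE scale0r add0r mul0e add0e !subr0 scale1r mul1e /conj_sum (ext p p2)// => z.
  by rewrite pE tE mul0r add0r subr0 mul1r.
have [tE|tn1] := eqVneq t 1.
  rewrite tE subrr scale0r addr0 mul0e adde0 scale1r mul1e /conj_sum (ext p p1)// => z.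
  by rewrite pE tE mul1r subrr mul0r addr0.
have tt0 : 0 < t by rewrite lt_neqAle eq_sym tn0.
have tt1 : 0 < 1 - t by rewrite subr_gt0 lt_neqAle tn1.
have [E1|E1] := eqVneq (conj_sum x1 p1) +oo%E.
  rewrite E1 gt0_muley ?lte_fin// addye ?leey//.
  by rewrite mule_eq_ninfty !negb_or !negb_and /= conj_sum_neqN !orbT andbT lte_fin -leNgt ltW.
have [E2|E2] := eqVneq (conj_sum x2 p2) +oo%E.
  rewrite E2 [((1 - t)%:E * _)%E]gt0_muley ?lte_fin// addey ?leey//.
  by rewrite mule_eq_ninfty !negb_or !negb_and /= conj_sum_neqN !orbT andbT lte_fin -leNgt ltW.
have := conj_sum_neqN x1 p1; case e1: (conj_sum x1 p1) E1 => [s1| |] // _ _.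
have := conj_sum_neqN x2 p2; case e2: (conj_sum x2 p2) E2 => [s2| |] // _ _.
have /conj_sum_leP[d1 c1] : (conj_sum x1 p1 <= s1%:E)%E by rewrite e1.
have /conj_sum_leP[d2 c2] : (conj_sum x2 p2 <= s2%:E)%E by rewrite e2.
have t01' : 0 < t < 1 by rewrite tt0/=; lra.
have [d h] := dom_convex fN fconv t01' d1 d2.
rewrite -!EFinM -EFinD; apply/conj_sum_leP; split=> // x dx.
by have := cj_mix t01 c1 c2 pE dx; lra.
Qed.

Lemma conj_sum_representative : (exists x u, subg f x u) -> representative f conj_sum.
Proof.
move=> [x [u xu]]; split.
- split; first exact: conj_sum_neqN.
  by exists x, u; rewrite (conj_sum_subg xu).
- exact: conj_sum_convex.
- exact: conj_sum_lsc.
- exact: conj_sum_ge.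
- by move=> y p /(subgP fN)/conj_sum_subg.
Qed.

End Representatives.

(** * Uniqueness of the representative from the decomposition *)

Section Rectangle.
Context {R : realType} {X : completeNormedModType R} (f : X -> \bar R).
Context (fN : forall x, f x != -oo%E) (fp : exists x, f x != +oo%E)
  (fconv : convex_fun f) (flsc : lower_semicontinuous f).
Implicit Types (x y z d k c : X) (u v w p q : @dual R X).
(** [S] stands for the closure of [K + C] and [W] for [V] translated by the linear part. [KW] and
    [fW] together say that, on [S], [f] is [f k] plus the supremum over [W] of [<x - k, w>], for any
    [k] in [K]. *)
Context (K C S : set X) (W : set (@dual R X)) (k0 x0 : X) (w0 : @dual R X).
Context (Kk0 : K k0) (C0 : C 0) (Ccone : is_cone C) (Sclosed : closed S)
  (Sconv : forall t x y, 0 < t < 1 -> S x -> S y -> S (t *: x + (1 - t) *: y))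
  (Sdense : forall x, S x -> forall e : R, 0 < e ->
     exists k c, [/\ K k, C c & `|x - (k + c)| < e])
  (SKC : forall k c, K k -> C c -> S (k + c))
  (domS : forall x, dom f x -> S x) (Ww0 : W w0)
  (KW : forall k w, K k -> W w -> subg f k w)
  (fW : forall k x s, K k -> S x ->
     (forall w, W w -> fval f k + pair (x - k) w <= s) -> dom f x /\ fval f x <= s).

Let SK k : K k -> S k.
Proof. by move=> Kk; rewrite -[k]addr0; exact: SKC. Qed.

Lemma recession_le k c t s : K k -> C c -> 0 <= t ->
  (forall w, W w -> pair c w <= s) ->
  dom f (k + t *: c) /\ fval f (k + t *: c) <= fval f k + t * s.
Proof.
move=> Kk Cc t0 h; apply: (fW Kk); first by apply: SKC => //; exact: Ccone.
by move=> w Ww; rewrite addrAC subrr add0r pairZ lerD2l ler_wpM2l// h.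
Qed.

(** Near the boundary [f] has no upper control, so [x] is moved slightly towards [x0] before being
    approximated from [K + C]. *)
Lemma KC_dense_dom x e : bint f x0 -> dom f x -> 0 < e ->
  exists k c, [/\ K k, C c, `|x - (k + c)| < e, bint f (k + c) &
    fval f (k + c) <= fval f x + e].
Proof.
move=> b0 dx e0.
pose m := `|x - x0| + `|fval f x0 - fval f x| + 1.
have m0 : 0 < m by rewrite ltr_wpDl// addr_ge0.
pose t := Num.min (1 / 2) (e / 4 / m).
have t0 : 0 < t by rewrite lt_min !divr_gt0.
have t1 : t <= 1 / 2 by rewrite ge_min lexx.
have t01 : 0 < t < 1 by apply/andP; split; lra.
have tm : t * m <= e / 4 by rewrite -ler_pdivlMr// ge_min lexx orbT.
have na := normr_ge0 (x - x0); have nb := normr_ge0 (fval f x0 - fval f x).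
have ta : t * `|x - x0| <= e / 4.
  by apply: le_trans tm; rewrite ler_wpM2l ?(ltW t0)// /m; lra.
have tb : t * `|fval f x0 - fval f x| <= e / 4.
  by apply: le_trans tm; rewrite ler_wpM2l ?(ltW t0)// /m; lra.
pose xt := t *: x0 + (1 - t) *: x.
have bt : bint f xt := bint_segment fN fconv b0 dx t01.
have [_ vt] := dom_convex fN fconv t01 (bint_dom b0) dx.
have xxt : `|x - xt| <= e / 4.
  have -> : x - xt = t *: (x - x0) by apply: pair_ext => u; rewrite !pairE; ring.
  by rewrite normrZ ger0_norm ?(ltW t0).
have e2 : 0 < e / 2 by rewrite divr_gt0.
have [r r0 rP] := bint_usc fN fconv bt e2.
have m1 : 0 < Num.min r (e / 2) by rewrite lt_min r0.
have [k [c [Kk Cc h]]] := Sdense (domS (bint_dom bt)) m1.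
have [|bk vk] := rP (k + c - xt).
  by rewrite distrC ltW// (lt_le_trans h)// ge_min lexx.
move: bk vk; rewrite subrKC => bk vk; exists k, c; split=> //.
  apply: le_lt_trans (ler_distD xt _ _) _.
  have : `|xt - (k + c)| < e / 2 by apply: lt_le_trans h _; rewrite ge_min lexx orbT.
  lra.
have := ler_norm (fval f x0 - fval f x); have := ler_wpM2l (ltW t0) (ler_norm (fval f x0 - fval f x)).
by move: vt; rewrite -/xt; lra.
Qed.

(* [f] is the sum of the sublinear function [sup_W] (translated to [k]) and the
   indicator of [S]; its conjugate splits accordingly because the former is
   bounded above near a point of [S]. *)
Lemma conj_split k q N : bint f x0 -> K k -> cj f q N -> exists w, subg f k w /\
  forall x, S x -> pair (x - k) q - pair (x - k) w <= N - pair k q + fval f k.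
Proof.
move=> b0 Kk cy; have dk := (KW Kk Ww0).1.
set g := N - pair k q + fval f k.
have [r [M [r0 h]]] := b0.
(* The epigraph of the inf-convolution of [sup_W] with [g - q] on [S], reflected about [k]; its
   nonnegativity at the origin comes from [f^* q <= N]. *)
pose A d s := exists2 x, S x &
  forall w, W w -> pair (d + (x - k)) w <= s + pair (x - k) q - g.
have [||||w wA] := @hahn_banach_epi R X A r (M - fval f k - pair (x0 - k) q + g).
- move=> t d1 s1 d2 s2 t01 [x1 S1 h1] [x2 S2 h2]; have /andP[t0 t1] := t01.
  exists (t *: x1 + (1 - t) *: x2); first exact: Sconv.
  move=> w Ww; have := h1 _ Ww; have := h2 _ Ww; rewrite !pairE; nra.
- move=> s [x Sx]; rewrite add0r => hx.
  have [w Ww|dx vx] := fW (s := fval f k + (s + pair (x - k) q - g)) Kk Sx.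
    by have := hx w Ww; lra.
  by have := cy x dx; move: vx; rewrite /g pairB; lra.
- exact: r0.
- move=> d /h[dd vd]; exists x0; first exact/domS/bint_dom.
  move=> w Ww; have := (KW Kk Ww).2 _ dd.
  have -> : d + (x0 - k) = x0 + d - k by rewrite addrCA addrA.
  by move: vd; lra.
exists w; split.
  split=> // x dx.
  suff : pair (x - k) w <= fval f x - fval f k by lra.
  apply: (@ler_scaled R _ _ g) => n; rewrite -pairZ.
  apply: wA; exists k; first exact: SK.
  move=> w' Ww'; rewrite subrr addr0 pair0 pairZ.
  have n0 : 0 <= n.+1%:R :> R by [].
  have h' : pair (x - k) w' <= fval f x - fval f k by have := (KW Kk Ww').2 _ dx; lra.
  by have := ler_wpM2l n0 h'; lra.
move=> x Sx; have := wA (- (x - k)) (g - pair (x - k) q).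
rewrite pairN => hx; suff : - pair (x - k) w <= g - pair (x - k) q by lra.
apply: hx; exists x => // w' _; rewrite addNr pair0; lra.
Qed.

(** Along [k + t c] the function lies below the line through its values at [t = 0] and [t = 1]. A
    subgradient at [t = 1], tested at [t = 0] and [t = 2], must have the slope of this line, and so
    supports [f] along the whole ray. *)
Lemma subg_ray k c w1 : K k -> C c -> subg f (k + c) w1 ->
  pair c w1 = fval f (k + c) - fval f k /\ forall t, 0 <= t -> subg f (k + t *: c) w1.
Proof.
move=> Kk Cc [dkc h]; set s := fval f (k + c) - fval f k.
have cW w : W w -> pair c w <= s.
  by move=> Ww; have := (KW Kk Ww).2 _ dkc; rewrite addrAC subrr add0r /s; lra.
have ray t (t0 : 0 <= t) := recession_le Kk Cc t0 cW.
have hray t : 0 <= t -> (t - 1) * pair c w1 <= (t - 1) * s.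
  move=> t0; have [dt vt] := ray t t0; have := h _ dt.
  have -> : k + t *: c - (k + c) = (t - 1) *: c.
    by apply: pair_ext => u; rewrite !pairE; ring.
  by rewrite pairZ; move: vt; rewrite /s; lra.
have cw1 : pair c w1 = s.
  by have := hray 0 (lexx _); have := hray 2 (ler0n _ 2); lra.
split=> // t t0; have [dt vt] := ray t t0; split=> // y dy; have := h y dy.
by rewrite !pairE cw1; move: vt; rewrite /s; lra.
Qed.

Context (h : X -> @dual R X -> \bar R) (hr : representative f h).

Lemma rep_subg x p : subg f x p -> h x p = (pair x p)%:E.
Proof. by move=> xp; have [_ _ _ _] := hr; apply; apply/(subgP fN). Qed.

Lemma rep_mix x1 x2 p1 p2 p t s1 s2 : 0 <= t <= 1 ->
  (h x1 p1 <= s1%:E)%E -> (h x2 p2 <= s2%:E)%E ->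
  (forall z, pair z p = t * pair z p1 + (1 - t) * pair z p2) ->
  (h (t *: x1 + (1 - t) *: x2)%R p <= (t * s1 + (1 - t) * s2)%:E)%E.
Proof.
move=> t01 h1 h2 pE; have [_ hc _ _ _] := hr.
have := hc x1 x2 p1 p2 p t t01 pE; move=> /le_trans; apply.
move: t01 => /andP[t0 t1]; rewrite [leRHS]EFinD !EFinM.
by apply: leeD; apply: lee_wpmul2l => //; rewrite lee_fin ?subr_ge0.
Qed.

(** Remote graph points get a small weight [s]. Since [q - w] is maximal over [S] at [a], the slope
    [(1 - 1/s) w + q/s] is a subgradient at [a]; mixed with [(k, w)] it yields exactly [q]. Mixing
    in [(k + c/s, w1)], again with weight [s], moves the position to [k + c] up to [O(s)]. The
    values of [h] at these graph points add up to [f (k + c) + f^* q + O(s)]. *)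
Lemma rep_near k c a q e : bint f x0 -> K k -> C c -> bint f (k + c) -> subg f a q ->
  0 < e -> exists x p, [/\ `|x - (k + c)| < e, dle p q e &
    (h x p <= (fval f (k + c) + (pair a q - fval f a) + e)%:E)%E].
Proof.
move=> b0 Kk Cc bkc aq e0; have [da aqP] := aq.
have cq : cj f q (pair a q - fval f a).
  by move=> x dx; have := aqP x dx; rewrite pairB; lra.
have [w [kw wP]] := conj_split b0 Kk cq; have [dk kwP] := kw.
have aE : fval f a = fval f k + pair (a - k) w.
  by have := kwP a da; have := wP a (domS da); rewrite !pairB; lra.
have aw t : 0 <= t -> subg f a (dcomb (1 - t) w t q).
  move=> t0; split=> // x dx; rewrite pair_dcomb.
  have h1 := kwP x dx; have h2 := wP x (domS dx).
  have h3 : pair (x - a) q - pair (x - a) w <= 0.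
    by move: h2 aE; rewrite !pairB; lra.
  have := ler_wpM2l t0 h3; move: h1 aE; rewrite mulr0 !pairB; lra.
have [w1 xw1] := subg_exists fN fconv bkc.
have [cw1 rayw1] := subg_ray Kk Cc xw1.
have [M1 M10 M1P] := pair_bounded w1; have [M2 M20 M2P] := pair_bounded q.
pose B := `|pair k w1| + `|pair a q| + 2 * `|pair a w - pair k w| + `|a - k| + M1 + M2 + 1.
have n1 := normr_ge0 (pair k w1); have n2 := normr_ge0 (pair a q).
have n3 := normr_ge0 (pair a w - pair k w); have n4 := normr_ge0 (a - k).
have B0 : 0 < B by rewrite /B; lra.
pose s := Num.min (1 / 2) (e / 2 / B).
have s0 : 0 < s by rewrite lt_min !divr_gt0.
have s1 : s <= 1 / 2 by rewrite ge_min lexx.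
have sB : s * B <= e / 2 by rewrite -ler_pdivlMr// ge_min lexx orbT.
have s01 : 0 <= s <= 1 by apply/andP; split; lra.
have sn : s * s^-1 = 1 by rewrite divff ?gt_eqF.
have sn0 : 0 <= s^-1 by rewrite invr_ge0 ltW.
have H1 : (h (s *: a + (1 - s) *: k)%R q <=
    (s * pair a (dcomb (1 - s^-1) w s^-1 q) + (1 - s) * pair k w)%:E)%E.
  apply: (@rep_mix _ _ (dcomb (1 - s^-1) w s^-1 q) w) => //.
  - by rewrite (rep_subg (aw _ sn0)).
  - by rewrite (rep_subg kw).
  - by move=> z; rewrite pair_dcomb mulrDr !mulrA mulrBr sn; ring.
exists (s *: (k + s^-1 *: c) + (1 - s) *: (s *: a + (1 - s) *: k)), (dcomb s w1 (1 - s) q).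
have sprod b : 0 <= b -> b <= B -> s * b <= e / 2.
  by move=> b0' bB; apply: le_trans sB; rewrite ler_wpM2l// ltW.
split.
- have -> : s *: (k + s^-1 *: c) + (1 - s) *: (s *: a + (1 - s) *: k) - (k + c) =
      (s * (1 - s)) *: (a - k).
    by apply: pair_ext => u; rewrite !pairE mulrDr mulrA sn; ring.
  rewrite normrZ ger0_norm; last by rewrite mulr_ge0//; lra.
  have h1 : s * `|a - k| <= e / 2 by apply: sprod => //; rewrite /B; lra.
  have : s * s * `|a - k| >= 0 by rewrite !mulr_ge0 // ltW.
  by rewrite mulrBr mulr1 mulrBl; lra.
- move=> z; rewrite pair_dcomb.
  have -> : s * pair z w1 + (1 - s) * pair z q - pair z q = s * (pair z w1 - pair z q) by ring.
  rewrite normrM ger0_norm ?(ltW s0)//.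
  apply: (@le_trans _ _ (s * ((M1 + M2) * `|z|))).
    rewrite ler_wpM2l ?(ltW s0)// mulrDl.
    by apply: le_trans (ler_normB _ _) _; rewrite lerD.
  rewrite mulrA ler_wpM2r//.
  have : s * (M1 + M2) <= e / 2 by apply: sprod; rewrite /B; lra.
  by lra.
- have := rep_mix s01 (_ : (h (k + s^-1 *: c)%R w1 <= (pair (k + s^-1 *: c) w1)%:E)%E) H1
    (fun z => pair_dcomb s w1 (1 - s) q z).
  rewrite (rep_subg (rayw1 _ sn0)) lexx => /(_ isT)/le_trans; apply; rewrite lee_fin.
  have h1 : s * `|pair k w1| <= e / 2 by apply: sprod => //; rewrite /B; lra.
  have hB : s * (`|pair k w1| + `|pair a q| + 2 * `|pair a w - pair k w|) <= e / 2.
    by apply: sprod; rewrite /B; lra.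
  have l1 := ler_norm (pair k w1).
  have l2 : - `|pair a q| <= pair a q by have := ler_norm (- pair a q); rewrite normrN; lra.
  have l3 := ler_norm (pair a w - pair k w).
  rewrite pair_dcomb !pairD !pairZ cw1.
  set P := (X in X <= _).
  have PE : P = fval f (k + c) + (pair a q - fval f a) +
      s * (pair k w1 - pair a q + (2 - s) * (pair a w - pair k w)).
    rewrite /P aE pairB.
    have -> : s * (pair k w1 + s^-1 * (fval f (k + c) - fval f k)) =
       s * pair k w1 + (fval f (k + c) - fval f k) by rewrite mulrDr mulrA sn mul1r.
    have -> : s * ((1 - s^-1) * pair a w + s^-1 * pair a q) = (s - 1) * pair a w + pair a q.
      by rewrite mulrDr !mulrA mulrBr sn; ring.
    ring.
  rewrite PE lerD2l; apply: (@le_trans _ _ (e / 2)); last by lra.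
  apply: le_trans hB; rewrite ler_wpM2l ?(ltW s0)//.
  have : (2 - s) * (pair a w - pair k w) <= 2 * `|pair a w - pair k w|.
    apply: (@le_trans _ _ ((2 - s) * `|pair a w - pair k w|)).
      by rewrite ler_wpM2l//; lra.
    by rewrite ler_wpM2r//; lra.
  lra.
Qed.

(** Tilting [q] by a small multiple of the coercive [v] makes [strongly_exposed] applicable, so a
    nearby [p] attains its conjugate. Then [rep_near] bounds [h] at points close to [(x, q)], and
    lower semicontinuity passes the bound on. *)
Lemma rep_le v r N0 x q N : @RNP R X -> bint f x0 -> 0 < r ->
  coercive (epi f) v r N0 -> dom f x -> cj f q N -> (h x q <= (fval f x + N)%:E)%E.
Proof.
move=> rnp b0 r0 cv dx cq; rewrite leNgt; apply/negP => hgt.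
have [_ _ hl hge _] := hr.
have [a [Na ah]] : exists a, fval f x + N < a /\ (a%:E < h x q)%E.
  move: hgt; have := hge x q; case: (h x q) => [b| |] //= _.
    by rewrite lte_fin => hb; exists ((fval f x + N + b) / 2); rewrite lte_fin; split; lra.
  by move=> _; exists (fval f x + N + 1); split; [lra|exact: ltry].
have [e e0 eP] := hl _ _ _ ah.
pose g := a - fval f x - N; have g0 : 0 < g by rewrite /g; lra.
pose e' := Num.min (e / 4) (g / 4).
have e'0 : 0 < e' by rewrite lt_min !divr_gt0.
have e'e : e' <= e / 4 by rewrite ge_min lexx.
have e'g : e' <= g / 4 by rewrite ge_min lexx orbT.
have [k [c [Kk Cc xkc bkc vkc]]] := KC_dense_dom b0 dx e'0.
have [Mq Mq0 MqP] := pair_bounded q; have [Mv Mv0 MvP] := pair_bounded v.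
have nN := normr_ge0 (N0 - N).
pose B := Mq + Mv + `|N0 - N| + 1; have B0 : 0 < B by rewrite /B; lra.
pose t := Num.min (1 / 2) (e' / B).
have t0 : 0 < t by rewrite lt_min !divr_gt0.
have t1 : t <= 1 / 2 by rewrite ge_min lexx.
have tB : t * B <= e' by rewrite -ler_pdivlMr// ge_min lexx orbT.
have tsmall b : b <= B -> t * b <= e'.
  by move=> bB; apply: le_trans tB; rewrite ler_wpM2l// ltW.
pose qt := dcomb (1 - t) q t v.
have cqt : coercive (epi f) qt (t * r) ((1 - t) * N + t * N0).
  move=> z s zs; have [dz vz] := dom_of_le fN zs.
  by rewrite pair_dcomb; have := cq z dz; have := cv _ _ zs; nra.
pose d := Num.min (t * r) e'.
have d0 : 0 < d by rewrite lt_min mulr_gt0.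
have nef : exists x s, epi f x s by exists x, (fval f x); exact: epi_val.
have [p [pqt [b [s [bs bmin _]]]]] :=
  strongly_exposed rnp nef (epi_closedP fN flsc) cqt (mulr_gt0 t0 r0) d0.
have [db vb] := dom_of_le fN bs.
have sE : s = fval f b.
  by apply/eqP; rewrite eq_le vb andbT; have := bmin b (fval f b) (epi_val fN db (lexx _));
    rewrite subrr pair0 addr0.
have bp : subg f b p.
  by split=> // z dz; rewrite -sE; apply: bmin; exact: epi_val.
have [x' [p' [x'kc p'p hx']]] := rep_near b0 Kk Cc bkc bp e'0.
have bound : pair b p - fval f b <= N + e'.
  have h1 := cq b db; have h2 := cv _ _ (epi_val fN db (lexx _)).
  have := pqt b; rewrite ler_norml => /andP[_]; rewrite pair_dcomb => h3.
  have h4 : d * `|b| <= t * r * `|b| by rewrite ler_wpM2r// ge_min lexx.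
  have h5 : t * (N0 - N) <= e'.
    by apply: tsmall; rewrite /B; have := ler_norm (N0 - N); lra.
  nra.
have x'x : `|x' - x| < e.
  apply: le_lt_trans (ler_distD (k + c) _ _) _; rewrite [`|k + c - x|]distrC; lra.
have p'q' : (ddist p' q < e%:E)%E.
  apply: (@le_lt_trans _ _ (e' + (e' + e'))%:E); last by rewrite lte_fin; lra.
  apply: dle_ddist; last by lra.
  apply: dle_trans p'p _; apply: (@dle_trans _ _ _ qt).
    by apply: dle_le pqt; rewrite ge_min lexx orbT.
  move=> z; rewrite pair_dcomb.
  have -> : (1 - t) * pair z q + t * pair z v - pair z q = t * (pair z v - pair z q) by ring.
  rewrite normrM ger0_norm ?(ltW t0)//.
  apply: (@le_trans _ _ (t * ((Mq + Mv) * `|z|))).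
    rewrite ler_wpM2l ?(ltW t0)// mulrDl.
    by apply: le_trans (ler_normB _ _) _; rewrite [leRHS]addrC lerD.
  by rewrite mulrA ler_wpM2r//; apply: tsmall; rewrite /B; lra.
have := lt_le_trans (eP x' p' x'x p'q') hx'; rewrite lte_fin.
move: e'g; rewrite /g; lra.
Qed.

(* Midpoint convexity against [h >= <.,.>]: a point where [h] exceeds the duality
   product by at most [eta] behaves like a graph point up to [2 eta]. *)
Lemma rep_almost x q b p B eta : (h x q <= B%:E)%E ->
  (h b p <= (pair b p + eta)%:E)%E ->
  pair b q + pair x p + pair x q <= pair b p + 2 * eta + 2 * B.
Proof.
move=> hB hb; have [_ _ _ hge _] := hr.
have h2 : (0 <= (1 / 2 : R)) && ((1 / 2 : R) <= 1) by apply/andP; split; lra.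
have := rep_mix h2 hB hb (fun z => pair_dcomb (1 / 2) q (1 - 1 / 2) p z).
move=> /(le_trans (hge _ _)); rewrite lee_fin pair_dcomb !pairE; lra.
Qed.

(** The Fitzpatrick function lies below every representative: compare first-order terms as the
    weight [e] of [(x, q)] vanishes. *)
Lemma rep_graph x q b p B : (h x q <= B%:E)%E -> subg f b p ->
  pair b q + pair x p - pair b p <= B.
Proof.
move=> hB bp; have [_ _ _ hge _] := hr.
have hb : (h b p <= (pair b p)%:E)%E by rewrite rep_subg.
apply: (@ler_vanishing _ _ _ (pair b q + pair x p - pair b p - pair x q)) => e /andP[e0 e1].
have e01 : 0 <= e <= 1 by rewrite !ltW.
have := rep_mix e01 hB hb (fun z => pair_dcomb e q (1 - e) p z).
move=> /(le_trans (hge _ _)); rewrite lee_fin pair_dcomb !pairE => hh.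
rewrite -(ler_pM2l e0).
nra.
Qed.

Lemma C_le0 p (s : R) : (forall x, S x -> pair x p <= s) -> forall c, C c -> pair c p <= 0.
Proof.
move=> hs c Cc; apply: (@ler_scaled _ _ _ (s - pair k0 p)) => n.
have := hs (k0 + n.+1%:R *: c) _; rewrite pairD pairZ mulr0 => hh.
suff : pair k0 p + n.+1%:R * pair c p <= s by lra.
by apply: hh; apply: SKC => //; exact: Ccone.
Qed.

Lemma S_sup_K p k e : 0 <= e -> (forall c, C c -> pair c p <= 0) ->
  (forall k', K k' -> pair k' p <= pair k p + e) ->
  forall x, S x -> pair x p <= pair k p + e.
Proof.
move=> e0 Cp Kp x Sx; have [M M0 MP] := pair_bounded p.
apply: (@ler_vanishing _ _ _ M) => d /andP[d0 d1].
have [k' [c [Kk' Cc xkc]]] := Sdense Sx d0.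
have := MP (x - (k' + c)); rewrite !pairE ler_norml => /andP[_ h1].
have h2 : M * `|x - (k' + c)| <= M * d by rewrite ler_wpM2l// ltW.
by have := Kp _ Kk'; have := Cp _ Cc; lra.
Qed.

Section LowerBound.
Context (hle : forall x p N, dom f x -> cj f p N -> (h x p <= (fval f x + N)%:E)%E).
Context (x : X) (q : @dual R X) (B : R) (hB : (h x q <= B%:E)%E).

(** If [p] separates [x] from [S] by [rho] and [k] almost maximises [p] on [K], then at
    [(k, w0 + t p)] the excess of [h] over the duality product is at most [t * rho / 8]. In
    [rep_almost] this costs [t * rho / 4], against a gain of [t * rho]; let [t] grow. *)
Lemma rep_S : S x.
Proof.
apply: contrapT => nSx; have [rho rho0 far] := closed_dist Sclosed nSx.
have [p pS] := separation Sconv (SK Kk0) far.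
pose V := [set pair k p | k in K].
have hV : has_sup V.
  split; first by exists (pair k0 p), k0.
  by exists (pair x p - rho) => _ [k Kk <-]; have := pS k (SK Kk); rewrite pairB; lra.
have rho8 : 0 < rho / 8 by rewrite divr_gt0.
have [_ [k Kk <-] ksup] := sup_adherent rho8 hV.
have kmax k' : K k' -> pair k' p <= pair k p + rho / 8.
  move=> Kk'; have : pair k' p <= sup V by apply: sup_upper_bound => //; exists k'.
  lra.
have Cp c : C c -> pair c p <= 0.
  by apply: (@C_le0 p (pair x p - rho)) => z /pS; rewrite pairB; lra.
have Smax := S_sup_K (ltW rho8) Cp kmax.
have kw := KW Kk Ww0.
have ray t : 0 <= t ->
    (h k (dcomb 1 w0 t p) <= (pair k (dcomb 1 w0 t p) + t * (rho / 8))%:E)%E.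
  move=> t0; have cN : cj f (dcomb 1 w0 t p)
      (pair k w0 - fval f k + t * (pair k p + rho / 8)).
    move=> z dz; rewrite pair_dcomb.
    by have := subg_cj kw dz; have := ler_wpM2l t0 (Smax z (domS dz)); lra.
  apply: le_trans (hle kw.1 cN) _; rewrite lee_fin pair_dcomb; lra.
have := pS k (SK Kk); rewrite pairB => kx.
suff : 3 / 4 * rho <= 0 by lra.
apply: (@ler_scaled _ _ _ (pair k w0 + 2 * B - pair k q - pair x w0 - pair x q)) => n.
have n0 : 0 <= n.+1%:R :> R by [].
have := rep_almost hB (ray _ n0); rewrite !pair_dcomb.
have := ler_wpM2l n0 kx; lra.
Qed.

(** The same argument with position and slope exchanged: go to infinity along [k0 + t c] with a
    fixed [w] that almost maximises [<c, w>] on [W]. *)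
Lemma rep_C c s : C c -> (forall w, W w -> pair c w <= s) -> pair c q <= s.
Proof.
move=> Cc cs; pose V := [set pair c w | w in W].
have hV : has_sup V.
  by split; [exists (pair c w0), w0|exists s => _ [w Ww <-]; exact: cs].
apply: (@ler_vanishing _ _ _ 2) => th /andP[th0 _].
have [_ [w Ww <-] wsup] := sup_adherent th0 hV.
have wmax w' : W w' -> pair c w' <= pair c w + th.
  move=> Ww'; have : pair c w' <= sup V by apply: sup_upper_bound => //; exists w'.
  lra.
have kw := KW Kk0 Ww.
have ray t : 0 <= t ->
    (h (k0 + t *: c)%R w <= (pair (k0 + t *: c) w + t * th)%:E)%E.
  move=> t0; have [dt vt] := recession_le Kk0 Cc t0 wmax.
  apply: le_trans (hle dt (subg_cj kw)) _; rewrite lee_fin !pairE; move: vt; lra.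
suff : pair c q <= pair c w + 2 * th by have := cs w Ww; lra.
apply: (@ler_scaled _ _ _ (pair k0 w + 2 * B - pair k0 q - pair x w - pair x q)) => n.
have n0 : 0 <= n.+1%:R :> R by [].
have := rep_almost hB (ray _ n0); rewrite !pairE; lra.
Qed.

(** At [k + c] the bound splits into a part at [k], from [rep_graph], and a part along [c], from
    [rep_C]; such points approximate the domain together with the values. *)
Lemma rep_ge : bint f x0 -> dom f x /\ cj f q (B - fval f x).
Proof.
move=> b0.
have xk k : K k -> dom f x /\ fval f x <= B - pair k q + fval f k.
  move=> Kk; apply: (fW Kk rep_S) => w Ww.
  by have := rep_graph hB (KW Kk Ww); rewrite pairB; lra.
have [dx _] := xk _ Kk0; split=> //.
have KC k c : K k -> C c -> dom f (k + c) ->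
    pair (k + c) q - fval f (k + c) <= B - fval f x.
  move=> Kk Cc dkc; have [_ vx] := xk _ Kk.
  have : pair c q <= fval f (k + c) - fval f k.
    apply: rep_C => // w Ww; have := (KW Kk Ww).2 _ dkc.
    by rewrite addrAC subrr add0r; lra.
  by rewrite pairD; lra.
move=> z dz; have [M M0 MP] := pair_bounded q.
apply: (@ler_vanishing _ _ _ (M + 1)) => e /andP[e0 e1].
have [k [c [Kk Cc zkc bkc vkc]]] := KC_dense_dom b0 dz e0.
have := KC k c Kk Cc (bint_dom bkc).
have := MP (z - (k + c)); rewrite pairB ler_norml => /andP[_ h1].
have h2 : M * `|z - (k + c)| <= M * e by rewrite ler_wpM2l// ltW.
lra.
Qed.

End LowerBound.

Theorem rep_unique v r N0 : @RNP R X -> bint f x0 -> 0 < r ->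
  coercive (epi f) v r N0 -> h = conj_sum f.
Proof.
move=> rnp b0 r0 cv.
have hle x p N : dom f x -> cj f p N -> (h x p <= (fval f x + N)%:E)%E.
  exact: rep_le rnp b0 r0 cv.
apply/funext => x; apply/funext => p; apply/eqP; rewrite eq_le; apply/andP; split.
  have := conj_sum_neqN fN fp x p; case E: (conj_sum f x p) => [s| |] // _; last exact: leey.
  have /(conj_sum_leP fN fp)[dx cp] : (conj_sum f x p <= s%:E)%E by rewrite E.
  by apply: le_trans (hle _ _ _ dx cp) _; rewrite lee_fin; lra.
have [_ _ _ hge _] := hr; have := hge x p.
case E: (h x p) => [s| |] // _; last exact: leey.
have hs : (h x p <= s%:E)%E by rewrite E.
by apply/(conj_sum_leP fN fp); exact: rep_ge hle _ _ _ hs b0.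
Qed.

End Rectangle.

Section ConvexSets.
Context {R : realType} {X : normedModType R}.
Implicit Types (A B : set X) (x y : X).

Lemma convex_setP A : convex_set A <->
  forall t x y, 0 < t < 1 -> A x -> A y -> A (t *: x + (1 - t) *: y).
Proof.
split=> [cA t x y /andP[t0 t1] Ax Ay|cA].
  have := cA x y (Itv01 (ltW t0) (ltW t1)); rewrite !inE => /(_ Ax Ay).
  exact.
apply/convex_setW => x y; rewrite !inE => Ax Ay t t0 t1.
have t01 : 0 < t%:num < 1 by rewrite t0 t1.
apply/mem_set; exact: cA t01 Ax Ay.
Qed.

Lemma closureP A x :
  closure A x <-> forall e : R, 0 < e -> exists2 y, A y & `|x - y| < e.
Proof.
split=> [cx e e0|h B /nbhs_ballP[e /= e0 eB]].
  have [y [Ay By]] := cx _ (nbhsx_ballx x e e0); exists y => //.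
  by move: By; rewrite -ball_normE.
by have [y Ay xy] := h e e0; exists y; split=> //; apply: eB; rewrite -ball_normE.
Qed.

Lemma closure_convex A :
  (forall t x y, 0 < t < 1 -> A x -> A y -> A (t *: x + (1 - t) *: y)) ->
  forall t x y, 0 < t < 1 -> closure A x -> closure A y ->
    closure A (t *: x + (1 - t) *: y).
Proof.
move=> cA t x y t01 /closureP hx /closureP hy; apply/closureP => e e0.
have [x' Ax' xx'] := hx e e0; have [y' Ay' yy'] := hy e e0.
exists (t *: x' + (1 - t) *: y'); first exact: cA.
have -> : t *: x + (1 - t) *: y - (t *: x' + (1 - t) *: y') =
    t *: (x - x') + (1 - t) *: (y - y').
  by apply: pair_ext => u; rewrite !pairE; ring.
have /andP[t0 t1] := t01.
apply: le_lt_trans (ler_normD _ _) _; rewrite !normrZ !ger0_norm ?(ltW t0)//; last lra.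
nra.
Qed.

Lemma sum_convex A B :
  (forall t x y, 0 < t < 1 -> A x -> A y -> A (t *: x + (1 - t) *: y)) ->
  (forall t x y, 0 < t < 1 -> B x -> B y -> B (t *: x + (1 - t) *: y)) ->
  let S := [set a + b | a in A & b in B]%classic in
  forall t x y, 0 < t < 1 -> S x -> S y -> S (t *: x + (1 - t) *: y).
Proof.
move=> cA cB S t _ _ t01 [a1 Aa1 [b1 Bb1 <-]] [a2 Aa2 [b2 Bb2 <-]].
exists (t *: a1 + (1 - t) *: a2); first exact: cA.
exists (t *: b1 + (1 - t) *: b2); first exact: cB.
by apply: pair_ext => u; rewrite !pairE; ring.
Qed.

End ConvexSets.

(** * From the formula to uniqueness *)

Section SufficientCondition.
Context {R : realType} {X : completeNormedModType R} (f : X -> \bar R).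
Context (rnp : @RNP R X) (fN : forall x, f x != -oo%E) (fp : exists x, f x != +oo%E)
  (fconv : convex_fun f) (flsc : lower_semicontinuous f)
  (fint : interior (dom f) !=set0) (fsint : dual_int_nonempty (dom_dual (fconj f))).

Lemma formula_singleton (c : R) (xb : @dual R X) (K C : set X) (V : set (@dual R X)) :
  [/\ closed K, convex_set K & K !=set0] -> [/\ closed C, convex_set C & is_cone C] ->
  (exists z, V z /\ forall x, pair x z = 0) ->
  (forall xh, K xh -> forall x, f x = (support_fun V (x - xh)%R +
     ind_set (closure [set (k + y)%R | k in K & y in C]) x
       + (pair x xb)%:E + c%:E)%E) ->
  fitzpatrick_singleton f.
Proof.
move=> [_ /convex_setP cK [k0 Kk0]] [_ /convex_setP cC coneC] [z [Vz z0]] fE.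
set S := closure _ in fE.
have supp_ge0 x : (0 <= support_fun V x)%E.
  by apply: ereal_sup_ubound; exists z => //; rewrite z0.
have domS x : dom f x -> S x.
  move=> dx; apply: contrapT => nSx; move: dx; rewrite /dom/= (fE k0 Kk0).
  rewrite /ind_set asboolF// addey ?addye ?ltxx//.
  by rewrite -ltNye (lt_le_trans _ (supp_ge0 _))// ltNy0.
have [x0 b0] := bint_exists fN flsc fint.
(* [is_cone] admits the empty set; a point of the domain, being in the closure of [K + C], supplies
   an element of [C]. *)
have C0 : C 0.
  have /closureP/(_ 1 ltr01)[_ [k Kk [y Cy _]] _] := domS _ (bint_dom b0).
  by rewrite -(scale0r y); exact: coneC.
have SKC k y : K k -> C y -> S (k + y).
  by move=> Kk Cy; apply: subset_closure; exists k => //; exists y.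
pose W : set (@dual R X) := [set w | exists2 v, V v & forall x, pair x w = pair x v + pair x xb].
have Ww0 : W (dcomb 1 z 1 xb) by exists z => // x; rewrite pair_dcomb !mul1r.
have Kval k : K k -> f k = (pair k xb + c)%:E.
  move=> Kk; rewrite (fE k Kk) subrr /ind_set asboolT; last first.
    by rewrite -[k]addr0; exact: SKC.
  rewrite (_ : support_fun V 0 = 0%E) ?add0e//.
  apply/eqP; rewrite eq_le supp_ge0 andbT; apply: ge_ereal_sup => _ [v Vv <-].
  by rewrite pair0.
have Kdom k : K k -> dom f k by move=> Kk; rewrite /dom/= Kval// ltry.
have KvalE k : K k -> fval f k = pair k xb + c by move=> Kk; rewrite /fval Kval.
have fS k x : K k -> S x -> f x = (support_fun V (x - k)%R + (pair x xb + c)%:E)%E.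
  by move=> Kk Sx; rewrite (fE k Kk) /ind_set asboolT// adde0 -addeA.
have KW k w : K k -> W w -> subg f k w.
  move=> Kk [v Vv wE]; split=> [|x dx]; first exact: Kdom.
  rewrite -lee_fin -(dom_val fN dx) (fS k x Kk (domS x dx)) KvalE// wE (pairB _ _ xb).
  have -> : pair k xb + c + (pair (x - k) v + (pair x xb - pair k xb)) =
    pair (x - k) v + (pair x xb + c) by ring.
  by rewrite EFinD leeD2r//; apply: ereal_sup_ubound; exists v.
have fW k x s : K k -> S x -> (forall w, W w -> fval f k + pair (x - k) w <= s) ->
    dom f x /\ fval f x <= s.
  move=> Kk Sx h; apply: (dom_of_le fN); rewrite /epi (fS k x Kk Sx) -leeBrDr//.
  apply: ge_ereal_sup => _ [v Vv <-]; rewrite -EFinB lee_fin.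
  have Wv : W (dcomb 1 v 1 xb) by exists v => // y; rewrite pair_dcomb !mul1r.
  by have := h _ Wv; rewrite pair_dcomb KvalE// !mul1r (pairB _ _ xb); lra.
have Sconv : forall t x y, 0 < t < 1 -> S x -> S y -> S (t *: x + (1 - t) *: y).
  exact: closure_convex (sum_convex cK cC).
have Sdense x : S x -> forall e : R, 0 < e ->
    exists k y, [/\ K k, C y & `|x - (k + y)| < e].
  by move=> /closureP h e /h[_ [k Kk [y Cy <-]] xky]; exists k, y.
have [v [r [N0 [r0 cv]]]] := coercive_exists fN fsint.
exists (conj_sum f); split.
  apply: conj_sum_representative => //.
  by have [u hu] := subg_exists fN fconv b0; exists x0, u.
move=> h hr.
exact: (rep_unique fN fp fconv flsc Kk0 C0 coneC (@closed_closure _ _) Sconv Sdense SKC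
  domS Ww0 KW fW hr rnp b0 r0 cv).
Qed.

End SufficientCondition.

(** * The Fitzpatrick function *)

Section MaximalMonotone.
Context {R : realType} {X : completeNormedModType R} (f : X -> \bar R).
Context (fN : forall x, f x != -oo%E) (fconv : convex_fun f)
  (flsc : lower_semicontinuous f).
Implicit Types (x y z a : X) (u v w p q : @dual R X).

(* At a boundary point [z] of the domain, any slope in the direction [e]
   compatible with [f] along the line [z + R e], which enters the interior of the
   domain, is realised by a subgradient. *)
Lemma subg_prescribed_slope z e (m r1 : R) : dom f z -> bint f (z + r1 *: e) ->
  (forall r, dom f (z + r *: e) -> fval f z + r * m <= fval f (z + r *: e)) ->
  exists v, subg f z v /\ pair e v = m.
Proof.
move=> dz [r [M [r0 h]]] slope.
(* The epigraph is smeared along the line spanned by [(e, m)], which forces the supporting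
   functional to have slope [m] in the direction [e]. *)
pose A d s := exists t, epi f (z + d + t *: e) (fval f z + s + t * m).
have [||||v vA] := @hahn_banach_epi R X A r (M - fval f z - r1 * m).
- move=> t d1 s1 d2 s2 t01 [t1 h1] [t2 h2]; exists (t * t1 + (1 - t) * t2).
  have := epi_convexP fN fconv t01 h1 h2.
  have -> : t *: (z + d1 + t1 *: e) + (1 - t) *: (z + d2 + t2 *: e) =
    z + (t *: d1 + (1 - t) *: d2) + (t * t1 + (1 - t) * t2) *: e.
    by apply: pair_ext => u; rewrite !pairE; ring.
  by congr (epi f _ _); ring.
- move=> s [t]; rewrite addr0 => /(dom_of_le fN)[dt vt].
  by have := slope _ dt; lra.
- exact: r0.
- move=> d /h[dd vd]; exists r1; rewrite addrAC; apply: (epi_val fN) => //; lra.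
have ve t : pair (- t *: e) v <= - t * m.
  apply: vA; exists t; rewrite -addrA -scalerDl addNr scale0r addr0.
  by apply: (epi_val fN) => //; lra.
exists v; split.
  split=> // y dy; suff : pair (y - z) v <= fval f y - fval f z by lra.
  apply: vA; exists 0; rewrite scale0r addr0 subrKC mul0r addr0.
  by apply: (epi_val fN) => //; lra.
by have := ve 1; have := ve (-1); rewrite !pairZ; lra.
Qed.

(** Maximal monotonicity of the subdifferential. Suppose all graph points leave a gap [de], and
    follow the segment from [x] to an interior point [u]. If the domain reaches [x] along it,
    [f - p] drops by [de] at each halving of the parameter, although a subgradient at [u] bounds it
    below. *)
Lemma subdifferential_maximal x p (de : R) : (exists x0, bint f x0) -> 0 < de ->
  exists a v, subg f a v /\ pair (a - x) v - pair (a - x) p < de.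
Proof.
move=> [u bu] de0; apply: contrapT => no.
have gap a v : subg f a v -> de <= pair (a - x) v - pair (a - x) p.
  by move=> av; rewrite leNgt; apply/negP => lt; apply: no; exists a, v.
have du := bint_dom bu.
pose e := u - x; pose at_ (t : R) := x + t *: e.
have at1 : at_ 1 = u by rewrite /at_ scale1r /e subrKC.
have atB t s : at_ t - at_ s = (t - s) *: e.
  by apply: pair_ext => v; rewrite !pairE; ring.
have at_int t s : t < s -> s <= 1 -> dom f (at_ t) -> bint f (at_ s).
  move=> ts; rewrite le_eqVlt => /predU1P[->|s1] dt; first by rewrite at1.
  have t1 : 0 < 1 - t by lra.
  have st01 : 0 < (s - t) / (1 - t) < 1.
    by rewrite divr_gt0//= ?ltr_pdivrMr//; lra.
  have := bint_segment fN fconv bu dt st01.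
  congr bint; rewrite -at1; apply: pair_ext => v; rewrite !pairE; field.
  by rewrite gt_eqF.
have [small|] := pselect (forall tau, 0 < tau -> exists2 t, 0 < t < tau & dom f (at_ t)).
  have bat t : 0 < t -> t <= 1 -> bint f (at_ t).
    by move=> t0 t1; have [s /andP[_ st] ds] := small _ t0; exact: at_int st t1 ds.
  pose phi t := fval f (at_ t) - pair (at_ t) p.
  have half t : 0 < t -> t <= 1 -> phi (t / 2) <= phi t - de.
    move=> t0 t1; have t20 : 0 < t / 2 by rewrite divr_gt0.
    have t21 : t / 2 <= 1 by lra.
    have [v tv] := subg_exists fN fconv (bat _ t20 t21).
    have := gap _ _ tv; have := tv.2 _ (bint_dom (bat _ t0 t1)).
    have -> : at_ (t / 2) - x = (t / 2) *: e by rewrite /at_ addrAC subrr add0r.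
    rewrite atB /phi (_ : t - t / 2 = t / 2); last by field.
    have : pair (at_ t) p = pair (at_ (t / 2)) p + t / 2 * pair e p.
      by rewrite -pairZ -pairD; congr pair; apply: pair_ext => w; rewrite !pairE; field.
    rewrite !pairZ; lra.
  have phin n : phi (2^-1 ^+ n) <= phi 1 - n%:R * de.
    elim: n => [|n ih]; first by rewrite expr0 mul0r subr0.
    have p0 : 0 < (2^-1 : R) ^+ n by rewrite exprn_gt0// invr_gt0.
    have p1 : (2^-1 : R) ^+ n <= 1.
      by rewrite exprn_ile1 ?invr_ge0// invf_le1// ler1n.
    by have := half _ p0 p1; rewrite exprSr (_ : n.+1%:R = n%:R + 1 :> R) ?natr1//; lra.
  have [us bus] := subg_exists fN fconv bu.
  pose B := `|pair e us| + `|pair x p| + `|pair e p| - fval f u + phi 1.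
  suff : de <= 0 by lra.
  apply: (@ler_scaled _ _ _ B) => n; rewrite mulr0 add0r.
  have p0 : 0 < (2^-1 : R) ^+ n.+1 by rewrite exprn_gt0// invr_gt0.
  have p1 : (2^-1 : R) ^+ n.+1 <= 1.
    by rewrite exprn_ile1 ?invr_ge0// invf_le1// ler1n.
  have := phin n.+1; set t := 2^-1 ^+ n.+1 in p0 p1 *.
  have := bus.2 _ (bint_dom (bat _ p0 p1)).
  have tE : at_ t - u = (t - 1) *: e by rewrite -at1 atB.
  have tpE : pair (at_ t) p = pair x p + t * pair e p by rewrite /at_ pairD pairZ.
  rewrite tE pairZ; have -> : phi t = fval f (at_ t) - (pair x p + t * pair e p) by rewrite /phi tpE.
  rewrite /B.
  have : (1 - t) * pair e us <= `|pair e us|.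
    apply: le_trans (ler_norm _) _; rewrite normrM ger0_norm; last lra.
    by rewrite -[leRHS]mul1r ler_wpM2r//; lra.
  have : t * pair e p <= `|pair e p|.
    apply: le_trans (ler_norm _) _; rewrite normrM ger0_norm ?(ltW p0)//.
    by rewrite -[leRHS]mul1r ler_wpM2r.
  have := ler_norm (pair x p); lra.
(* Otherwise the domain stops at some [t0 > 0]. The gap keeps slopes beyond [t0] at least [<e, p>],
   so the endpoint [z] lies in the domain and has a subgradient of slope exactly [<e, p>] along [e]:
   its gap is zero. *)
move=> /existsNP[tau /not_implyP[tau0 none]].
have none' t : dom f (at_ t) -> tau <= t.
  move=> dt; rewrite leNgt; apply/negP => ttau; apply: none.
  have [t0|t0] := ltP 0 t; first by exists t => //; rewrite t0.
  pose s := Num.min tau 1 / 2.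
  have m0 : 0 < Num.min tau 1 by rewrite lt_min tau0 ltr01.
  have mtau : Num.min tau 1 <= tau by rewrite ge_min lexx.
  have m1 : Num.min tau 1 <= 1 by rewrite ge_min lexx orbT.
  have s1 : s <= 1 by rewrite /s; lra.
  have ts : t < s by rewrite /s; lra.
  exists s; first by rewrite /s; apply/andP; split; lra.
  exact: bint_dom (at_int t s ts s1 dt).
pose V := [set t | dom f (at_ t)].
have hV : has_inf V by split; [exists 1; rewrite /V/= at1|exists tau => t; exact: none'].
pose t0 := inf V.
have t0tau : tau <= t0 by apply: lb_le_inf; [exact: hV.1|exact: none'].
have t0V t : dom f (at_ t) -> t0 <= t by move=> dt; apply: ge_inf => //; exact: hV.2.
have t00 : 0 < t0 by lra.
have t0int s : t0 < s -> s <= 1 -> bint f (at_ s).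
  move=> t0s s1; have s0 : 0 < s - t0 by rewrite subr_gt0.
  have [t dt ts] := inf_adherent s0 hV.
  by apply: at_int dt => //; move: ts; rewrite -/t0; lra.
have t01 : t0 < 1.
  have [r [M [r0 h]]] := bu; have ne1 : 0 < `|e| + 1 by rewrite ltr_wpDl.
  have [|d1 _] := h (- (r / (`|e| + 1)) *: e).
    rewrite normrZ normrN ger0_norm ?divr_ge0 ?(ltW r0) ?(ltW ne1)//.
    by rewrite mulrAC ler_pdivrMr// ler_wpM2l ?(ltW r0)//; lra.
  have : t0 <= 1 - r / (`|e| + 1).
    by apply: t0V; rewrite /at_ scalerBl scale1r addrA -/(at_ 1) /e subrKC -scaleNr.
  have : 0 < r / (`|e| + 1) by rewrite divr_gt0.
  lra.
pose m := pair e p.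
have slope t s : t0 < t -> t <= 1 -> t <= s -> dom f (at_ s) ->
    fval f (at_ t) + (s - t) * m <= fval f (at_ s).
  move=> t0t t1 ts ds; have [v tv] := subg_exists fN fconv (t0int t t0t t1).
  have := tv.2 _ ds; rewrite atB pairZ.
  have := gap _ _ tv; have -> : at_ t - x = t *: e by rewrite /at_ addrAC subrr add0r.
  rewrite !pairZ -mulrBr => h.
  have ev : m <= pair e v.
    by rewrite /m -subr_ge0 -(pmulr_rge0 _ (lt_trans t00 t0t)); lra.
  have := ler_wpM2l (_ : 0 <= s - t) ev; rewrite subr_ge0 => /(_ ts); lra.
pose z := at_ t0.
have zlim s : t0 < s -> dom f (at_ s) -> dom f z /\ fval f z <= fval f (at_ s) - (s - t0) * m.
  move=> t0s ds; apply: (val_lsc fN flsc) => d d0.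
  have B0 : 0 < `|e| + `|m| + 1 by rewrite ltr_wpDl// addr_ge0.
  pose g := Num.min (Num.min (1 - t0) (s - t0)) (d / 2 / (`|e| + `|m| + 1)).
  have g0 : 0 < g by rewrite !lt_min !subr_gt0 t01 t0s !divr_gt0.
  have g1 : g <= 1 - t0 by rewrite !ge_min lexx.
  have gs : g <= s - t0 by rewrite !ge_min lexx orbT.
  have gB : g * (`|e| + `|m| + 1) <= d / 2 by rewrite -ler_pdivlMr// !ge_min lexx !orbT.
  have tt : t0 < t0 + g by lra.
  have tt1 : t0 + g <= 1 by lra.
  exists (at_ (t0 + g)); split; last 2 first.
  - exact: bint_dom (t0int _ tt tt1).
  - have := slope (t0 + g) s tt tt1 _ ds; have := ler_norm m.
    have hg : g * m <= d / 2.
      apply: le_trans gB; rewrite ler_wpM2l ?(ltW g0)//.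
      by have := ler_norm m; have := normr_ge0 e; lra.
    by move=> _ /(_ _); rewrite -lerBrDl => hs; have := hs gs; lra.
  - rewrite /z distrC atB addrAC subrr add0r normrZ ger0_norm ?(ltW g0)//.
    apply: (@le_lt_trans _ _ (d / 2)); last by lra.
    apply: le_trans gB; rewrite ler_wpM2l ?(ltW g0)//.
    by have := normr_ge0 m; lra.
have [dz _] : dom f z /\ fval f z <= fval f (at_ 1) - (1 - t0) * m.
  by apply: zlim => //; rewrite at1.
have zat r : z + r *: e = at_ (t0 + r) by rewrite /z /at_ scalerDl addrA.
have [||v [zv ev]] := @subg_prescribed_slope z e m (1 - t0) dz.
- by rewrite zat subrKC at1.
- move=> r; rewrite zat => dr; have := t0V _ dr.
  rewrite lerDl le_eqVlt => /predU1P[<-|r0].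
    by rewrite addr0 mul0r addr0.
  have [|_] := zlim (t0 + r) _ dr; first by rewrite ltrDl.
  by rewrite [t0 + r]addrC addrK; lra.
have := gap _ _ zv; have -> : z - x = t0 *: e by rewrite /z /at_ addrAC subrr add0r.
by rewrite !pairZ ev -/m subrr; lra.
Qed.

End MaximalMonotone.

Section Fitzpatrick.
Context {R : realType} {X : completeNormedModType R} (f : X -> \bar R).
Context (fN : forall x, f x != -oo%E) (fconv : convex_fun f)
  (flsc : lower_semicontinuous f) (bf : exists x, bint f x).
Implicit Types (x y z a : X) (u v w p q : @dual R X).

Definition fitzpatrick x p : \bar R := ereal_sup
  [set s | exists a v, subg f a v /\ s = (pair x v + pair a p - pair a v)%:E].

Lemma fitzpatrick_leP x p s : (fitzpatrick x p <= s%:E)%E <->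
  forall a v, subg f a v -> pair x v + pair a p - pair a v <= s.
Proof.
split=> [h a v av|h].
  rewrite -lee_fin; apply: le_trans h; apply: ereal_sup_ubound.
  by exists a, v.
by apply: ge_ereal_sup => _ [a [v [av ->]]]; rewrite lee_fin; exact: h.
Qed.

Lemma fitzpatrick_ub x p a v : subg f a v ->
  ((pair x v + pair a p - pair a v)%:E <= fitzpatrick x p)%E.
Proof. by move=> av; apply: ereal_sup_ubound; exists a, v. Qed.

Lemma fitzpatrick_ge x p : ((pair x p)%:E <= fitzpatrick x p)%E.
Proof.
have main s : (fitzpatrick x p <= s%:E)%E -> pair x p <= s.
  move=> /fitzpatrick_leP h; apply/ler_addgt0Pr => e e0.
  have [a [v [av lt]]] := subdifferential_maximal fN fconv flsc x p bf e0.
  by have := h _ _ av; move: lt; rewrite !pairB; lra.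
case E: (fitzpatrick x p) => [s| |]; [|exact: leey|].
  by rewrite lee_fin; apply: main; rewrite E.
have h : pair x p <= pair x p - 1 by apply: main; rewrite E leNye.
by exfalso; clear main E; lra.
Qed.

Lemma fitzpatrick_graph x p : subg f x p -> fitzpatrick x p = (pair x p)%:E.
Proof.
move=> xp; apply/eqP; rewrite eq_le fitzpatrick_ge andbT; apply/fitzpatrick_leP.
move=> a v av; have := xp.2 _ av.1; have := av.2 _ xp.1; rewrite !pairB; lra.
Qed.

Lemma fitzpatrick_neqN x p : fitzpatrick x p != -oo%E.
Proof. by have := fitzpatrick_ge x p; case: (fitzpatrick x p). Qed.

Lemma fitzpatrick_convex : convex_fun2 fitzpatrick.
Proof.
move=> x1 x2 p1 p2 p t /andP[t0 t1] pE.
apply: ge_ereal_sup => _ [a [v [av ->]]].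
rewrite (_ : _ - _ = t * (pair x1 v + pair a p1 - pair a v) +
  (1 - t) * (pair x2 v + pair a p2 - pair a v)); last by rewrite pE !pairE; ring.
rewrite [leLHS]EFinD !EFinM; apply: leeD; apply: lee_wpmul2l.
- by rewrite lee_fin.
- exact: fitzpatrick_ub.
- by rewrite lee_fin subr_ge0.
- exact: fitzpatrick_ub.
Qed.

Lemma fitzpatrick_lsc : lsc2 fitzpatrick.
Proof.
move=> x p s sF.
have [a [v [av hs]]] : exists a v, subg f a v /\ s < pair x v + pair a p - pair a v.
  apply: contrapT => no; move: sF; rewrite ltNge => /negP; apply.
  apply/fitzpatrick_leP => a v av; rewrite leNgt; apply/negP => h.
  by apply: no; exists a, v.
have [M M0 MP] := pair_bounded v.
pose g := pair x v + pair a p - pair a v - s; have g0 : 0 < g by rewrite /g; lra.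
have B0 : 0 < M + `|a| + 1 by have := normr_ge0 a; lra.
exists (g / (M + `|a| + 1)); first by rewrite divr_gt0.
move=> y q yx /ltW/ddist_dle/(_ a) qp.
apply: lt_le_trans (fitzpatrick_ub y q av); rewrite lte_fin.
have h1 := MP (y - x); set e := g / _ in yx qp *.
have eE : e * (M + `|a| + 1) = g by rewrite /e divfK// gt_eqF.
have e0 : 0 < e by rewrite /e divr_gt0.
have h2 : M * `|y - x| <= M * e by apply: ler_wpM2l; exact: ltW.
move: qp h1; rewrite !ler_norml pairB => /andP[h3 _] /andP[h4 _].
by rewrite /g in eE *; lra.
Qed.

Lemma fitzpatrick_representative : representative f fitzpatrick.
Proof.
have [x bx] := bf; have [u xu] := subg_exists fN fconv bx.
split.
- by split; [exact: fitzpatrick_neqN|exists x, u; rewrite fitzpatrick_graph].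
- exact: fitzpatrick_convex.
- exact: fitzpatrick_lsc.
- exact: fitzpatrick_ge.
- by move=> y p /(subgP fN)/fitzpatrick_graph.
Qed.

End Fitzpatrick.

(** * Pivots of a function with a unique representative *)

Section NecessaryCondition.
Context {R : realType} {X : completeNormedModType R} (f : X -> \bar R).
Context (rnp : @RNP R X) (fN : forall x, f x != -oo%E) (fp : exists x, f x != +oo%E)
  (fconv : convex_fun f) (flsc : lower_semicontinuous f)
  (bf : exists x, bint f x) (fsing : fitzpatrick_singleton f).
Context (z : @dual R X) (r N0 : R) (r0 : 0 < r) (cz : coercive (epi f) z r N0).
Implicit Types (x y a k : X) (u v w p q : @dual R X).

Lemma fitzpatrickE : fitzpatrick f = conj_sum f.
Proof.
have [h [_ hu]] := fsing.
rewrite (hu _ (fitzpatrick_representative fN fconv flsc bf)).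
apply/esym/hu; apply: conj_sum_representative => //.
by have [x bx] := bf; have [u xu] := subg_exists fN fconv bx; exists x, u.
Qed.

(** Equality of the two representatives gives a graph point [(a, v)] with [<x, v> + <a, q> - <a, v>]
    within [e] of [f x + f^* q]. The difference is the sum of two nonnegative slacks, that of [v] at
    [x] and that of [a] in [f^* q], so both are below [e]. *)
Lemma singleton_graph x q N e : dom f x -> cj f q N -> 0 < e ->
  exists a v, [/\ subg f a v, fval f x - e <= fval f a + pair (x - a) v &
    forall y, dom f y -> pair y q - fval f y <= pair a q - fval f a + e].
Proof.
move=> dx cq e0.
have [Nq Nq_eq cNq] : exists2 Nq, fconj f q = Nq%:E & cj f q Nq.
  apply: (fconj_fin fN fp); apply: le_lt_trans (ltry N); exact/(fconj_leP fN).
have [a [v [av h]]] : exists a v, subg f a v /\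
    fval f x + Nq - e < pair x v + pair a q - pair a v.
  apply: contrapT => no.
  have : (fitzpatrick f x q <= (fval f x + Nq - e)%:E)%E.
    apply/fitzpatrick_leP => a v av; rewrite leNgt; apply/negP => h.
    by apply: no; exists a, v.
  by rewrite fitzpatrickE /conj_sum (dom_val fN dx) Nq_eq -EFinD lee_fin; lra.
exists a, v; split=> //.
  by have := cNq a av.1; move: h; rewrite pairB; lra.
move=> y dy; have := cNq y dy; have := av.2 x dx; move: h; rewrite pairB; lra.
Qed.

Definition exposing q k := subg f k q /\ forall e, 0 < e ->
  exists2 eps, 0 < eps & forall x, dom f x ->
    fval f x <= fval f k + pair (x - k) q + eps -> `|x - k| <= e.

(* By [singleton_graph], [f] is almost affine on a segment joining [x] to an almost
   maximiser of [q - f], and these cluster at [k]. *)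
Lemma exposing_affine q k x t : exposing q k -> bint f x -> 0 <= t <= 1 ->
  dom f (k + t *: (x - k)) ->
  (1 - t) * fval f k + t * fval f x <= fval f (k + t *: (x - k)).
Proof.
move=> [kq strong] bx /andP[t0 t1] dt; have dx := bint_dom bx.
have [rx [M [rx0 h]]] := bx; have [Mq Mq0 MqP] := pair_bounded q.
pose B := M - fval f x + 1.
have B0 : 0 <= B.
  have n0 : `|0 : X| <= rx by rewrite normr0 ltW.
  by have [_] := h 0 n0; rewrite addr0 /B; lra.
apply: (@ler_vanishing _ _ _ (Mq + B / rx + 1)) => e /andP[e0 e1].
have [eps eps0 near] := strong e e0.
have m0 : 0 < Num.min eps e by rewrite lt_min eps0.
have meps : Num.min eps e <= eps by rewrite ge_min lexx.
have me : Num.min eps e <= e by rewrite ge_min lexx orbT.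
have [a [v [av h1 h2]]] := singleton_graph dx (subg_cj kq) m0.
have ak : `|a - k| <= e.
  by apply: near av.1 _; have := h2 k kq.1; rewrite pairB; lra.
have vd d : `|d| <= rx -> pair d v <= B.
  move=> /h[dxd vxd]; have := av.2 _ dxd.
  have -> : x + d - a = (x - a) + d by rewrite addrAC.
  by rewrite pairD /B; lra.
have vB y : pair y v <= B / rx * `|y|.
  have [->|y0] := eqVneq y 0; first by rewrite pair0 normr0 mulr0.
  have ny : 0 < `|y| by rewrite normr_gt0.
  have := vd ((rx / `|y|) *: y); rewrite normrZ ger0_norm ?divr_ge0 ?(ltW rx0)//.
  rewrite divfK ?gt_eqF// lexx => /(_ isT); rewrite pairZ => hy.
  rewrite mulrAC ler_pdivlMr// mulrC -(ler_pM2r (_ : 0 < `|y|^-1)) ?invr_gt0//.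
  by rewrite mulfK ?gt_eqF// mulrAC.
have za := av.2 _ dt; have ka := kq.2 _ av.1.
have := MqP (a - k); rewrite ler_norml => /andP[hq _].
have hq' : Mq * `|a - k| <= Mq * e by rewrite ler_wpM2l// ltW.
have hv : pair (a - k) v <= B / rx * e.
  by apply: le_trans (vB _) _; rewrite ler_wpM2l// divr_ge0// ltW.
have zE : pair (k + t *: (x - k) - a) v = t * pair (x - a) v - (1 - t) * pair (a - k) v.
  by rewrite !pairE; ring.
rewrite zE in za.
have tB : (1 - t) * pair (a - k) v <= B / rx * e.
  apply: (@le_trans _ _ ((1 - t) * (B / rx * e))).
    by rewrite ler_wpM2l// subr_ge0.
  rewrite -[leRHS]mul1r ler_wpM2r//; last by lra.
  by rewrite mulr_ge0 ?divr_ge0 // ltW.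
have ak' : fval f k - Mq * e <= fval f a by lra.
have xa : t * (fval f x - e) <= t * (fval f a + pair (x - a) v).
  by rewrite ler_wpM2l//; lra.
have ka' : (1 - t) * (fval f k - Mq * e) <= (1 - t) * fval f a.
  by rewrite ler_wpM2l// subr_ge0.
have te : t * e <= e by rewrite -[leRHS]mul1r ler_wpM2r// ltW.
have tq : (1 - t) * (Mq * e) <= Mq * e.
  have Mqe0 : 0 <= Mq * e := mulr_ge0 (ltW Mq0) (ltW e0).
  by rewrite -[leRHS]mul1r ler_wpM2r//; lra.
lra.
Qed.

(* The set [K] of the representation: points at which every subgradient taken at an
   interior point of the domain is still a subgradient. *)
Definition pivot : set X := [set k | forall x v, bint f x -> subg f x v ->
  epi f k (fval f x + pair (k - x) v)].

Lemma pivotP k : pivot k -> dom f k /\ forall x v, bint f x -> subg f x v ->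
  fval f k <= fval f x + pair (k - x) v.
Proof.
move=> Kk; have h x v (bx : bint f x) (xv : subg f x v) := dom_of_le fN (Kk x v bx xv).
have [x bx] := bf; have [v xv] := subg_exists fN fconv bx.
by split=> [|y w by_ yw]; [exact: (h x v bx xv).1|exact: (h y w by_ yw).2].
Qed.

(** The segment from [k] to [x] is prolonged by a factor [1 + d] within the interior. On it [f] is
    affine from below, and [v], which supports [f] at the intermediate point [x], then reaches the
    value at [k]. *)
Lemma exposing_pivot q k : exposing q k -> pivot k.
Proof.
move=> qk x v bx xv; have [[dk _] _] := qk.
apply: (epi_val fN) => //; have [rx rx0 hx] := bint_usc fN fconv bx ltr01.
have n1 : 0 < `|x - k| + 1 by rewrite ltr_wpDl.
pose d := rx / (`|x - k| + 1); have d0 : 0 < d by rewrite divr_gt0.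
have [|bx' _] := hx (d *: (x - k)).
  rewrite normrZ ger0_norm ?(ltW d0)// /d mulrAC ler_pdivrMr// ler_wpM2l ?(ltW rx0)//.
  by lra.
have d1 : 0 < 1 + d by lra.
have t01 : 0 <= (1 + d)^-1 <= 1.
  by rewrite invr_ge0 ltW//= invf_le1//; lra.
have xE : k + (1 + d)^-1 *: (x + d *: (x - k) - k) = x.
  apply: pair_ext => u; rewrite !pairE; field; rewrite gt_eqF//.
have := exposing_affine qk bx' t01; rewrite xE => /(_ (bint_dom bx)) aff.
have := xv.2 _ (bint_dom bx'); rewrite addrAC subrr add0r pairZ => sub.
rewrite -(ler_pM2l d0).
have -> : pair (k - x) v = - pair (x - k) v by rewrite -pairN opprB.
have h1 : (1 + d) * ((1 - (1 + d)^-1) * fval f k + (1 + d)^-1 * fval f (x + d *: (x - k)))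
   <= (1 + d) * fval f x by rewrite ler_wpM2l// ltW.
have h2 : (1 + d) * ((1 - (1 + d)^-1) * fval f k + (1 + d)^-1 * fval f (x + d *: (x - k))) =
   d * fval f k + fval f (x + d *: (x - k)) by field; rewrite gt_eqF.
lra.
Qed.

(* A translate of the set [V] of the representation. *)
Definition copivot : set (@dual R X) := [set w | forall k, pivot k -> subg f k w].

Lemma copivot_int x v : bint f x -> subg f x v -> copivot v.
Proof.
move=> bx xv k /pivotP[dk h]; split=> // y dy.
by have := h x v bx xv; have := xv.2 y dy; rewrite !pairB; lra.
Qed.

Lemma exposing_near u rho N d : coercive (epi f) u rho N -> 0 < rho -> 0 < d ->
  exists q k, dle q u d /\ exposing q k.
Proof.
move=> cu rho0 d0; have [x0 b0] := bf; have dx0 := bint_dom b0.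
have nef : exists x s, epi f x s by exists x0, (fval f x0); exact: epi_val.
have [q [qu [k [s [ks kmin kstr]]]]] :=
  strongly_exposed rnp nef (epi_closedP fN flsc) cu rho0 d0.
have [dk vk] := dom_of_le fN ks.
have sE : s = fval f k.
  apply/eqP; rewrite eq_le vk andbT; have := kmin k (fval f k) (epi_val fN dk (lexx _)).
  by rewrite subrr pair0 addr0.
exists q, k; split=> //; split.
  by split=> // x dx; rewrite -sE; apply: kmin; exact: epi_val.
move=> e /kstr[eps eps0 h]; exists eps => // x dx hx; apply: (h x (fval f x)).
  exact: epi_val.
by rewrite sE.
Qed.

Lemma pivot_nonempty : pivot !=set0.
Proof.
have [q [k [_ qk]]] := exposing_near cz r0 ltr01.
by exists k; exact: exposing_pivot qk.
Qed.

(** The conjugate is determined by the pivots wherever it is finite: near a slight tilt of [u]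
    towards [z] there is a [q] whose conjugate is attained at a pivot. *)
Lemma cj_pivot u Nu N : cj f u Nu ->
  (forall k, pivot k -> pair k u - fval f k <= N) -> cj f u N.
Proof.
move=> cu KN x dx.
apply: (@ler_vanishing _ _ _ (N0 - N + r * `|x| + pair x u - pair x z)) => e /andP[e0 e1].
have er : 0 < e * r by rewrite mulr_gt0.
pose ut := dcomb (1 - e) u e z.
have cut : coercive (epi f) ut (e * r) ((1 - e) * Nu + e * N0).
  move=> y s ys; have [dy vy] := dom_of_le fN ys.
  by rewrite pair_dcomb; have := cu y dy; have := cz ys; nra.
(* At radius [e * r] the error [e * r * |k|], for an uncontrolled pivot [k], is cancelled by the
   coercivity of the summand [e z]. *)
have [q [k [qu qk]]] := exposing_near cut er er.
have Kk := exposing_pivot qk; have dk := (pivotP Kk).1.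
have h1 := subg_cj qk.1 dx; have h2 := KN k Kk.
have h3 := cz (epi_val fN dk (lexx _)).
have := qu x; have := qu k; rewrite !ler_norml !pair_dcomb => /andP[_ h4] /andP[h5 _].
nra.
Qed.

End NecessaryCondition.

(** * Recession directions *)

Section Sublinear.
Context {R : realType} {X : completeNormedModType R}.
Implicit Types (x y c d : X) (u v w p q : @dual R X).

(* The inf-convolution of the perspective [inf_(al >= 0) al g (x / al)] with
   [rho |.|] is the support function of [{u | |u| <= rho, u <= g}]. *)
Lemma perspective_support (D : set X) (g : X -> R) (rho : R) :
  (forall t x y, 0 < t < 1 -> D x -> D y -> D (t *: x + (1 - t) *: y) /\
     g (t *: x + (1 - t) *: y) <= t * g x + (1 - t) * g y) ->
  D !=set0 -> (forall x, D x -> 0 <= g x) -> 0 < rho ->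
  exists phi : X -> R, [/\ sublinear phi, forall c, 0 <= phi c,
    forall c, phi c <= rho * `|c|, forall x, D x -> phi x <= g x &
    forall u, (forall y, pair y u <= rho * `|y|) -> (forall x, D x -> pair x u <= g x) ->
      forall c, pair c u <= phi c].
Proof.
move=> gconv [x0 Dx0] g0 rho0.
pose V c := [set s | exists a x, [/\ 0 <= a, D x & s = a * g x + rho * `|c - a *: x|]].
have V0 c : V c (rho * `|c|) by exists 0, x0; rewrite mul0r scale0r subr0 add0r.
have Vge0 c s : V c s -> 0 <= s.
  move=> [a [x [a0 Dx ->]]]; rewrite addr_ge0// mulr_ge0//; first exact: g0.
  exact: ltW.
have hV c : has_inf (V c) by split; [exists (rho * `|c|)|exists 0 => s /Vge0].
pose phi c := inf (V c).
have phiV c s : V c s -> phi c <= s by move=> Vs; apply: ge_inf => //; exact: (hV c).2.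
have adh c e : 0 < e -> exists2 s, V c s & s < phi c + e.
  by move=> e0; have [s Vs hs] := inf_adherent e0 (hV c); exists s.
have VD c d s1 s2 : V c s1 -> V d s2 -> exists2 s, V (c + d) s & s <= s1 + s2.
  move=> [a [x [a0 Dx ->]]] [b [y [b0 Dy ->]]].
  have [aE|an0] := eqVneq a 0.
    exists (b * g y + rho * `|c + d - b *: y|); first by exists b, y.
    rewrite aE mul0r scale0r subr0 -addrA.
    have : rho * `|c + (d - b *: y)| <= rho * (`|c| + `|d - b *: y|).
      by rewrite ler_wpM2l ?(ltW rho0)// ler_normD.
    lra.
  have [bE|bn0] := eqVneq b 0.
    exists (a * g x + rho * `|c + d - a *: x|); first by exists a, x.
    rewrite bE mul0r scale0r subr0 [c + d]addrC -addrA.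
    have : rho * `|d + (c - a *: x)| <= rho * (`|d| + `|c - a *: x|).
      by rewrite ler_wpM2l ?(ltW rho0)// ler_normD.
    lra.
  have {an0}a0 : 0 < a by rewrite lt_neqAle eq_sym an0.
  have {bn0}b0 : 0 < b by rewrite lt_neqAle eq_sym bn0.
  have ab0 : 0 < a + b by rewrite addr_gt0.
  have t01 : 0 < a / (a + b) < 1 by rewrite divr_gt0//= ltr_pdivrMr//; lra.
  have [Dm gm] := gconv _ _ _ t01 Dx Dy.
  set m := _ + _ in Dm gm; exists ((a + b) * g m + rho * `|c + d - (a + b) *: m|).
    by exists (a + b), m; split=> //; exact: ltW.
  have mE : (a + b) *: m = a *: x + b *: y.
    by apply: pair_ext => u; rewrite !pairE; field; rewrite gt_eqF.
  have : (a + b) * g m <= a * g x + b * g y.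
    have -> : a * g x + b * g y = (a + b) * (a / (a + b) * g x + (1 - a / (a + b)) * g y).
      by field; rewrite gt_eqF.
    by rewrite ler_wpM2l// ltW.
  have : rho * `|c + d - (a + b) *: m| <= rho * (`|c - a *: x| + `|d - b *: y|).
    rewrite ler_wpM2l ?(ltW rho0)// mE opprD addrACA.
    exact: ler_normD.
  lra.
exists phi; split.
- split=> [c d|t c t0|].
  + apply/ler_addgt0Pr => e e0; have e2 : 0 < e / 2 by rewrite divr_gt0.
    have [s1 V1 h1] := adh c _ e2; have [s2 V2 h2] := adh d _ e2.
    by have [s Vs hs] := VD _ _ _ _ V1 V2; have := phiV _ _ Vs; lra.
  + apply/ler_addgt0Pr => e e0; have [s [a [x [a0 Dx sE]]] hs] := adh c _ (divr_gt0 e0 t0).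
    apply: (@le_trans _ _ (t * s)).
      apply: phiV; exists (t * a), x; split=> //; first by rewrite mulr_ge0// ltW.
      rewrite sE -scalerA -scalerBr normrZ ger0_norm ?(ltW t0)//; ring.
    apply: (@le_trans _ _ (t * (phi c + e / t))); first by rewrite ler_pM2l// ltW.
    by rewrite mulrDr [t * (e / t)]mulrC divfK ?gt_eqF.
  + by have := phiV _ _ (V0 0); rewrite normr0 mulr0.
- by move=> c; apply: lb_le_inf; [exact: (hV c).1|move=> s /Vge0].
- by move=> c; apply: phiV; exact: V0.
- move=> x Dx; apply: phiV; exists 1, x; split=> //.
  by rewrite mul1r scale1r subrr normr0 mulr0 addr0.
- move=> u urho ug c; apply: lb_le_inf; first exact: (hV c).1.
  move=> _ [a [x [a0 Dx ->]]].
  have := urho (c - a *: x); have := ler_wpM2l a0 (ug x Dx).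
  by rewrite pairB pairZ; lra.
Qed.

(* A Bronsted-Rockafellar statement: near any [c0] the sublinear function [phi]
   has a small subgradient, obtained by exposing [phi + tau |. - c0|] and splitting
   the exposing functional between the two summands. *)
Lemma sublinear_attained (phi : X -> R) (rho tau : R) c0 : @RNP R X ->
  sublinear phi -> (forall c, 0 <= phi c) -> (forall c, phi c <= rho * `|c|) -> 0 < tau ->
  exists c e1, [/\ phi c + tau / 2 * `|c - c0| <= phi c0,
    forall d, pair d e1 <= phi d, pair c e1 = phi c &
    forall y, `|pair y e1| <= 3 / 2 * tau * `|y|].
Proof.
move=> rnp [phiD phiZ phi0'] phi_ge0 phi_le tau0.
have phi0 : phi 0 = 0 by apply/eqP; rewrite eq_le phi0' phi_ge0.
pose psi x := phi x + tau * `|x - c0|.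
pose ep x s := psi x <= s.
have rho0 : 0 <= `|rho| by [].
have phi_le' c : phi c <= `|rho| * `|c|.
  by apply: le_trans (phi_le c) _; rewrite ler_wpM2r// ler_norm.
have clo : epi_closed ep.
  move=> x s h; rewrite /ep; apply: (@ler_vanishing _ _ _ (`|rho| + tau + 1)) => e /andP[e0 _].
  have [y [s' [xy s's ys]]] := h e e0.
  have h1 := phiD y (x - y); rewrite subrKC in h1; have h2 := phi_le' (x - y).
  have h3 := ler_distD y x c0.
  have h4 : `|rho| * `|x - y| <= `|rho| * e by rewrite ler_wpM2l// ltW.
  have h5 : tau * `|x - c0| <= tau * (e + `|y - c0|) by rewrite ler_wpM2l ?(ltW tau0)//; lra.
  by move: ys; rewrite /ep /psi; lra.
have coe : coercive ep (@dual0 R X) tau (tau * `|c0|).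
  move=> x s xs; rewrite pair_dual0 add0r; apply: le_trans xs; rewrite /psi.
  have : tau * `|x| <= tau * (`|x - c0| + `|c0|).
    by rewrite ler_wpM2l ?(ltW tau0)// -{1}(subrK c0 x) ler_normD.
  by have := phi_ge0 x; lra.
have ne : exists x s, ep x s by exists 0, (psi 0); exact: lexx.
have tau2 : 0 < tau / 2 by rewrite divr_gt0.
have [u [u0 [c [s [cs cmin _]]]]] := strongly_exposed rnp ne clo coe tau0 tau2.
have cmin' x : psi c + pair (x - c) u <= psi x.
  have hs : s = psi c.
    apply/eqP; rewrite eq_le (cs : psi c <= s) andbT.
    have h := cmin c (psi c) (lexx _); rewrite /ep subrr pair0 addr0 in h; exact: h.
  by rewrite -hs; apply: cmin; exact: lexx.
have uB y : `|pair y u| <= tau / 2 * `|y| by have := u0 y; rewrite pair_dual0 subr0.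
have phiB d : - `|rho| * `|d| <= phi (c + d) - phi c.
  by have := phiD (c + d) (- d); rewrite addrK; have := phi_le' (- d); rewrite normrN; lra.
(* A support [e1] of [A] splits [u]: [d' = 0] makes [e1] a subgradient of [phi] at [c], and
   [d' = - d] compares it with the penalty, whence its size [tau + tau / 2]. *)
pose A d s := exists d', phi (c + d + d') + tau * `|c + d' - c0| - pair d' u <= s + psi c.
have [||||e1 e1A] := @hahn_banach_epi R X A 1 `|rho|.
- move=> t d1 s1 d2 s2 /andP[t0 t1] [d1' h1] [d2' h2]; exists (t *: d1' + (1 - t) *: d2').
  have t1' : 0 < 1 - t by lra.
  have -> : c + (t *: d1 + (1 - t) *: d2) + (t *: d1' + (1 - t) *: d2') =
     t *: (c + d1 + d1') + (1 - t) *: (c + d2 + d2').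
    by apply: pair_ext => v; rewrite !pairE; ring.
  have -> : c + (t *: d1' + (1 - t) *: d2') - c0 =
     t *: (c + d1' - c0) + (1 - t) *: (c + d2' - c0).
    by apply: pair_ext => v; rewrite !pairE; ring.
  have k1 := phiD (t *: (c + d1 + d1')) ((1 - t) *: (c + d2 + d2')).
  have k2 := phiZ _ (c + d1 + d1') t0; have k3 := phiZ _ (c + d2 + d2') t1'.
  have := ler_normD (t *: (c + d1' - c0)) ((1 - t) *: (c + d2' - c0)).
  rewrite !normrZ !ger0_norm ?(ltW t0) ?(ltW t1')// => /(ler_wpM2l (ltW tau0)) k4.
  have k5 := ler_wpM2l (ltW t0) h1; have k6 := ler_wpM2l (ltW t1') h2.
  by rewrite !pairE; lra.
- move=> s' [d']; rewrite addr0; have := cmin' (c + d').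
  rewrite (_ : c + d' - c = d'); last by rewrite addrAC subrr add0r.
  by rewrite /psi; lra.
- exact: ltr01.
- move=> d d1; exists 0; rewrite !addr0 pair0 subr0 /psi.
  have := phiD c d; have := phi_le' d.
  have : `|rho| * `|d| <= `|rho| * 1 by rewrite ler_wpM2l.
  lra.
have e1_le d : pair d e1 <= phi (c + d) - phi c.
  by apply: e1A; exists 0; rewrite !addr0 pair0 subr0 /psi; lra.
have e1_phi d : pair d e1 <= phi d by have := e1_le d; have := phiD c d; lra.
have e1_tau d : pair d e1 <= 3 / 2 * tau * `|d|.
  have h1 : pair d e1 <= tau * `|d| + pair d u.
    apply: e1A; exists (- d); rewrite addrK pairN /psi.
    have : tau * `|c - d - c0| <= tau * (`|c - c0| + `|d|).
      rewrite ler_wpM2l ?(ltW tau0)// addrAC; exact: ler_normB.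
    lra.
  by have := uB d; rewrite ler_norml => /andP[_]; lra.
exists c, e1; split.
- have := cmin' c0; have := uB (c0 - c); rewrite ler_norml => /andP[h _].
  by rewrite /psi subrr normr0 mulr0 [`|c - c0|]distrC; lra.
- exact: e1_phi.
- apply/eqP; rewrite eq_le e1_phi /=.
  by have := e1_le (- c); rewrite subrr phi0 pairN; lra.
- move=> y; rewrite ler_norml e1_tau andbT.
  by have := e1_tau (- y); rewrite pairN normrN; lra.
Qed.

End Sublinear.

(** * Recession cone of the domain *)

Section Recession.
Context {R : realType} {X : completeNormedModType R} (f : X -> \bar R).
Context (rnp : @RNP R X) (fN : forall x, f x != -oo%E)
  (fconv : convex_fun f) (flsc : lower_semicontinuous f).
Implicit Types (x y c : X) (u v w p q e : @dual R X).

Definition reccone : set X := [set c | forall t x, 0 <= t ->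
  closure (dom f) x -> closure (dom f) (x + t *: c)].

Lemma reccone_cone : is_cone reccone.
Proof. by move=> l c l0 Cc t x t0 cx; rewrite scalerA; apply: Cc => //; rewrite mulr_ge0. Qed.

Lemma reccone_convex s c d : 0 < s < 1 -> reccone c -> reccone d ->
  reccone (s *: c + (1 - s) *: d).
Proof.
move=> /andP[s0 s1] Cc Cd t x t0 cx; rewrite scalerDr addrA !scalerA.
apply: Cd; first by rewrite mulr_ge0//; lra.
by apply: Cc => //; rewrite mulr_ge0// ltW.
Qed.

Lemma reccone_closed : closed reccone.
Proof.
move=> c /closureP hc t x t0 cx; apply/closureP => e e0.
have D0 : 0 < e / 2 / (t + 1) by rewrite !divr_gt0//; lra.
have [c' Cc' cc'] := hc _ D0.
have [y dy xy] := (closureP _ _).1 (Cc' t x t0 cx) (e / 2) (divr_gt0 e0 (ltr0n _ 2)).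
exists y => //; have -> : x + t *: c - y = (x + t *: c' - y) + t *: (c - c').
  by apply: pair_ext => u; rewrite !pairE; ring.
apply: le_lt_trans (ler_normD _ _) _; rewrite normrZ ger0_norm//.
have : t * `|c - c'| <= e / 2.
  apply: le_trans (ler_wpM2l t0 (ltW cc')) _.
  rewrite mulrA ler_pdivrMr; last lra.
  by rewrite mulrC ler_wpM2l//; lra.
lra.
Qed.

Lemma pivot_dom k : (exists x, bint f x) -> pivot f k -> dom f k.
Proof. by move=> bf /(pivotP fN fconv bf)[]. Qed.

Lemma pivot_convex t k l : 0 < t < 1 -> pivot f k -> pivot f l ->
  pivot f (t *: k + (1 - t) *: l).
Proof.
move=> t01 Kk Kl x v bx xv; have := epi_convexP fN fconv t01 (Kk x v bx xv) (Kl x v bx xv).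
by congr (epi f _ _); rewrite !pairE; ring.
Qed.

Lemma pivot_closed : closed (pivot f).
Proof.
move=> k /closureP hk x v bx xv; apply: (epi_closedP fN flsc) => e e0.
have [M M0 MP] := pair_bounded v.
have D0 : 0 < e / (M + 1) by rewrite divr_gt0//; lra.
have [y Ky ky] := hk _ D0; exists y, (fval f x + pair (y - x) v).
have De : e / (M + 1) * (M + 1) = e by rewrite divfK// gt_eqF//; lra.
split; last exact: Ky.
- apply: lt_le_trans ky _; rewrite ler_pdivrMr; last lra.
  by rewrite ler_peMr ?(ltW e0)//; lra.
- have := MP (k - y); rewrite ler_norml !pairB => /andP[h _].
  have := ler_wpM2l (ltW M0) (ltW ky); lra.
Qed.

Lemma closure_dom_convex t x y : 0 < t < 1 -> closure (dom f) x -> closure (dom f) y ->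
  closure (dom f) (t *: x + (1 - t) *: y).
Proof.
by apply: closure_convex => s a b s01 da db; have [] := dom_convex fN fconv s01 da db.
Qed.

(** A [p] separating [x + t c] from the closed domain is bounded above on it, so [v0 + n p] has a
    finite conjugate for all [n]. Boundedness of [<c, .>] gives [<c, p> <= 0], contrary to the
    separation. *)
Lemma reccone_of_bound c B : (exists x, bint f x) ->
  (forall w N, cj f w N -> pair c w <= B) -> reccone c.
Proof.
move=> [x0 b0] cB t x t0 cx; have [v0 v0P] := subg_exists fN fconv b0.
have cv0 := subg_cj v0P; set Nv := _ - _ in cv0.
apply: contrapT => nx.
have [rho rho0 far] := closed_dist (@closed_closure _ (dom f)) nx.
have [p pP] := separation closure_dom_convex cx far.
have pc : pair c p <= 0.
  apply: (@ler_scaled _ _ _ (B - pair c v0)) => n.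
  rewrite mulr0 add0r.
  suff /cB : cj f (dcomb 1 v0 n.+1%:R p) (Nv + n.+1%:R * (pair (x + t *: c) p - rho)).
    by rewrite pair_dcomb; lra.
  move=> y dy; rewrite pair_dcomb; have := cv0 y dy.
  have : n.+1%:R * pair y p <= n.+1%:R * (pair (x + t *: c) p - rho).
    by rewrite ler_wpM2l ?ler0n//; have := pP y (subset_closure dy); rewrite pairB; lra.
  lra.
have := pP x cx; rewrite !pairE; have := mulr_ge0_le0 t0 pc; lra.
Qed.

(* If the functionals with finite conjugate near [e] have a conjugate bounded by a
   common [N], an almost recession direction [c0] is close to a direction [c] at
   which the support function of the domain of the conjugate is attained. *)
Lemma support_attained e Ne N rho c0 eta : cj f e Ne -> 0 < rho ->
  (forall u Nu, dle u e rho -> cj f u Nu -> cj f u N) ->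
  dom f c0 -> fval f c0 - pair c0 e + N + 1 <= eta * `|c0| ->
  exists c e', [/\ forall w Nw, cj f w Nw -> pair c w <= pair c e',
    pair c e' - pair c e <= eta * `|c0| & rho / 6 * `|c - c0| <= eta * `|c0|].
Proof.
move=> ce0 rho0 nearP dc0 c0eta.
have ce : cj f e N.
  by apply: (nearP e Ne) => // x; rewrite subrr normr0 mulr_ge0// (ltW rho0).
(* The slack [1] is regained by [nearP]: a small [u <= g] gives [e + u] a conjugate at most [N + 1],
   hence at most [N], so in fact [u <= g - 1]. *)
pose g x := fval f x - pair x e + N + 1.
have gge x : dom f x -> 1 <= g x by move=> dx; have := ce x dx; rewrite /g; lra.
have [||||phi [sphi phi0 phirho phig phisup]] := @perspective_support _ _ (dom f) g rho.
- move=> t x y t01 dx dy; have [dxy h] := dom_convex fN fconv t01 dx dy; split=> //.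
  by rewrite /g !pairE; lra.
- by exists c0.
- by move=> x /gge; lra.
- exact: rho0.
have [c [e1 [cc0 e1phi ce1 e1small]]] :=
  sublinear_attained c0 rnp sphi phi0 phirho (divr_gt0 rho0 (ltr0n _ 3)).
have phic0 : phi c0 <= eta * `|c0| by apply: le_trans (phig _ dc0) c0eta.
have e1half y : `|pair y e1| <= rho / 2 * `|y|.
  by apply: le_trans (e1small y) _; rewrite ler_wpM2r//; lra.
pose e' := dcomb 1 e 1 e1.
have ce' : cj f e' N.
  apply: (nearP e' (N + 1)) => x.
    rewrite pair_dcomb !mul1r addrAC subrr add0r; apply: le_trans (e1half x) _.
    by rewrite ler_wpM2r//; lra.
  by move=> dx; rewrite pair_dcomb; have := phig x dx; have := e1phi x; rewrite /g; lra.
exists c, e'; split.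
- move=> w Nw cw; rewrite pair_dcomb !mul1r.
  have [M M0 MP] := pair_bounded (dcomb 1 w (-1) e).
  (* So small that [e1], moved by the fraction [t] towards [w - e], stays within [rho] and, by the
     slack [1], below [g]. As [e1] is maximal at [c], this bounds [<c, w>]. *)
  pose t := (1 + M / (rho / 2) + `|Nw - N|)^-1.
  have M20 : 0 < M / (rho / 2) by rewrite !divr_gt0.
  have D0 : 0 < 1 + M / (rho / 2) + `|Nw - N| by have := normr_ge0 (Nw - N); lra.
  have t0 : 0 < t by rewrite invr_gt0.
  have t1 : t <= 1 by rewrite invf_le1//; have := normr_ge0 (Nw - N); lra.
  have tN : t * (Nw - N) <= 1.
    by rewrite mulrC ler_pdivrMr// mul1r; have := ler_norm (Nw - N); lra.
  have tM : t * M <= rho / 2.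
    rewrite mulrC ler_pdivrMr// mulrC -ler_pdivrMr ?divr_gt0//.
    by have := normr_ge0 (Nw - N); lra.
  have := phisup (dcomb (1 - t) e1 t (dcomb 1 w (-1) e)) _ _ c.
  rewrite -ce1 !pair_dcomb => h.
  suff : t * (pair c w - (pair c e + pair c e1)) <= 0 by rewrite pmulr_rle0//; lra.
  suff : (1 - t) * pair c e1 + t * (1 * pair c w + -1 * pair c e) <= pair c e1 by lra.
  apply: h => y.
    rewrite pair_dcomb; have := e1half y; have := MP y.
    rewrite !ler_norml => /andP[_ h1] /andP[_ h2].
    have h3 := ler_wpM2l (ltW t0) h1.
    have h4 : t * M * `|y| <= rho / 2 * `|y| by rewrite ler_wpM2r.
    have t1' : 0 <= 1 - t by lra.
    have h5 := ler_wpM2l t1' h2.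
    have h6 : 0 <= t * (rho / 2 * `|y|) by rewrite !mulr_ge0// ltW.
    lra.
  move=> dy; rewrite !pair_dcomb /g.
  have t1' : 0 <= 1 - t by lra.
  have h1 := ce' y dy; rewrite pair_dcomb !mul1r in h1.
  have h2 := ler_wpM2l t1' h1; have h3 := ler_wpM2l (ltW t0) (cw y dy).
  lra.
- rewrite pair_dcomb !mul1r ce1; have : 0 <= rho / 3 / 2 * `|c - c0|.
    by rewrite mulr_ge0// !divr_ge0// ltW.
  lra.
- by have := phi0 c; lra.
Qed.

End Recession.

(** * Pivots plus recession directions are dense in the domain *)

Section Density.
Context {R : realType} {X : completeNormedModType R} (f : X -> \bar R).
Context (rnp : @RNP R X) (fN : forall x, f x != -oo%E) (fp : exists x, f x != +oo%E)
  (fconv : convex_fun f) (flsc : lower_semicontinuous f)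
  (bf : exists x, bint f x) (fsing : fitzpatrick_singleton f).
Context (z : @dual R X) (r N0 : R) (r0 : 0 < r) (cz : coercive (epi f) z r N0).
Implicit Types (x y c k : X) (u v w p q e : @dual R X).

Let cjp := cj_pivot rnp fN fp fconv flsc bf fsing r0 cz.

Lemma coercive_val x : dom f x -> pair x z - fval f x <= N0 - r * `|x|.
Proof. by move=> dx; have := cz (epi_val fN dx (lexx _)); lra. Qed.

(** Finiteness of the conjugate need not be an open or closed condition along a segment, so the exit
    is located by steps of length [th]. *)
Lemma last_step (P : R -> Prop) (b th : R) : 0 < th -> P 0 -> ~ P b -> 0 < b ->
  exists l l', [/\ 0 <= l < l', l' <= b, l' - l <= th, P l & ~ P l'].
Proof.
move=> th0 P0 nPb b0; apply: contrapT => no.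
have all n : P (Num.min b (n%:R * th)).
  elim: n => [|n ih]; first by rewrite mul0r min_r// ltW.
  apply: contrapT => nP.
  have [h|h] := leP b (n%:R * th); first by rewrite min_l// in ih.
  rewrite min_r ?(ltW h)// in ih; apply: no.
  exists (n%:R * th), (Num.min b (n.+1%:R * th)).
  have thS : n.+1%:R * th = n%:R * th + th by rewrite -natr1 mulrDl mul1r.
  split=> //; last 2 first.
  - by rewrite ge_min lexx.
  - by rewrite lerBlDl ge_min thS lexx orbT.
  - by rewrite mulr_ge0 ?ler0n ?(ltW th0)//= lt_min h thS ltrDl.
have [n nb] := archi_lt (b / th).
apply: nPb; have := all n.+1; rewrite min_l//.
by rewrite -ler_pdivrMr// ltW.
Qed.

(* Moving from [z] towards a functional [Y] that is bounded on the pivots but not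
   dominated by [f], one leaves the domain of the conjugate; the recession
   direction attained near the exit point contradicts [pair c p <= 0]. *)
Lemma recession_escape v0 p (s : R) Y Nv NY l1 : 0 < l1 < 1 -> 0 <= s ->
  cj f v0 Nv -> (forall x, pair x Y = pair x v0 + s * pair x p) ->
  (forall k, pivot f k -> pair k Y - fval f k <= NY) ->
  (forall N, ~ cj f (dcomb (1 - l1) z l1 Y) N) ->
  (forall c, reccone f c -> pair c p <= 0) -> False.
Proof.
move=> /andP[l10 l11] s0 cv0 YE YK nY pc.
have [M M0 MP] := pair_bounded (dcomb 1 Y (-1) z).
pose kap := 1 - l1; have kap0 : 0 < kap by rewrite /kap; lra.
pose N' := Num.max N0 NY.
have N0N' : N0 <= N' by rewrite le_max lexx.
have NYN' : NY <= N' by rewrite le_max lexx orbT.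
pose rho := kap * r; have rho0 : 0 < rho by rewrite mulr_gt0.
(* With [eta * B = rho / 2], the error [eta * |c0|] and twice [kap] times the effect on [Y - z] of
   passing from [c0] to [c] add up to half of [rho * |c0|]. *)
pose B := 1 + 2 * kap * M / (rho / 6).
have B0 : 0 < B by rewrite ltr_wpDr// ltW// divr_gt0 ?mulr_gt0// divr_gt0.
pose eta := rho / (2 * B); have eta0 : 0 < eta by rewrite divr_gt0// mulr_gt0.
pose Yl l := dcomb (1 - l) z l Y.
have P0 : exists N, cj f (Yl 0) N.
  exists N0 => x dx; have := coercive_val dx; rewrite pair_dcomb.
  by have := mulr_ge0 (ltW r0) (normr_ge0 x); lra.
have nP1 : ~ exists N, cj f (Yl l1) N by move=> [N /nY].
have [l [l' [/andP[l0 ll'] l'1 ll [Ne ce] nl']]] :=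
  last_step (P := fun l => exists N, cj f (Yl l) N) (divr_gt0 eta0 M0) P0 nP1 l10.
have nearP u Nu : dle u (Yl l) rho -> cj f u Nu -> cj f u N'.
  move=> ue cu; apply: (cjp cu) => k Kk.
  have dk := (pivotP fN fconv bf Kk).1.
  have := ue k; rewrite ler_norml pair_dcomb => /andP[_ h1].
  have h2 := coercive_val dk; have h3 := YK k Kk.
  have l1' : 0 <= 1 - l by lra.
  have h4 := ler_wpM2l l1' h2; have h5 := ler_wpM2l l0 h3.
  have h6 : rho * `|k| <= (1 - l) * (r * `|k|).
    by rewrite mulrA ler_wpM2r// ler_wpM2r ?(ltW r0)// /kap; lra.
  have h7 := ler_wpM2l l1' N0N'; have h8 := ler_wpM2l l0 NYN'.
  lra.
have ceN' : cj f (Yl l) N'.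
  by apply: (nearP _ Ne) => // x; rewrite subrr normr0 mulr_ge0// (ltW rho0).
(* The point [c0] violates the bound [N' + 1] just past the exit and respects [N'] just before it;
   as the step is [eta / M], it is almost a recession direction in the sense of
   [support_attained]. *)
have [c0 dc0 hc0] : exists2 c0, dom f c0 & N' + 1 < pair c0 (Yl l') - fval f c0.
  apply: contrapT => no; apply: nl'; exists (N' + 1) => x dx.
  by rewrite leNgt; apply/negP => h; apply: no; exists x.
have zc0 := coercive_val dc0; have ec0 := ceN' c0 dc0.
rewrite /Yl !pair_dcomb in hc0 ec0.
set D := pair c0 Y - pair c0 z.
have D0 : 0 < (l' - l) * D by rewrite /D; lra.
have Dpos : 0 < D by rewrite -(pmulr_rgt0 D (_ : 0 < l' - l))//; lra.
have rD : r * `|c0| <= D.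
  have : l' * D <= D by rewrite -[leRHS]mul1r ler_wpM2r ?(ltW Dpos)//; lra.
  by move: hc0; rewrite /D; lra.
have := MP c0; rewrite pair_dcomb ler_norml => /andP[_ MD].
have c0pos : 0 < `|c0|.
  rewrite normr_gt0; apply/eqP => c00; move: Dpos.
  by rewrite /D c00 !pair0; lra.
have c0eta : fval f c0 - pair c0 (Yl l) + N' + 1 <= eta * `|c0|.
  have h1 : (l' - l) * D <= eta / M * D by rewrite ler_wpM2r// ltW.
  have h2 : eta / M * D <= eta / M * (M * `|c0|).
    by rewrite ler_wpM2l ?divr_ge0 ?(ltW eta0) ?(ltW M0)//; rewrite /D; lra.
  have h3 : eta / M * (M * `|c0|) = eta * `|c0| by rewrite mulrA divfK// gt_eqF.
  by rewrite pair_dcomb; rewrite /D in h1 h2; lra.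
have [c [e' [csup ce' cc0]]] := support_attained rnp fN fconv ce rho0 nearP dc0 c0eta.
(* [<c, p> <= 0] yields an upper bound of order [eta * |c0|] for [(1 - l) * <c, Y - z>], while
   closeness to [c0] makes it almost [kap * r * |c0|]. *)
have cY : pair c Y <= pair c e'.
  have rc : reccone f c := reccone_of_bound fN fconv bf csup.
  have := csup _ _ cv0; rewrite YE; have := mulr_ge0_le0 s0 (pc _ rc); lra.
have := MP (c0 - c); rewrite pair_dcomb ler_norml => /andP[_].
rewrite !pairB [`|c0 - c|]distrC => Mc.
have cc0' : `|c - c0| <= eta / (rho / 6) * `|c0|.
  by rewrite mulrAC ler_pdivlMr ?divr_gt0// mulrC.
have Mc' : M * `|c - c0| <= M * (eta / (rho / 6) * `|c0|) by rewrite ler_wpM2l// ltW.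
have etaB : eta * B = rho / 2 by rewrite /eta; field; rewrite gt_eqF.
have etaB' : eta * `|c0| + 2 * kap * (M * (eta / (rho / 6) * `|c0|)) = rho / 2 * `|c0|.
  by rewrite -etaB /B; field; rewrite gt_eqF.
set Q := M * (eta / _ * _) in Mc' etaB'.
have low : r * `|c0| - Q <= pair c Y - pair c z.
  by rewrite /D in rD; lra.
have kl : kap <= 1 - l by rewrite /kap; lra.
have rc0 : 0 < kap * (r * `|c0|) by rewrite !mulr_gt0.
have kMc : kap * Q <= kap * (r * `|c0|).
  have e0 : 0 < eta * `|c0| by rewrite mulr_gt0.
  by rewrite /rho in etaB' *; lra.
have pos : 0 <= pair c Y - pair c z.
  by apply: le_trans low; move: kMc; rewrite ler_pM2l// subr_ge0.
have h1 : kap * (pair c Y - pair c z) <= (1 - l) * (pair c Y - pair c z).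
  by rewrite ler_wpM2r.
have h2 := ler_wpM2l (ltW kap0) low.
have e0 : 0 < eta * `|c0| by rewrite mulr_gt0.
rewrite /Yl pair_dcomb in ce'; rewrite /rho in etaB'.
have Q0 : 0 <= kap * Q.
  by apply: mulr_ge0 (ltW kap0) (le_trans _ Mc'); rewrite mulr_ge0// ltW.
lra.
Qed.

(** A [p] separating [x1] from pivots plus recession directions is added, with a large factor, to a
    subgradient. The resulting [Y] is bounded on the pivots but violates that bound at [x1], which
    [cj_pivot] excludes inside [dom f^*]. *)
Lemma pivot_reccone_dense x1 : dom f x1 ->
  closure [set k + y | k in pivot f & y in reccone f]%classic x1.
Proof.
move=> dx1; set D := [set _ | _ in _ & _ in _]; apply: contrapT => nD.
have [k0 Kk0] := pivot_nonempty rnp fN fp fconv flsc bf fsing r0 cz.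
have rec0 : reccone f 0 by move=> t x _; rewrite scaler0 addr0.
have pivotE k : pivot f k -> forall y, reccone f y -> D (k + y).
  by move=> Kk y Cy; exists k => //; exists y.
have Dconv t x y : 0 < t < 1 -> D x -> D y -> D (t *: x + (1 - t) *: y).
  by apply: sum_convex; [exact: pivot_convex|exact: reccone_convex].
have [rho rho0 far] := closed_dist (@closed_closure _ D) nD.
have D0 : D k0 by rewrite -[k0]addr0; exact: pivotE.
have [p pP] := separation Dconv D0 (fun x Dx => far x (subset_closure Dx)).
have [xb bx] := bf; have [v0 v0P] := subg_exists fN fconv bx.
have v0K := copivot_int fN fconv bf bx v0P.
have [dk0 sk0] := v0K k0 Kk0.
pose Nv := pair k0 v0 - fval f k0.
have cv0 : cj f v0 Nv := subg_cj (v0K k0 Kk0).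
have KNv k : pivot f k -> pair k v0 - fval f k <= Nv.
  by move=> Kk; exact: cv0 (v0K k Kk).1.
have pc c : reccone f c -> pair c p <= 0.
  move=> Cc; apply: (@ler_scaled _ _ _ (pair (x1 - k0) p - rho)) => n.
  have Cn : reccone f (n.+1%:R *: c).
    by move=> t x t0 cx; rewrite scalerA; apply: Cc => //; rewrite mulr_ge0.
  by have := pP _ (pivotE k0 Kk0 _ Cn); rewrite !pairE; lra.
have pk k : pivot f k -> pair k p <= pair x1 p - rho.
  by move=> Kk; have := pP _ (pivotE k Kk _ rec0); rewrite !pairE; lra.
(* With [s * rho = g], the value of [Y - f] at [x1] exceeds its bound [NY] over the pivots by at
   least [1]. *)
pose g := `|Nv + fval f x1 - pair x1 v0| + 1.
pose s := g / rho.
have s0 : 0 <= s by rewrite divr_ge0 ?(ltW rho0)// addr_ge0.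
have sg : s * rho = g by rewrite /s divfK// gt_eqF.
pose NY := Nv + s * (pair x1 p - rho).
pose Y := dcomb 1 v0 s p.
have YE x : pair x Y = pair x v0 + s * pair x p by rewrite pair_dcomb mul1r.
have YK k : pivot f k -> pair k Y - fval f k <= NY.
  move=> Kk; rewrite YE /NY; have := KNv k Kk; have := ler_wpM2l s0 (pk k Kk); lra.
(* If all conjugates between [z] and [Y] were finite, [cj_pivot] would carry the bound over the
   pivots to [x1], and then to [Y] in the limit. *)
have [l1 l1P nY] : exists2 l1, 0 < l1 < 1 & forall N, ~ cj f (dcomb (1 - l1) z l1 Y) N.
  apply: contrapT => no.
  suff : pair x1 Y - fval f x1 <= NY.
    by rewrite YE /NY; have := ler_norm (Nv + fval f x1 - pair x1 v0); rewrite -/g; rewrite /g in sg; lra.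
  apply: (@ler_vanishing _ _ _ (N0 - NY + pair x1 Y - pair x1 z)) => e e01.
  have /andP[e0 e1] := e01.
  have l01 : 0 < 1 - e < 1 by lra.
  have [N cN] : exists N, cj f (dcomb (1 - (1 - e)) z (1 - e) Y) N.
    apply: contrapT => nN; apply: no; exists (1 - e) => // N cN.
    by apply: nN; exists N.
  have := cjp cN (N := e * N0 + (1 - e) * NY) _ dx1.
  rewrite pair_dcomb => h; have {}h := h _; move: h.
  set a := pair x1 Y; set b := pair x1 z; set d := fval f x1 => h.
  suff : (1 - (1 - e)) * b + (1 - e) * a - d <= e * N0 + (1 - e) * NY by lra.
  apply: h => k Kk; rewrite pair_dcomb.
  have dk := (pivotP fN fconv bf Kk).1.
  have e1' : 0 <= 1 - e by lra.
  have h2 := ler_wpM2l (ltW e0) (coercive_val dk).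
  have h3 := ler_wpM2l e1' (YK k Kk).
  have h4 : 0 <= e * (r * `|k|) by rewrite !mulr_ge0// ltW.
  lra.
exact: (recession_escape l1P s0 cv0 YE YK nY pc).
Qed.

End Density.

(** * The decomposition *)

Section Decomposition.
Context {R : realType} {X : completeNormedModType R} (f : X -> \bar R).
Context (rnp : @RNP R X) (fN : forall x, f x != -oo%E) (fp : exists x, f x != +oo%E)
  (fconv : convex_fun f) (flsc : lower_semicontinuous f)
  (bf : exists x, bint f x) (fsing : fitzpatrick_singleton f).
Context (z : @dual R X) (r N0 : R) (r0 : 0 < r) (cz : coercive (epi f) z r N0).
Implicit Types (x y c k : X) (u v w p q : @dual R X).

(** [x] is replaced by a nearby point [y] of the domain; the difference, scaled by [(1 - t) / t], is
    absorbed by the ball around [x0]. *)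
Lemma bint_segment_closure x0 x t : bint f x0 -> closure (dom f) x -> 0 < t < 1 ->
  bint f (t *: x0 + (1 - t) *: x).
Proof.
move=> b0 /closureP cx /andP[t0 t1]; have [rx rx0 hx] := bint_usc fN fconv b0 ltr01.
have t1' : 0 < 1 - t by lra.
have [y dy xy] := cx (rx * t / (1 - t)) (divr_gt0 (mulr_gt0 rx0 t0) t1').
have -> : t *: x0 + (1 - t) *: x = t *: (x0 + ((1 - t) / t) *: (x - y)) + (1 - t) *: y.
  by apply: pair_ext => u; rewrite !pairE; field; rewrite gt_eqF.
apply: (bint_segment fN fconv) => //; last by rewrite t0.
apply: (hx _ _).1; rewrite normrZ ger0_norm ?divr_ge0 ?(ltW t0) ?(ltW t1')//.
by rewrite mulrAC ler_pdivrMr// mulrC -ler_pdivlMr// ltW.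
Qed.

(** At [xt], slightly inside the domain, any subgradient [v] is a copivot and
    [f xt <= f k + <xt - k, v>]. This affine bound is at most [f x0] at [x0] and at most [s] at [x];
    let [xt] tend to [x]. *)
Lemma copivot_upper k x s : pivot f k -> closure (dom f) x ->
  (forall w, copivot f w -> fval f k + pair (x - k) w <= s) -> dom f x /\ fval f x <= s.
Proof.
move=> Kk cx h; have [x0 b0] := bf; apply: (val_lsc fN flsc) => e e0.
pose g := 2 + `|x - x0| / e + `|fval f x0 - s| / e.
have n1 : 0 <= `|x - x0| / e by rewrite divr_ge0// ltW.
have n2 : 0 <= `|fval f x0 - s| / e by rewrite divr_ge0// ltW.
have g0 : 0 < g by rewrite /g; lra.
pose t := g^-1; have t0 : 0 < t by rewrite invr_gt0.
have t1 : t < 1 by rewrite invf_lt1// /g; lra.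
have t01 : 0 < t < 1 by rewrite t0.
have bt := bint_segment_closure b0 cx t01.
set xt := _ + _ in bt; have [v xv] := subg_exists fN fconv bt.
have vK := copivot_int fN fconv bf bt xv.
exists xt; split.
- have -> : x - xt = t *: (x - x0) by apply: pair_ext => u; rewrite !pairE; ring.
  rewrite normrZ ger0_norm ?(ltW t0)// mulrC ltr_pdivrMr// mulrC -ltr_pdivrMr//.
  by rewrite /g; lra.
- exact: bint_dom.
- have h1 := (vK k Kk).2 x0 (bint_dom b0); have h2 := h v vK.
  have h3 := xv.2 k (vK k Kk).1.
  have h4 : t * (fval f x0 - s) <= e.
    rewrite mulrC ler_pdivrMr// mulrC -ler_pdivrMr// /g.
    have : (fval f x0 - s) / e <= `|fval f x0 - s| / e.
      by rewrite ler_wpM2r ?invr_ge0 ?(ltW e0)// ler_norm.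
    lra.
  have h5 := ler_wpM2l (ltW t0) h1.
  have t1' : 0 <= 1 - t by lra.
  have h6 := ler_wpM2l t1' h2.
  by move: h3 h5 h6; rewrite !pairE; lra.
Qed.

Lemma singleton_formula :
   exists (c : R) (xb : dual) (K C : set X) (V : set (@dual R X)),
     [/\ closed K, convex_set K & K !=set0] /\ [/\ closed C, convex_set C & is_cone C] /\
     [/\ weakstar_closed V, convex_dual V,
         (exists z, V z /\ forall x, pair x z = 0),
         (forall k1 k2 v, K k1 -> K k2 -> V v -> pair (k1 - k2) v = 0) &
         (forall xh, K xh -> forall x,
            f x = (support_fun V (x - xh)%R + ind_set (closure [set (k + y)%R | k in K & y in C]) x
                   + (pair x xb)%:E + c%:E)%E)].
Proof.
have [k0 Kk0] := pivot_nonempty rnp fN fp fconv flsc bf fsing r0 cz.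
have [x0 b0] := bf; have [xb xbP] := subg_exists fN fconv b0.
have Wxb := copivot_int fN fconv bf b0 xbP.
pose V : set (@dual R X) :=
  [set v | exists2 w, copivot f w & forall x, pair x v = pair x w - pair x xb].
have V0 v : (forall x, pair x v = 0) -> V v.
  by move=> v0; exists xb => // x; rewrite v0 subrr.
(* The subgradient inequalities of [w] at two pivots are opposite; as the left side is independent
   of [w], differences of copivots vanish on [K - K]. *)
have Kconst k1 k2 w : pivot f k1 -> pivot f k2 -> copivot f w ->
    fval f k2 - fval f k1 = pair (k2 - k1) w.
  move=> K1 K2 Ww; have [d1 h1] := Ww k1 K1; have [d2 h2] := Ww k2 K2.
  by have := h1 _ d2; have := h2 _ d1; rewrite !pairB; lra.
exists (fval f k0 - pair k0 xb), xb, (pivot f), (reccone f), V.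
split; [|split]; first split.
- exact: pivot_closed.
- by apply/convex_setP; exact: pivot_convex.
- by exists k0.
- split; [exact: reccone_closed| |exact: reccone_cone].
  by apply/convex_setP; exact: reccone_convex.
split.
(* Up to translation [V] is cut out by inequalities on the values at [y - k]; a violated one, with
   its gap as radius, is a weak* neighbourhood that misses [V]. *)
- move=> p nVp; apply: contrapT => no.
  apply: nVp; exists (dcomb 1 p 1 xb) => [|x]; last by rewrite pair_dcomb; ring.
  move=> k Kk; split; first exact: pivot_dom Kk.
  move=> y dy; rewrite leNgt; apply/negP => gap; apply: no.
  exists [:: y - k]; exists (fval f k + pair (y - k) (dcomb 1 p 1 xb) - fval f y).
    by rewrite subr_gt0.
  move=> q /(_ (y - k) (or_introl erefl)) + [w Ww wE].
  rewrite wE ltr_norml pair_dcomb => /andP[h _].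
  by have := (Ww k Kk).2 y dy; lra.
- move=> p q v t [w1 W1 E1] [w2 W2 E2] /andP[t0 t1] vE.
  exists (dcomb t w1 (1 - t) w2) => [k Kk|x]; last by rewrite vE E1 E2 pair_dcomb; ring.
  have [dk h1] := W1 k Kk; have [_ h2] := W2 k Kk; split=> // y dy.
  have t1' : 0 <= 1 - t by lra.
  have := ler_wpM2l t0 (h1 y dy); have := ler_wpM2l t1' (h2 y dy).
  by rewrite pair_dcomb; lra.
- exists (@dual0 R X); split; last exact: pair_dual0.
  by apply: V0 => x; exact: pair_dual0.
- move=> k1 k2 v K1 K2 [w Ww ->].
  by rewrite -(Kconst _ _ _ K2 K1 Ww) -(Kconst _ _ _ K2 K1 Wxb) subrr.
move=> k Kk x; set S := closure _; set a := (pair x xb + (fval f k0 - pair k0 xb))%R.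
rewrite -addeA -EFinD -/a.
have aE : a = (pair (x - k) xb + fval f k)%R.
  by have := Kconst _ _ _ Kk Kk0 Wxb; rewrite /a !pairB; lra.
have supp_ge0 : (0 <= support_fun V (x - k)%R)%E.
  apply: ereal_sup_ubound; exists (@dual0 R X); last by rewrite pair_dual0.
  by apply: V0 => y; exact: pair_dual0.
have [Sx|nSx] := pselect (S x); last first.
  rewrite /ind_set asboolF// addey ?addye//; last first.
    by rewrite -ltNye (lt_le_trans _ supp_ge0)// ltNy0.
  apply/eqP; rewrite -leye_eq leNgt; apply/negP => dx; apply: nSx.
  exact: (pivot_reccone_dense rnp fN fp fconv flsc bf fsing r0 cz).
have clx : closure (dom f) x.
  apply: closed_closure; apply: closure_subset Sx => _ [l Kl [y Cy <-]].
  rewrite -[y]scale1r; apply: Cy => //; apply: subset_closure; exact: pivot_dom Kl.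
rewrite /ind_set asboolT// adde0; apply/eqP; rewrite eq_le; apply/andP; split; last first.
  rewrite -leeBrDr//; apply: ge_ereal_sup => _ [v [w Ww wE] <-]; rewrite leeBrDr//.
  have [_] := (subgP fN k w).2 (Ww k Kk); move=> /(_ x).
  by rewrite wE aE (dom_val fN (pivot_dom fN fconv bf Kk)) -!EFinD addrA subrK addrC.
have Bub w : copivot f w -> ((pair (x - k) w - pair (x - k) xb)%R%:E <= support_fun V (x - k)%R)%E.
  move=> Ww; apply: ereal_sup_ubound; exists (dcomb 1 w (-1) xb).
    by exists w => // y; rewrite pair_dcomb; ring.
  by congr EFin; rewrite pair_dcomb; ring.
case: (support_fun V (x - k)) supp_ge0 Bub => [B| |] // _ Bub; last by rewrite addye// leey.
have [dx vx] : dom f x /\ fval f x <= B + a.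
  apply: (copivot_upper Kk clx) => w /Bub; rewrite lee_fin aE; lra.
by rewrite (dom_val fN dx) -EFinD lee_fin.
Qed.

End Decomposition.

Unset Implicit Arguments.

Theorem theoremB (R : realType) (X : completeNormedModType R) (f : X -> \bar R) :
  @RNP R X ->
  (forall x, f x != -oo%E) -> (exists x, f x != +oo%E) ->
  convex_fun f -> lower_semicontinuous f ->
  interior (dom f) !=set0 ->
  dual_int_nonempty (dom_dual (fconj f)) ->
  (fitzpatrick_singleton f <->
   exists (c : R) (xb : dual) (K C : set X) (V : set (@dual R X)),
     [/\ closed K, convex_set K & K !=set0] /\ [/\ closed C, convex_set C & is_cone C] /\
     [/\ weakstar_closed V, convex_dual V,
         (exists z, V z /\ forall x, pair x z = 0),
         (forall k1 k2 v, K k1 -> K k2 -> V v -> pair (k1 - k2) v = 0) &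
         (forall xh, K xh -> forall x,
            f x = (support_fun V (x - xh)%R + ind_set (closure [set (k + y)%R | k in K & y in C]) x
                   + (pair x xb)%:E + c%:E)%E)]).
Proof.
move=> rnp fN fp fconv flsc fint fsint; split.
  move=> fsing; have [z [r [N0 [r0 cz]]]] := coercive_exists fN fsint.
  exact: singleton_formula rnp fN fp fconv flsc (bint_exists fN flsc fint) fsing _ _ _ r0 cz.
by case=> [c [xb [K [C [V [hK [hC [_ _ hV _ fE]]]]]]]]; exact: formula_singleton fE.
Qed.
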